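(* Let $\varphi\in L^2(\mathbb{R})$ be such that $\Phi_\varphi$ has singularities only at finitely many points $X=\{x_1,\dots,x_s\}\subset\mathbb{T}$ (distinct points), the order of the singularity at $x_j$ being $\lambda_j\in\mathbb{N}$, $1\le j\le s$. Put $|\Lambda|=\sum_{j=1}^s\lambda_j$ and assume $|\Lambda|\ge 1$. Let $\Omega\subset\mathbb{Z}$ be a set of $|\Lambda|$ consecutive integers and $\Omega^c=\mathbb{Z}\setminus\Omega$. Then the system $\{\varphi(\cdot+k)\}_{k\in\Omega^c}$ is an $M$-basis in $S(\varphi)$.
   Context: $\mathbb{T}=\mathbb{R}/\mathbb{Z}$, $\mathbb{N}=\{1,2,\dots\}$. The Fourier transform on $L^2(\mathbb{R})$ is the isometry given for $f\in L^1(\mathbb{R})\cap L^2(\mathbb{R})$ by $\widehat f(y)=\int_{\mathbb{R}}f(x)e^{-2\pi ixy}\,dx$. For $\varphi\in L^2(\mathbb{R})$, $\Phi_\varphi(t)=\sum_{k\in\mathbb{Z}}|\widehat\varphi(t+k)|^2$, a $1$-periodic nonnegative function in $L^1(\mathbb{T})$. $S(\varphi)$ is the closed linear span in $L^2(\mathbb{R})$ of $\{\varphi(\cdot+k):k\in\mathbb{Z}\}$. Singularities: a nonnegative measurable function $w$ on $\mathbb{R}$ has a singularity of order $k\in\mathbb{N}$ at $x_0\in\mathbb{R}$ if there is a (bounded open) interval $I$ centered at $x_0$ such that $\frac{(x-x_0)^{2(k-1)}}{w(x)}\notin L^1(I)$ but $\frac{(x-x_0)^{2k}}{w(x)}\in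 L^1(I)$. For the periodic function $\Phi_\varphi$, points of $\mathbb{T}$ are identified with their representatives in $\mathbb{R}$. ''Singularities only at the points of $X$'' means that $1/\Phi_\varphi$ is integrable in a neighbourhood of every point of $\mathbb{T}\setminus X$. A system $\{y_k\}$ in a Banach space $B$ is an $M$-basis if it is complete (its linear span is dense in $B$) and minimal (no $y_k$ lies in the closed linear span of the others), and its dual (biorthogonal) system $\{y_k^*\}\subset B^*$, $y_k^*(y_j)=\delta_{jk}$, is total with respect to $B$, i.e. $y_k^*(x)=0$ for all $k$ implies $x=0$. *)

(* Defs.v *)
From HB Require Import structures.
From mathcomp Require Import all_boot all_order all_algebra.
From mathcomp Require Import complex.
From mathcomp Require Import all_classical all_reals all_analysis.

Set Implicit Arguments.
Unset Strict Implicit.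
Unset Printing Implicit Defensive.

Import Order.TTheory GRing.Theory Num.Theory.
Import numFieldNormedType.Exports.
Import ComplexField.Normc.

Local Open Scope classical_set_scope.
Local Open Scope ring_scope.

(* Elements of L^2(R) are represented by complex-valued functions on the line;
   two functions represent the same element when they agree almost everywhere,
   i.e. when the L^2-norm of their difference vanishes.  The predicates below
   do not distinguish between such representatives. *)
Section complex_L2.
Context {R : realType}.
Local Notation mu := (@lebesgue_measure R).
Implicit Types f g : R -> R[i].

Definition cmeasurable f : Prop :=
  measurable_fun [set: R] (fun x => complex.Re (f x)) /\
  measurable_fun [set: R] (fun x => complex.Im (f x)).

Definition cLnorm (p : \bar R) f : \bar R :=
  Lnorm mu p (fun x => (normc (f x))%:E).

Definition cLp (p : \bar R) : set (R -> R[i]) :=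
  [set f | cmeasurable f /\ (cLnorm p f < +oo)%E].

Definition cintegral f : R[i] :=
  Complex (\int[mu]_x complex.Re (f x)) (\int[mu]_x complex.Im (f x)).

Definition expi (t : R) : R[i] := Complex (cos t) (sin t).

Definition fourier_integral f : R -> R[i] :=
  fun y => cintegral (fun x => f x * expi (- (2 * pi * x * y))).

(* [g] represents the Fourier transform of [f] in L^2(R): the continuous
   extension to L^2 of the integral formula on the dense subspace of functions
   both in L^1 and in L^2. *)
Definition is_fourier_transform f g : Prop :=
  [/\ cLp 2%:E f, cLp 2%:E g &
    exists u : nat -> R -> R[i],
      [/\ forall n, cLp 1%:E (u n) /\ cLp 2%:E (u n),
          cLnorm 2%:E (u n \- f) @[n --> \oo] --> 0%E &
          cLnorm 2%:E (fourier_integral (u n) \- g) @[n --> \oo] --> 0%E]].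

Definition translate f (k : int) : R -> R[i] := fun x => f (x + k%:~R).

(* [periodization phihat] is the function Phi_phi when phihat represents the
   Fourier transform of phi; it may take the value +oo. *)
Definition periodization (phihat : R -> R[i]) (t : R) : \bar R :=
  (\esum_(k in [set: int]) (normc (phihat (t + k%:~R)) ^+ 2)%:E)%E.

Definition span_of (I : eqType) (J : set I) (y : I -> R -> R[i]) :
    set (R -> R[i]) :=
  [set f | exists (s : seq I) (c : I -> R[i]),
    (forall k, k \in s -> J k) /\ f = (fun x => \sum_(k <- s) c k * y k x)].

Definition closed_span (I : eqType) (J : set I) (y : I -> R -> R[i]) :
    set (R -> R[i]) :=
  [set f | cLp 2%:E f /\
    forall e : R, 0 < e ->
      exists2 g, span_of J y g & (cLnorm 2%:E (f \- g)%R < e%:E)%E].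

Definition shift_space (phi : R -> R[i]) : set (R -> R[i]) :=
  closed_span [set: int] (translate phi).

(* The bound forces [l] to take the same value on two representatives of the
   same element of L^2. *)
Definition bounded_functional (B : set (R -> R[i])) (l : (R -> R[i]) -> R[i]) :
    Prop :=
  (forall (a : R[i]) f g, B f -> B g ->
     l (fun x => a * f x + g x) = a * l f + l g) /\
  (exists M : R, forall f, B f -> ((normc (l f))%:E <= M%:E * cLnorm 2%:E f)%E).

(* Here [B] is a closed linear subspace of L^2(R), seen as a Banach space, and
   the system is the restriction to [J] of the family [y]. *)
Definition complete_in (I : eqType) (J : set I) (y : I -> R -> R[i])
    (B : set (R -> R[i])) : Prop :=
  (forall k, J k -> B (y k)) /\ B `<=` closed_span J y.

Definition minimal_system (I : eqType) (J : set I) (y : I -> R -> R[i]) : Prop :=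
  forall k, J k -> ~ closed_span (J `\ k) y (y k).

Definition dual_system (I : eqType) (J : set I) (y : I -> R -> R[i])
    (B : set (R -> R[i])) (ystar : I -> (R -> R[i]) -> R[i]) : Prop :=
  (forall k, J k -> bounded_functional B (ystar k)) /\
  (forall j k, J j -> J k -> ystar k (y j) = (j == k)%:R).

Definition total_system (I : eqType) (J : set I) (B : set (R -> R[i]))
    (ystar : I -> (R -> R[i]) -> R[i]) : Prop :=
  forall f, B f -> (forall k, J k -> ystar k f = 0) ->
    {ae mu, forall x, f x = 0}.

(* The dual system of a complete minimal system exists and is unique. *)
Definition M_basis (I : eqType) (J : set I) (y : I -> R -> R[i])
    (B : set (R -> R[i])) : Prop :=
  [/\ complete_in J y B, minimal_system J y &
      exists2 ystar, dual_system J y B ystar & total_system J B ystar].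

(* In [\bar R], the inverse of 0 is +oo and the inverse of +oo is 0, so that
   the zeros of [w] do contribute to non-integrability. *)
Definition weighted_inverse (w : R -> \bar R) (m : nat) (x0 : R) : R -> \bar R :=
  fun x => (((x - x0) ^+ (2 * m))%:E * (w x)^-1)%E.

Definition has_singularity (w : R -> \bar R) (k : nat) (x0 : R) : Prop :=
  (0 < k)%N /\
  exists2 r : R, 0 < r &
    ~ mu.-integrable `]x0 - r, x0 + r[ (weighted_inverse w k.-1 x0) /\
    mu.-integrable `]x0 - r, x0 + r[ (weighted_inverse w k x0).

Definition inverse_integrable_near (w : R -> \bar R) (x0 : R) : Prop :=
  exists2 r : R, 0 < r &
    mu.-integrable `]x0 - r, x0 + r[ (fun x => (w x)^-1%E).

Definition eq_mod1 (x y : R) : Prop := exists m : int, x - y = m%:~R.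

Definition singularities_exactly (w : R -> \bar R) (s : nat) (x : 'I_s -> R)
    (lambda : 'I_s -> nat) : Prop :=
  [/\ forall i j, eq_mod1 (x i) (x j) -> i = j,
      forall j, has_singularity w (lambda j) (x j) &
      forall t, (forall j, ~ eq_mod1 t (x j)) -> inverse_integrable_near w t].

End complex_L2.

Definition consecutive_integers (Omega : set int) (m : nat) : Prop :=
  exists n : int, Omega = [set k : int | n <= k < n + m%:Z].

(* Main.v *)
Require Import Defs.
From mathcomp Require Import all_boot all_order all_algebra.
From mathcomp Require Import complex.
From mathcomp Require Import all_classical all_reals all_analysis.
From mathcomp Require Import measurable_realfun.
From mathcomp Require Import ring lra.

(* By Plancherel, [sum_k c_k phi(. + k)] has the same norm as [(sum_k c_k e_k) sqrt w] in
   L^2(0, 1), where [e_k t = exp (2 i pi k t)] and [w] is the periodization of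
   [|phihat|^2].  Let [W = prod_j (X - e_1(x_j))^lambda_j]: it has degree |Lambda|,
   |W|^2 / w is integrable, and a polynomial [q] with |q|^2 / w integrable is divisible
   by [W].
   - Complete: a function orthogonal to the system is [P / sqrt w] with [P] a
     trigonometric polynomial with spectrum in Omega, so W | P and P = 0 by degree.
   - Minimal: for [k] outside Omega, subtracting from [e_k] a combination of the
     exponentials of Omega yields a multiple [D] of [W]; then [D / sqrt w] is
     orthogonal to the other elements of the system.
   - Total: if the dual functionals vanish on [f], the coefficients of finite sums
     approximating [f] tend to 0, so the limit [F] on the Fourier side is orthogonal
     to all [e_m W / sqrt w]; then F conj(W) / sqrt w has vanishing Fourier
     coefficients, whence F = 0. *)

Set Implicit Arguments.
Unset Strict Implicit.
Unset Printing Implicit Defensive.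

Import Order.TTheory GRing.Theory Num.Theory.
Import numFieldNormedType.Exports.
Import ComplexField.Normc.

Local Open Scope classical_set_scope.
Local Open Scope ring_scope.

(* The hint of the library for this instance does not fire on [lebesgue_measure]. *)
#[local] Instance ae_lebesgue_filter {R : realType} :
  Filter (almost_everywhere (@lebesgue_measure R)).
Proof. exact: ae_filter_ringOfSetsType. Qed.

Section complex_numbers.
Context {R : realType}.
Implicit Types z w : R[i].

Lemma ReD z w : complex.Re (z + w) = complex.Re z + complex.Re w.
Proof. by case: z w => [a b] [c d]. Qed.

Lemma ImD z w : complex.Im (z + w) = complex.Im z + complex.Im w.
Proof. by case: z w => [a b] [c d]. Qed.

Lemma ReN z : complex.Re (- z) = - complex.Re z.
Proof. by case: z. Qed.

Lemma ImN z : complex.Im (- z) = - complex.Im z.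
Proof. by case: z. Qed.

Lemma ReM z w : complex.Re (z * w) =
  complex.Re z * complex.Re w - complex.Im z * complex.Im w.
Proof. by case: z w => [a b] [c d]. Qed.

Lemma ImM z w : complex.Im (z * w) =
  complex.Re z * complex.Im w + complex.Im z * complex.Re w.
Proof. by case: z w => [a b] [c d]. Qed.

Lemma Re_conjc z : complex.Re (conjc z) = complex.Re z.
Proof. by case: z. Qed.

Lemma Im_conjc z : complex.Im (conjc z) = - complex.Im z.
Proof. by case: z. Qed.

Lemma Re_real (a : R) : complex.Re (a%:C)%C = a.
Proof. by []. Qed.

Lemma Re_realM (a : R) z : complex.Re ((a%:C)%C * z) = a * complex.Re z.
Proof. by rewrite ReM /= mul0r subr0. Qed.

Lemma complex_ext z w :
  complex.Re z = complex.Re w -> complex.Im z = complex.Im w -> z = w.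
Proof. by case: z w => [a b] [c d] /= -> ->. Qed.

Lemma normc_ge0 z : 0 <= normc z.
Proof. exact: (normr_ge0 (z : Rcomplex R)). Qed.

Lemma normc_eq0 z : (normc z == 0) = (z == 0).
Proof. exact: (normr_eq0 (z : Rcomplex R)). Qed.

Lemma sqr_normcE z : normc z ^+ 2 = complex.Re z ^+ 2 + complex.Im z ^+ 2.
Proof. by case: z => a b /=; rewrite sqr_sqrtr// addr_ge0// sqr_ge0. Qed.

Lemma normc_conjc z : normc (conjc z) = normc z.
Proof. by case: z => a b /=; rewrite sqrrN. Qed.

Lemma normc_real (a : R) : normc (a%:C)%C = `|a|.
Proof. by rewrite /= expr0n/= addr0 sqrtr_sqr. Qed.

Lemma normcX z n : normc (z ^+ n) = normc z ^+ n.
Proof.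
by elim: n => [|n IHn]; rewrite ?expr0 ?normc1// !exprS normcM IHn.
Qed.

Lemma ler_normc_sum (I : Type) (r : seq I) (F : I -> R[i]) :
  normc (\sum_(i <- r) F i) <= \sum_(i <- r) normc (F i).
Proof.
apply: (big_ind2 (fun z b => normc z <= b)) => //; first by rewrite normc0.
by move=> z b w d zb wd; rewrite (le_trans (le_normcD _ _))// lerD.
Qed.

Lemma conjcD z w : conjc (z + w) = conjc z + conjc w.
Proof. exact: rmorphD. Qed.

Lemma conjcM z w : conjc (z * w) = conjc z * conjc w.
Proof. exact: rmorphM. Qed.

Lemma conjcX z n : conjc (z ^+ n) = conjc z ^+ n.
Proof. exact: rmorphXn. Qed.

Lemma mulcJ z : z * conjc z = ((normc z ^+ 2)%:C)%C.
Proof. by rewrite -sqr_normc -(rmorphXn (real_complex R)). Qed.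

Lemma ler_Re_normc z : `|complex.Re z| <= normc z.
Proof.
rewrite -(@ler_pXn2r _ 2)// ?nnegrE ?normc_ge0// sqr_normcE.
by rewrite real_normK ?num_real// lerDl sqr_ge0.
Qed.

Lemma ler_Im_normc z : `|complex.Im z| <= normc z.
Proof.
rewrite -(@ler_pXn2r _ 2)// ?nnegrE ?normc_ge0// sqr_normcE.
by rewrite real_normK ?num_real// lerDr sqr_ge0.
Qed.

Lemma normc_le_ReIm z : normc z <= `|complex.Re z| + `|complex.Im z|.
Proof.
rewrite -(@ler_pXn2r _ 2)// ?nnegrE ?normc_ge0 ?addr_ge0// sqr_normcE sqrrD.
by rewrite !real_normK ?num_real// lerD2r lerDl mulrn_wge0 ?mulr_ge0.
Qed.

Lemma sqr_normcD_le z w :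
  normc (z + w) ^+ 2 <= 2 * normc z ^+ 2 + 2 * normc w ^+ 2.
Proof.
rewrite (@le_trans _ _ ((normc z + normc w) ^+ 2))//.
  by rewrite ler_pXn2r ?nnegrE ?addr_ge0 ?normc_ge0 ?le_normcD.
have := sqr_ge0 (normc z - normc w); rewrite sqrrB sqrrD; lra.
Qed.

Lemma expiD (s t : R) : expi (s + t) = expi s * expi t.
Proof.
apply: complex_ext; rewrite (ReM, ImM)/= ?cosD ?sinD //.
by rewrite addrC.
Qed.

Lemma expi0 : expi (0 : R) = 1.
Proof. by rewrite /expi cos0 sin0. Qed.

Lemma conjc_expi (t : R) : conjc (expi t) = expi (- t).
Proof. by rewrite /expi/= cosN sinN. Qed.

Lemma normc_expi (t : R) : normc (expi t) = 1.
Proof. by rewrite /= cos2Dsin2 sqrtr1. Qed.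

Lemma expi_natM (t : R) n : expi (t * n%:R) = expi t ^+ n.
Proof.
elim: n => [|n IHn]; first by rewrite mulr0 expi0 expr0.
by rewrite -natr1 mulrDr mulr1 expiD IHn exprSr.
Qed.

Lemma expi_2pi_int (m : int) : expi (2 * pi * m%:~R) = 1 :> R[i].
Proof.
have expi_2pi_nat n : expi (2 * pi * n%:R) = 1 :> R[i].
  by rewrite expi_natM /expi mulr_natl cos2pi sin2pi expr1n.
case: m => m; first exact: expi_2pi_nat.
by rewrite NegzE mulrNz mulrN -conjc_expi -pmulrn expi_2pi_nat conjc1.
Qed.

End complex_numbers.

Section complex_measurable.
Context {R : realType}.
Implicit Types f g : R -> R[i].

Lemma cmeasurable_cst (z : R[i]) : cmeasurable (fun _ : R => z).
Proof. by split; exact: measurable_cst. Qed.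

Lemma cmeasurableD f g : cmeasurable f -> cmeasurable g ->
  cmeasurable (fun x => f x + g x).
Proof.
move=> [rf jf] [rg ig]; split.
  by under eq_fun do rewrite ReD; exact: measurable_funD.
by under eq_fun do rewrite ImD; exact: measurable_funD.
Qed.

Lemma cmeasurableM f g : cmeasurable f -> cmeasurable g ->
  cmeasurable (fun x => f x * g x).
Proof.
move=> [rf jf] [rg ig]; split.
  by under eq_fun do rewrite ReM; apply: measurable_funB; exact: measurable_funM.
by under eq_fun do rewrite ImM; apply: measurable_funD; exact: measurable_funM.
Qed.

Lemma cmeasurableN f : cmeasurable f -> cmeasurable (fun x => - f x).
Proof.
move=> mf; under eq_fun do rewrite -mulN1r.
by apply: cmeasurableM => //; exact: cmeasurable_cst.
Qed.

Lemma cmeasurableB f g : cmeasurable f -> cmeasurable g ->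
  cmeasurable (fun x => f x - g x).
Proof. by move=> mf mg; apply: cmeasurableD => //; exact: cmeasurableN. Qed.

Lemma cmeasurable_conjc f : cmeasurable f -> cmeasurable (fun x => conjc (f x)).
Proof.
move=> [rf jf]; split; first by under eq_fun do rewrite Re_conjc.
by under eq_fun do rewrite Im_conjc; exact: measurable_funN.
Qed.

Lemma cmeasurable_real (r : R -> R) : measurable_fun setT r ->
  cmeasurable (fun x => ((r x)%:C)%C).
Proof. by move=> mr; split => //=; exact: measurable_cst. Qed.

Lemma cmeasurable_sum (I : Type) (s : seq I) (F : I -> R -> R[i]) :
  (forall i, cmeasurable (F i)) -> cmeasurable (fun x => \sum_(i <- s) F i x).
Proof.
move=> mF; elim: s => [|i s IHs].
  by under eq_fun do rewrite big_nil; exact: cmeasurable_cst.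
by under eq_fun do rewrite big_cons; exact: cmeasurableD.
Qed.

Lemma cmeasurable_expi (r : R -> R) : measurable_fun setT r ->
  cmeasurable (fun x => expi (r x)).
Proof.
by move=> mr; split => /=; apply: measurableT_comp => //;
  apply: continuous_measurable_fun; [exact: continuous_cos|exact: continuous_sin].
Qed.

Lemma measurable_shift (c : R) :
  measurable_fun [set: measurableTypeR R] ((fun x => x + c) : _ -> measurableTypeR R).
Proof. by apply: measurable_funD => //; exact: measurable_cst. Qed.

Lemma cmeasurable_shift f (c : R) : cmeasurable f ->
  cmeasurable (fun x => f (x + c)).
Proof.
by move=> [rf jf]; split;
  [exact: measurableT_comp rf (measurable_shift c)
  |exact: measurableT_comp jf (measurable_shift c)].
Qed.

Lemma measurable_sqr_normc f : cmeasurable f ->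
  measurable_fun setT (fun x => normc (f x) ^+ 2).
Proof.
move=> [rf jf]; under eq_fun do rewrite sqr_normcE.
by apply: measurable_funD; exact: measurable_funX.
Qed.

Lemma measurable_sqrt (r : R -> R) : measurable_fun setT r ->
  measurable_fun setT (fun x => Num.sqrt (r x)).
Proof.
apply: measurableT_comp; apply: continuous_measurable_fun.
exact: sqrt_continuous.
Qed.

Lemma measurable_normc f : cmeasurable f ->
  measurable_fun setT (fun x => normc (f x)).
Proof.
move=> mf; have := measurable_sqrt (measurable_sqr_normc mf).
by under eq_fun do rewrite sqrtr_sqr ger0_norm ?normc_ge0//.
Qed.

End complex_measurable.

Section complex_integral.
Context {R : realType}.
Local Notation mu := (@lebesgue_measure R).
Implicit Types f g : R -> R[i].

Lemma integral_EFin_norm (u : R -> R) : (forall x, 0 <= u x) ->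
  (\int[mu]_x `|(EFin \o u) x| = \int[mu]_x (u x)%:E)%E.
Proof. by move=> u0; apply: eq_integral => x _; rewrite /= ger0_norm. Qed.

Lemma integrable_funZl (k : R) (u : R -> R) : mu.-integrable setT (EFin \o u) ->
  mu.-integrable setT (EFin \o (fun x => k * u x)).
Proof. by move=> iu; exact: (integrableZl measurableT k iu). Qed.

Lemma integrable_funD (u v : R -> R) : mu.-integrable setT (EFin \o u) ->
  mu.-integrable setT (EFin \o v) ->
  mu.-integrable setT (EFin \o (fun x => u x + v x)).
Proof. by move=> iu iv; exact: (integrableD measurableT iu iv). Qed.

Lemma Rintegral_dominated_cvg (u : nat -> R -> R) (v g : R -> R) :
  (forall n, measurable_fun setT (u n)) -> measurable_fun setT v ->
  mu.-integrable setT (EFin \o g) -> (forall n x, `|u n x| <= g x) ->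
  {ae mu, forall x, u n x @[n --> \oo] --> v x} ->
  \int[mu]_x u n x @[n --> \oo] --> \int[mu]_x v x.
Proof.
move=> mu_ mv ig ug uv.
have mE n : measurable_fun setT (EFin \o u n) by exact/measurable_EFinP.
have mvE : measurable_fun setT (EFin \o v) by exact/measurable_EFinP.
have cuv : {ae mu, forall x, setT x -> (EFin \o u n) x @[n --> \oo] --> (EFin \o v) x}.
  by apply: filterS uv => x uvx _; apply: cvg_EFin => //; exact: nearW.
have dom : {ae mu, forall x n, setT x -> (`|(EFin \o u n) x| <= (EFin \o g) x)%E}.
  by apply: aeW => x n _; rewrite /= lee_fin.
have [iv _ lim] := @dominated_convergence _ _ _ mu setT measurableT
  (fun n => EFin \o u n) (EFin \o v) (EFin \o g) mE mvE cuv ig dom.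
apply: fine_cvg; rewrite fineK//; exact: integrable_fin_num.
Qed.

Definition cintegrable f : Prop :=
  mu.-integrable setT (EFin \o (fun x => complex.Re (f x))) /\
  mu.-integrable setT (EFin \o (fun x => complex.Im (f x))).

Lemma cintegrable_cmeasurable f : cintegrable f -> cmeasurable f.
Proof.
by move=> [rf jf]; split; apply/measurable_EFinP; exact: (measurable_int mu).
Qed.

Lemma le_cintegrable f (g : R -> R) : cmeasurable f ->
  mu.-integrable setT (EFin \o g) -> (forall x, normc (f x) <= g x) ->
  cintegrable f.
Proof.
move=> [mr mi] ig fg.
have g0 x : `|g x| = g x by rewrite ger0_norm// (le_trans (normc_ge0 _) (fg x)).
split; apply: le_integrable ig => //; try exact/measurable_EFinP;
  move=> x _; rewrite /= lee_fin g0 (le_trans _ (fg x))//.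
- exact: ler_Re_normc.
- exact: ler_Im_normc.
Qed.

Lemma integrable_normc f : cintegrable f ->
  mu.-integrable setT (EFin \o (fun x => normc (f x))).
Proof.
move=> cf; have [rf jf] := cf.
have iReIm := integrable_funD (integrable_norm rf) (integrable_norm jf).
apply: le_integrable iReIm => // [|x _].
  by apply/measurable_EFinP; apply: measurable_normc; exact: cintegrable_cmeasurable.
rewrite /= lee_fin (ger0_norm (normc_ge0 _)) ger0_norm ?addr_ge0//.
exact: normc_le_ReIm.
Qed.

Lemma cintegrableP f : cintegrable f <->
  cmeasurable f /\ (\int[mu]_x (normc (f x))%:E < +oo)%E.
Proof.
split=> [cf|[mf ff]].
  split; first exact: cintegrable_cmeasurable.
  have /integrableP[_] := integrable_normc cf.
  by rewrite integral_EFin_norm// => x; exact: normc_ge0.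
apply: (le_cintegrable (g := fun x => normc (f x))) => //.
apply/integrableP; split; first by apply/measurable_EFinP; exact: measurable_normc.
by rewrite integral_EFin_norm// => x; exact: normc_ge0.
Qed.

Lemma cintegrableD f g : cintegrable f -> cintegrable g ->
  cintegrable (fun x => f x + g x).
Proof.
move=> [rf jf] [rg ig]; split.
  by under eq_fun do rewrite ReD; exact: integrable_funD.
by under eq_fun do rewrite ImD; exact: integrable_funD.
Qed.

Lemma cintegrableM_bounded f g (C : R) : cintegrable f -> cmeasurable g ->
  (forall x, normc (g x) <= C) -> cintegrable (fun x => f x * g x).
Proof.
move=> cf mg gC.
apply: (le_cintegrable (g := fun x => C * normc (f x))).
- by apply: cmeasurableM => //; exact: cintegrable_cmeasurable.
- by apply: integrable_funZl; exact: integrable_normc.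
- by move=> x; rewrite normcM mulrC ler_wpM2r// normc_ge0.
Qed.

Lemma cintegrableZ (z : R[i]) f : cintegrable f -> cintegrable (fun x => z * f x).
Proof.
move=> cf; under eq_fun do rewrite mulrC.
by apply: (cintegrableM_bounded (C := normc z)) => //; exact: cmeasurable_cst.
Qed.

Lemma cintegrableB f g : cintegrable f -> cintegrable g ->
  cintegrable (fun x => f x - g x).
Proof.
move=> cf cg; apply: cintegrableD => //; under eq_fun do rewrite -mulN1r.
exact: cintegrableZ.
Qed.

Lemma cintegrable_sum (I : Type) (s : seq I) (F : I -> R -> R[i]) :
  (forall i, cintegrable (F i)) -> cintegrable (fun x => \sum_(i <- s) F i x).
Proof.
move=> mF; elim: s => [|i s IHs].
  by under eq_fun do rewrite big_nil; split; exact: integrable0.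
by under eq_fun do rewrite big_cons; exact: cintegrableD.
Qed.

Lemma cintegralD f g : cintegrable f -> cintegrable g ->
  cintegral (fun x => f x + g x) = cintegral f + cintegral g.
Proof.
move=> [rf jf] [rg ig]; apply: complex_ext; rewrite ?ReD ?ImD /=.
  by under eq_Rintegral do rewrite ReD; rewrite RintegralD.
by under eq_Rintegral do rewrite ImD; rewrite RintegralD.
Qed.

Lemma cintegralZ (z : R[i]) f : cintegrable f ->
  cintegral (fun x => z * f x) = z * cintegral f.
Proof.
move=> [rf jf]; apply: complex_ext; rewrite ?ReM ?ImM /=.
  under eq_Rintegral do rewrite ReM.
  by rewrite RintegralB ?RintegralZl//; exact: integrable_funZl.
under eq_Rintegral do rewrite ImM.
by rewrite RintegralD ?RintegralZl//; exact: integrable_funZl.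
Qed.

Lemma cintegralB f g : cintegrable f -> cintegrable g ->
  cintegral (fun x => f x - g x) = cintegral f - cintegral g.
Proof.
move=> cf cg; under eq_fun do rewrite -(mulN1r (g _)).
by rewrite cintegralD ?cintegralZ ?mulN1r//; exact: cintegrableZ.
Qed.

Lemma cintegral0 : cintegral (fun _ : R => 0) = 0 :> R[i].
Proof. by rewrite /cintegral /Rintegral integral0. Qed.

Lemma cintegral_sum (I : Type) (s : seq I) (F : I -> R -> R[i]) :
  (forall i, cintegrable (F i)) ->
  cintegral (fun x => \sum_(i <- s) F i x) = \sum_(i <- s) cintegral (F i).
Proof.
move=> mF; elim: s => [|i s IHs].
  by under eq_fun do rewrite big_nil; rewrite big_nil cintegral0.
under eq_fun do rewrite big_cons; rewrite cintegralD// ?IHs ?big_cons//.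
exact: cintegrable_sum.
Qed.

Lemma cintegral_conjc f : cintegrable f ->
  cintegral (fun x => conjc (f x)) = conjc (cintegral f).
Proof.
move=> [rf jf]; apply: complex_ext; rewrite ?Re_conjc ?Im_conjc /=.
  by under eq_Rintegral do rewrite Re_conjc.
under eq_Rintegral do rewrite Im_conjc -mulN1r.
by rewrite RintegralZl// mulN1r.
Qed.

Lemma ae_eq_cintegral f g : cmeasurable f -> cmeasurable g ->
  {ae mu, forall x, f x = g x} -> cintegral f = cintegral g.
Proof.
move=> [rf jf] [rg ig] fg; apply: complex_ext; rewrite /= /Rintegral; congr fine;
  apply: ae_eq_integral => //; try exact/measurable_EFinP;
  by apply: filterS fg => x /= ->.
Qed.

End complex_integral.

Section L2.
Context {R : realType}.
Local Notation mu := (@lebesgue_measure R).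
Implicit Types f g h : R -> R[i].

Definition esqnorm f : \bar R := (\int[mu]_x (normc (f x) ^+ 2)%:E)%E.

Definition sqnorm f : R := fine (esqnorm f).

Definition L2norm f : R := Num.sqrt (sqnorm f).

Definition L2 f : Prop := cmeasurable f /\ (esqnorm f < +oo)%E.

Definition dot f g : R[i] := cintegral (fun x => f x * conjc (g x)).

Lemma esqnorm_ge0 f : (0 <= esqnorm f)%E.
Proof. by apply: integral_ge0 => x _; rewrite lee_fin sqr_ge0. Qed.

Lemma sqnorm_ge0 f : 0 <= sqnorm f.
Proof. exact/fine_ge0/esqnorm_ge0. Qed.

Lemma L2norm_ge0 f : 0 <= L2norm f.
Proof. exact: sqrtr_ge0. Qed.

Lemma sqr_L2norm f : L2norm f ^+ 2 = sqnorm f.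
Proof. by rewrite sqr_sqrtr// sqnorm_ge0. Qed.

Lemma eq_sqnorm f g : (forall x, normc (f x) = normc (g x)) -> sqnorm f = sqnorm g.
Proof. by move=> fg; congr fine; apply: eq_integral => x _; rewrite fg. Qed.

Lemma sqnormN f : sqnorm (fun x => - f x) = sqnorm f.
Proof. by apply: eq_sqnorm => x; rewrite normcN. Qed.

Lemma sqnorm0 : sqnorm (fun _ : R => 0) = 0.
Proof.
by rewrite /sqnorm /esqnorm normc0 expr0n integral_cst// mul0e.
Qed.

Lemma L2norm_distC f g : L2norm (fun x => f x - g x) = L2norm (fun x => g x - f x).
Proof. by congr Num.sqrt; apply: eq_sqnorm => x; rewrite -opprB normcN. Qed.

Lemma L2_cmeasurable f : L2 f -> cmeasurable f.
Proof. by case. Qed.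

Lemma sqnormK f : L2 f -> (sqnorm f)%:E = esqnorm f.
Proof. by move=> [_ sf]; rewrite fineK// ge0_fin_numE// esqnorm_ge0. Qed.

Lemma integrable_sqr_normc f : L2 f ->
  mu.-integrable setT (EFin \o (fun x => normc (f x) ^+ 2)).
Proof.
move=> [mf sf]; apply/integrableP; split.
  by apply/measurable_EFinP; exact: measurable_sqr_normc.
by rewrite integral_EFin_norm// => x; exact: sqr_ge0.
Qed.

Lemma L2_dominated f (g : R -> R) : cmeasurable f ->
  mu.-integrable setT (EFin \o g) -> (forall x, normc (f x) ^+ 2 <= g x) -> L2 f.
Proof.
move=> mf /integrableP[mg ig] fg; split => //.
apply: le_lt_trans ig; apply: ge0_le_integral => //.
- by move=> x _; rewrite lee_fin sqr_ge0.
- by apply/measurable_EFinP; exact: measurable_sqr_normc.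
- by apply: measurableT_comp.
- by move=> x _; rewrite lee_fin (le_trans (fg x))// ler_norm.
Qed.

Lemma le_esqnorm f g (C : R) : cmeasurable f -> cmeasurable g ->
  (forall x, normc (f x) <= C * normc (g x)) ->
  (esqnorm f <= (C ^+ 2)%:E * esqnorm g)%E.
Proof.
move=> mf mg fg; rewrite /esqnorm -ge0_integralZl ?lee_fin ?sqr_ge0//; first last.
- by move=> x _; rewrite lee_fin sqr_ge0.
- by apply/measurable_EFinP; exact: measurable_sqr_normc.
apply: ge0_le_integral => //.
- by move=> x _; rewrite lee_fin sqr_ge0.
- by apply/measurable_EFinP; exact: measurable_sqr_normc.
- by apply/measurable_EFinP/measurable_funM => //; exact: measurable_sqr_normc.
- move=> x _; rewrite -EFinM lee_fin -exprMn.
  by rewrite ler_pXn2r ?nnegrE ?normc_ge0// (le_trans (normc_ge0 _) (fg x)).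
Qed.

Lemma le_L2 f g (C : R) : cmeasurable f -> L2 g ->
  (forall x, normc (f x) <= C * normc (g x)) -> L2 f.
Proof.
move=> mf lg fg; split => //; apply: le_lt_trans (le_esqnorm mf lg.1 fg) _.
by rewrite lte_mul_pinfty// ?lee_fin ?sqr_ge0//; case: lg.
Qed.

Lemma le_L2norm f g (C : R) : 0 <= C -> cmeasurable f -> L2 g ->
  (forall x, normc (f x) <= C * normc (g x)) -> L2norm f <= C * L2norm g.
Proof.
move=> C0 mf lg fg; rewrite /L2norm -[X in X * _](ger0_norm C0) -sqrtr_sqr -sqrtrM ?sqr_ge0//.
rewrite ler_wsqrtr// -lee_fin EFinM (sqnormK lg) (sqnormK (le_L2 mf lg fg)).
exact: le_esqnorm mf lg.1 fg.
Qed.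

Lemma L2M_bounded f g (C : R) : L2 f -> cmeasurable g ->
  (forall x, normc (g x) <= C) -> L2 (fun x => g x * f x).
Proof.
move=> lf mg gC; apply: (le_L2 (g := f) (C := C)) => //.
  by apply: cmeasurableM => //; exact: L2_cmeasurable.
by move=> x; rewrite normcM ler_wpM2r ?normc_ge0.
Qed.

Lemma L2Z (z : R[i]) f : L2 f -> L2 (fun x => z * f x).
Proof. by move=> lf; apply: (L2M_bounded lf) => //; exact: cmeasurable_cst. Qed.

Lemma L2D f g : L2 f -> L2 g -> L2 (fun x => f x + g x).
Proof.
move=> lf lg.
apply: (L2_dominated (g := fun x => 2 * normc (f x) ^+ 2 + 2 * normc (g x) ^+ 2)).
- by apply: cmeasurableD; exact: L2_cmeasurable.
- by apply: integrable_funD; apply: integrable_funZl; exact: integrable_sqr_normc.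
- by move=> x; exact: sqr_normcD_le.
Qed.

Lemma L2N f : L2 f -> L2 (fun x => - f x).
Proof. by move=> lf; under eq_fun do rewrite -mulN1r; exact: L2Z. Qed.

Lemma L2B f g : L2 f -> L2 g -> L2 (fun x => f x - g x).
Proof. by move=> lf lg; apply: L2D => //; exact: L2N. Qed.

Lemma L2_0 : L2 (fun _ : R => 0).
Proof.
split; first exact: cmeasurable_cst.
by rewrite /esqnorm normc0 expr0n integral_cst// mul0e.
Qed.

Lemma L2_sum (I : Type) (s : seq I) (F : I -> R -> R[i]) :
  (forall i, L2 (F i)) -> L2 (fun x => \sum_(i <- s) F i x).
Proof.
move=> mF; elim: s => [|i s IHs].
  by under eq_fun do rewrite big_nil; exact: L2_0.
by under eq_fun do rewrite big_cons; exact: L2D.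
Qed.

Lemma cintegrable_mul_conjc f g : L2 f -> L2 g ->
  cintegrable (fun x => f x * conjc (g x)).
Proof.
move=> lf lg.
apply: (le_cintegrable (g := fun x => normc (f x) ^+ 2 + normc (g x) ^+ 2)).
- by apply: cmeasurableM; [|apply: cmeasurable_conjc]; exact: L2_cmeasurable.
- by apply: integrable_funD; exact: integrable_sqr_normc.
- move=> x; rewrite normcM normc_conjc.
  have := sqr_ge0 (normc (f x) - normc (g x)).
  by rewrite sqrrB; have := normc_ge0 (f x); have := normc_ge0 (g x); nra.
Qed.

Lemma dotZl (z : R[i]) f g : L2 f -> L2 g ->
  dot (fun x => z * f x) g = z * dot f g.
Proof.
move=> lf lg; rewrite /dot -cintegralZ; last exact: cintegrable_mul_conjc.
by congr cintegral; apply/funext => x; rewrite mulrA.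
Qed.

Lemma dotDl f g h : L2 f -> L2 g -> L2 h ->
  dot (fun x => f x + g x) h = dot f h + dot g h.
Proof.
move=> lf lg lh; rewrite /dot -cintegralD; try exact: cintegrable_mul_conjc.
by congr cintegral; apply/funext => x; rewrite mulrDl.
Qed.

Lemma dotC f g : L2 f -> L2 g -> dot g f = conjc (dot f g).
Proof.
move=> lf lg; rewrite /dot -cintegral_conjc; last exact: cintegrable_mul_conjc.
by congr cintegral; apply/funext => x; rewrite conjcM conjcK mulrC.
Qed.

Lemma dotZr (z : R[i]) f g : L2 f -> L2 g ->
  dot f (fun x => z * g x) = conjc z * dot f g.
Proof.
move=> lf lg; rewrite (dotC (L2Z z lg) lf) dotZl// conjcM.
by rewrite -(dotC lg lf).
Qed.

Lemma dotDr f g h : L2 f -> L2 g -> L2 h ->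
  dot f (fun x => g x + h x) = dot f g + dot f h.
Proof.
move=> lf lg lh; rewrite (dotC (L2D lg lh) lf) dotDl// conjcD.
by rewrite -(dotC lg lf) -(dotC lh lf).
Qed.

Lemma dotNl f h : L2 f -> L2 h -> dot (fun x => - f x) h = - dot f h.
Proof.
by move=> lf lh; under eq_fun do rewrite -mulN1r; rewrite dotZl// mulN1r.
Qed.

Lemma dotBl f g h : L2 f -> L2 g -> L2 h ->
  dot (fun x => f x - g x) h = dot f h - dot g h.
Proof. by move=> lf lg lh; rewrite dotDl ?dotNl//; exact: L2N. Qed.

Lemma dot_suml (I : Type) (s : seq I) (F : I -> R -> R[i]) h :
  (forall i, L2 (F i)) -> L2 h ->
  dot (fun x => \sum_(i <- s) F i x) h = \sum_(i <- s) dot (F i) h.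
Proof.
move=> mF lh; rewrite /dot -cintegral_sum; last by move=> i; exact: cintegrable_mul_conjc.
by congr cintegral; apply/funext => x; rewrite mulr_suml.
Qed.

Lemma dot_id f : dot f f = ((sqnorm f)%:C)%C.
Proof.
rewrite /dot /cintegral; apply: complex_ext => /=.
  by congr fine; apply: eq_integral => x _; rewrite mulcJ.
by under eq_Rintegral do rewrite mulcJ /=; rewrite Rintegral_cst// mul0r.
Qed.

Lemma sqnormD f g : L2 f -> L2 g ->
  sqnorm (fun x => f x + g x) = sqnorm f + sqnorm g + 2 * complex.Re (dot f g).
Proof.
move=> lf lg; have lfg := L2D lf lg.
have := dot_id (fun x => f x + g x); rewrite dotDl// !dotDr// (dotC lf lg) !dot_id.
by move=> /(congr1 (@complex.Re R)) /= <-; case: (dot f g) => a b /=; ring.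
Qed.

Lemma sqnormZ (z : R[i]) f : L2 f -> sqnorm (fun x => z * f x) = normc z ^+ 2 * sqnorm f.
Proof.
move=> lf; have lz := L2Z z lf.
have := dot_id (fun x => z * f x); rewrite dotZl// dotZr// mulrA mulcJ dot_id.
by rewrite -(rmorphM (real_complex R)) => /complexI.
Qed.

Lemma L2normZ (z : R[i]) f : L2 f -> L2norm (fun x => z * f x) = normc z * L2norm f.
Proof.
move=> lf; rewrite /L2norm sqnormZ// sqrtrM ?sqr_ge0// sqrtr_sqr.
by rewrite ger0_norm ?normc_ge0.
Qed.

Lemma sqnormB f g : L2 f -> L2 g ->
  sqnorm (fun x => f x - g x) = sqnorm f + sqnorm g - 2 * complex.Re (dot f g).
Proof.
move=> lf lg; rewrite (sqnormD lf (L2N lg)) sqnormN (dotC (L2N lg) lf) dotNl//.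
by rewrite (dotC lf lg); case: (dot f g) => a b /=; ring.
Qed.

Lemma parallelogram f g : L2 f -> L2 g ->
  sqnorm (fun x => f x + g x) + sqnorm (fun x => f x - g x) =
  2 * sqnorm f + 2 * sqnorm g.
Proof. by move=> lf lg; rewrite sqnormD// sqnormB//; ring. Qed.

Lemma sqnorm_eq0 f : L2 f -> sqnorm f = 0 -> {ae mu, forall x, f x = 0}.
Proof.
move=> lf f0; have := sqnormK lf; rewrite f0 => /esym sf.
have /(ae_eq_integral_abs mu measurableT)[+ _] : measurable_fun [set: R]
  (EFin \o (fun x => normc (f x) ^+ 2)).
  by apply/measurable_EFinP; apply: measurable_sqr_normc; case: lf.
rewrite integral_EFin_norm; last by move=> x; exact: sqr_ge0.
move=> /(_ sf); apply: filterS => x /(_ I)/= [] /eqP.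
by rewrite sqrf_eq0 => /eqP; exact: eq0_normc.
Qed.

Lemma L2norm_eq0 f : L2 f -> L2norm f = 0 -> {ae mu, forall x, f x = 0}.
Proof. by move=> lf f0; apply: sqnorm_eq0; rewrite // -sqr_L2norm f0 expr0n. Qed.

Lemma ae_eq_esqnorm f g : cmeasurable f -> cmeasurable g ->
  {ae mu, forall x, f x = g x} -> esqnorm f = esqnorm g.
Proof.
move=> mf mg fg; apply: ae_eq_integral => //.
- by apply/measurable_EFinP; exact: measurable_sqr_normc.
- by apply/measurable_EFinP; exact: measurable_sqr_normc.
- by apply: filterS fg => x fgx _; rewrite fgx.
Qed.

Lemma cauchy_schwarz f g : L2 f -> L2 g -> normc (dot f g) <= L2norm f * L2norm g.
Proof.
move=> lf lg; rewrite -(@ler_pXn2r _ 2)// ?nnegrE ?normc_ge0 ?mulr_ge0 ?L2norm_ge0//.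
rewrite exprMn !sqr_L2norm; set d := dot f g.
have [g0|gn0] := eqVneq (sqnorm g) 0.
  suff -> : d = 0 by rewrite normc0 expr0n mulr_ge0 ?sqnorm_ge0.
  rewrite -cintegral0; apply: ae_eq_cintegral.
  - exact: cintegrable_cmeasurable (cintegrable_mul_conjc lf lg).
  - exact: cmeasurable_cst.
  - by apply: filterS (sqnorm_eq0 lg g0) => x ->; rewrite conjc0 mulr0.
have gp : 0 < sqnorm g by rewrite lt_neqAle eq_sym gn0 sqnorm_ge0.
have := sqnorm_ge0 (fun x => ((sqnorm g)%:C)%C * f x - d * g x).
rewrite (sqnormB (L2Z _ lf) (L2Z _ lg)) !sqnormZ// dotZl ?dotZr//; last exact: L2Z.
rewrite normc_real real_normK ?num_real// (mulrC (conjc d)) mulcJ Re_realM Re_real.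
rewrite (_ : _ - _ = sqnorm g * (sqnorm f * sqnorm g - normc d ^+ 2)); last by ring.
by rewrite pmulr_rge0// subr_ge0.
Qed.

Lemma minkowski f g : L2 f -> L2 g ->
  L2norm (fun x => f x + g x) <= L2norm f + L2norm g.
Proof.
move=> lf lg; rewrite -(@ler_pXn2r _ 2)// ?nnegrE ?addr_ge0 ?L2norm_ge0//.
have := le_trans (le_trans (ler_norm _) (ler_Re_normc _)) (cauchy_schwarz lf lg).
by rewrite sqrrD !sqr_L2norm sqnormD//; lra.
Qed.

Lemma minkowskiB f g h : L2 f -> L2 g -> L2 h ->
  L2norm (fun x => f x - h x) <=
  L2norm (fun x => f x - g x) + L2norm (fun x => g x - h x).
Proof.
move=> lf lg lh; apply: le_trans (minkowski (L2B lf lg) (L2B lg lh)).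
by rewrite le_eqVlt; apply/orP; left; apply/eqP; congr L2norm; apply/funext => x; ring.
Qed.

Lemma L2norm_le_dist f g : L2 f -> L2 g ->
  L2norm f <= L2norm (fun x => f x - g x) + L2norm g.
Proof.
move=> lf lg; apply: le_trans (minkowski (L2B lf lg) lg).
by under eq_fun do rewrite subrK.
Qed.

Lemma dist_L2norm f g : L2 f -> L2 g ->
  `|L2norm f - L2norm g| <= L2norm (fun x => f x - g x).
Proof.
move=> lf lg; rewrite ler_norml; apply/andP; split.
  by rewrite lerNl opprB lerBlDr L2norm_distC; exact: L2norm_le_dist.
by rewrite lerBlDr; exact: L2norm_le_dist.
Qed.

Lemma cLnorm2E f : L2 f -> cLnorm 2%:E f = (L2norm f)%:E.
Proof.
move=> lf; rewrite /cLnorm unlock/= /L2norm -powR12_sqrt ?sqnorm_ge0//.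
rewrite -poweR_EFin (sqnormK lf) /esqnorm.
congr (_ `^ _)%E; apply: eq_integral => x _.
by rewrite ger0_norm ?normc_ge0// powR_mulrn// normc_ge0.
Qed.

Lemma cLp2E f : cLp 2%:E f <-> L2 f.
Proof.
rewrite /cLp/= /L2 /cLnorm unlock/=.
under [X in (X `^ _)%E]eq_integral => x _.
  rewrite ger0_norm ?normc_ge0// powR_mulrn ?normc_ge0//; over.
split=> -[mf sf]; split => //; last exact: poweR_lty.
by apply: lty_poweRy sf => //; rewrite invr_eq0.
Qed.

Lemma cLp1E f : cLp 1%:E f <-> cintegrable f.
Proof.
rewrite cintegrableP /cLp/= /cLnorm Lnorm1.
by rewrite integral_EFin_norm// => x; exact: normc_ge0.
Qed.

End L2.

Section L2_convergence.
Context {R : realType}.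
Implicit Types (f g : R -> R[i]) (u : nat -> R -> R[i]).

Definition L2_cvg u f : Prop := L2norm (fun x => u n x - f x) @[n --> \oo] --> 0.

Definition L2_cauchy u : Prop := forall e : R, 0 < e ->
  exists N, forall n m, (N <= n)%N -> (N <= m)%N ->
    L2norm (fun x => u n x - u m x) < e.

Lemma squeeze_cvg0 (a b : nat -> R) : (forall n, 0 <= a n <= b n) ->
  b n @[n --> \oo] --> 0 -> a n @[n --> \oo] --> 0.
Proof.
move=> ab; apply: (@squeeze_cvgr _ _ _ _ (fun=> 0) b); last exact: cvg_cst.
exact: nearW.
Qed.

Lemma L2_cvg_cauchy u f : (forall n, L2 (u n)) -> L2 f -> L2_cvg u f -> L2_cauchy u.
Proof.
move=> lu lf /cvgrPdist_lt uf e e0.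
have [N _ NP] := uf (e / 2) (divr_gt0 e0 (ltr0Sn _ 1)).
have dist_u n : (N <= n)%N -> L2norm (fun x => u n x - f x) < e / 2.
  by move=> /NP; rewrite /= sub0r normrN ger0_norm ?L2norm_ge0.
exists N => n m /dist_u un /dist_u um.
apply: le_lt_trans (minkowskiB (lu n) lf (lu m)) _.
by rewrite (splitr e) ltrD// L2norm_distC.
Qed.

Lemma cvg_L2norm u f : (forall n, L2 (u n)) -> L2 f -> L2_cvg u f ->
  L2norm (u n) @[n --> \oo] --> L2norm f.
Proof.
move=> lu lf uf; apply: (cvg_sub0 (g := fun=> L2norm f)); last exact: cvg_cst.
apply: norm_cvg0; apply: squeeze_cvg0 uf => n.
by rewrite normr_ge0; exact: dist_L2norm.
Qed.

Lemma cvg_sqnorm u f : (forall n, L2 (u n)) -> L2 f -> L2_cvg u f ->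
  sqnorm (u n) @[n --> \oo] --> sqnorm f.
Proof.
move=> lu lf /(cvg_L2norm lu lf) uf; rewrite -sqr_L2norm expr2.
by under eq_fun do rewrite -sqr_L2norm expr2; exact: cvgM.
Qed.

Lemma dot_cvg_eq0 u f g : (forall n, L2 (u n)) -> L2 f -> L2 g -> L2_cvg u f ->
  normc (dot (u n) g) @[n --> \oo] --> 0 -> dot f g = 0.
Proof.
move=> lu lf lg uf ug; apply/eqP; rewrite -normc_eq0 eq_le normc_ge0 andbT.
have bound n : normc (dot f g) <=
    L2norm (fun x => u n x - f x) * L2norm g + normc (dot (u n) g).
  rewrite L2norm_distC -lerBlDr (le_trans _ (cauchy_schwarz (L2B lf (lu n)) lg))//.
  by rewrite dotBl// lerBlDr (le_trans _ (le_normcD _ _))// subrK.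
have bound0 : L2norm (fun x => u n x - f x) * L2norm g + normc (dot (u n) g)
    @[n --> \oo] --> 0.
  rewrite -[X in _ --> X](addr0 0) -[X in _ --> X + _](mul0r (L2norm g)).
  by apply: cvgD => //; exact: cvgMr_tmp.
by apply: cvgr_to_ge bound0 _; exact: nearW.
Qed.

End L2_convergence.

Section riesz_fischer.
Context {R : realType}.
Local Notation mu := (@lebesgue_measure R).
Implicit Types (f g h : R -> R[i]) (u : nat -> R -> R[i]).

Definition ccvg (z : nat -> R[i]) (l : R[i]) : Prop :=
  normc (z n - l) @[n --> \oo] --> 0.

Lemma ccvgP (z : nat -> R[i]) (l : R[i]) : ccvg z l <->
  complex.Re (z n) @[n --> \oo] --> complex.Re l /\
  complex.Im (z n) @[n --> \oo] --> complex.Im l.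
Proof.
split=> [zl|[zr zi]].
  split; apply/subr_cvg0; apply: norm_cvg0; apply: squeeze_cvg0 zl => n;
    rewrite normr_ge0/=.
  - by rewrite -ReN -ReD; exact: ler_Re_normc.
  - by rewrite -ImN -ImD; exact: ler_Im_normc.
apply: (@squeeze_cvg0 _ _
  (fun n => `|complex.Re (z n) - complex.Re l| + `|complex.Im (z n) - complex.Im l|)).
  move=> n; rewrite normc_ge0 (le_trans (normc_le_ReIm _))//.
  by rewrite ReD ReN ImD ImN.
rewrite -[X in _ --> X](addr0 0).
by apply: cvgD; apply/norm_cvg0P; apply/subr_cvg0.
Qed.

Lemma ccvg_normc (z : nat -> R[i]) (l : R[i]) : ccvg z l ->
  normc (z n) @[n --> \oo] --> normc l.
Proof.
move=> zl; apply: (cvg_sub0 (g := fun=> normc l)); last exact: cvg_cst.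
apply: norm_cvg0; apply: squeeze_cvg0 zl => n; rewrite normr_ge0.
exact: (ler_dist_dist (z n : Rcomplex R) l).
Qed.

Lemma cintegral_dominated_cvg u f (g : R -> R) : (forall n, cmeasurable (u n)) ->
  cmeasurable f -> mu.-integrable setT (EFin \o g) ->
  (forall n x, normc (u n x) <= g x) -> {ae mu, forall x, ccvg (u ^~ x) (f x)} ->
  ccvg (fun n => cintegral (u n)) (cintegral f).
Proof.
move=> mu_ [rf jf] ig ug uf; apply/ccvgP; split; apply: Rintegral_dominated_cvg ig _ _ => //.
- by move=> n; case: (mu_ n).
- by move=> n x; apply: le_trans (ug n x); exact: ler_Re_normc.
- by apply: filterS uf => x /ccvgP[].
- by move=> n; case: (mu_ n).
- by move=> n x; apply: le_trans (ug n x); exact: ler_Im_normc.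
- by apply: filterS uf => x /ccvgP[].
Qed.

Lemma measurable_limn_einf (F : nat -> R -> \bar R) :
  (forall n, measurable_fun setT (F n)) ->
  measurable_fun setT (fun x => limn_einf (F ^~ x)).
Proof.
move=> mF; rewrite [X in measurable_fun _ X](_ : _ =
    (fun x => - limn_esup (fun n => - F n x))%E).
  apply: measurableT_comp => //; apply: measurable_fun_limn_esup => n.
  exact: measurableT_comp.
by apply/funext => x; rewrite limn_esupN oppeK.
Qed.

Lemma esqnorm_fatou u h (e : \bar R) : (forall n, cmeasurable (u n)) -> cmeasurable h ->
  {ae mu, forall x, ccvg (u ^~ x) (h x)} -> (forall n, (esqnorm (u n) <= e)%E) ->
  (esqnorm h <= e)%E.
Proof.
move=> mu_ mh uh ue.
have mF n : measurable_fun [set: R] (fun x => (normc (u n x) ^+ 2)%:E).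
  by apply/measurable_EFinP; exact: measurable_sqr_normc.
have F0 n (x : R) : setT x -> (0 <= (normc (u n x) ^+ 2)%:E)%E.
  by move=> _; rewrite lee_fin sqr_ge0.
have -> : esqnorm h = (\int[mu]_x limn_einf (fun n => (normc (u n x) ^+ 2)%:E))%E.
  apply: ae_eq_integral => //.
  - by apply/measurable_EFinP; exact: measurable_sqr_normc.
  - exact: measurable_limn_einf.
  apply: filterS uh => x /ccvg_normc ux _; apply/esym/(cvg_limn_einf_sup _).1.
  by apply: cvg_EFin; [exact: nearW|exact: cvgM].
apply: le_trans (fatou mu measurableT mF F0) _.
rewrite limn_einf_lim; apply: lime_le; first exact: is_cvg_einfs.
by apply: nearW => n; apply: le_trans (ue n); apply: ereal_inf_lbound; exists n => /=.
Qed.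

Lemma ae_nneseries_lty (a : nat -> R -> \bar R) :
  (forall j, measurable_fun setT (a j)) -> (forall j x, (0 <= a j x)%E) ->
  (\sum_(j <oo) \int[mu]_x a j x < +oo)%E ->
  {ae mu, forall x, (\sum_(j <oo) a j x < +oo)%E}.
Proof.
move=> ma a0 sa.
have S0 x : (0 <= \sum_(j <oo) a j x)%E by exact: nneseries_ge0.
have iS : mu.-integrable setT (fun x => \sum_(j <oo) a j x)%E.
  apply/integrableP; split.
    by apply: ge0_emeasurable_sum => [j x _ _|j _]; [exact: a0|exact: ma].
  by under eq_integral do rewrite gee0_abs//; rewrite integral_nneseries.
have := integrable_ae measurableT iS; apply: filterS => x /(_ I).
by rewrite ge0_fin_numE.
Qed.

Lemma cvg_geometric_increments (v : nat -> R) (C : R) :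
  (forall n, `|v n.+1 - v n| <= C * 2^-1 ^+ n) -> cvgn v.
Proof.
move=> vC.
have -> : v = (fun n => v 0%N + series (telescope v) n).
  by apply/funext => n; exact: eq_sum_telescope.
apply: is_cvgD; first exact: is_cvg_cst.
apply: normed_cvg; apply: (@series_le_cvg _ _ (geometric C 2^-1)).
- by move=> n; exact: normr_ge0.
- by move=> n /=; rewrite (le_trans _ (vC n)).
- by move=> n /=; exact: vC.
- by apply: is_cvg_geometric_series; rewrite ger0_norm ?invr_ge0// invf_lt1// ltr1n.
Qed.

Lemma ae_geometric_increments u : (forall j, L2 (u j)) ->
  (forall j, L2norm (fun x => u j.+1 x - u j x) <= 4^-1 ^+ j) ->
  {ae mu, forall x, exists C, forall j, normc (u j.+1 x - u j x) <= C * 2^-1 ^+ j}.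
Proof.
move=> lu du; have ld j : L2 (fun x => u j.+1 x - u j x) by exact: L2B.
pose a j x := ((4 ^+ j)%:E * (normc (u j.+1 x - u j x) ^+ 2)%:E)%E.
have md j : measurable_fun setT (fun x => (normc (u j.+1 x - u j x) ^+ 2)%:E).
  by apply/measurable_EFinP; apply: measurable_sqr_normc; exact: L2_cmeasurable.
have a0 j x : (0 <= a j x)%E by rewrite mule_ge0 ?lee_fin ?exprn_ge0 ?normc_ge0.
have inta j : (\int[mu]_x a j x <= (4^-1 ^+ j)%:E)%E.
  rewrite ge0_integralZl//; first last.
  - by move=> x _; rewrite lee_fin sqr_ge0.
  - exact: md.
  have := sqnormK (ld j); rewrite /esqnorm => <-; rewrite -sqr_L2norm -EFinM lee_fin.
  apply: (@le_trans _ _ (4 ^+ j * (4^-1 ^+ j) ^+ 2)).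
    by rewrite ler_wpM2l ?exprn_ge0// ler_pXn2r ?nnegrE ?L2norm_ge0 ?exprn_ge0 ?invr_ge0.
  by rewrite expr2 mulrA -exprMn divff// expr1n mul1r.
have : {ae mu, forall x, (\sum_(j <oo) a j x < +oo)%E}.
  apply: ae_nneseries_lty => // [j|]; first exact: measurable_funeM.
  apply: (@le_lt_trans _ _ (1 * (1 - 4^-1)^-1)%:E); last exact: ltry.
  apply: lime_le; first by apply: is_cvg_nneseries => j _ _; exact: integral_ge0.
  apply: nearW => n; apply: (@le_trans _ _ (series (geometric 1 4^-1) n)%:E).
    by rewrite /series/= -sumEFin; apply: lee_sum => j _; rewrite mul1r; exact: inta.
  by rewrite lee_fin geometric_le_lim// ger0_norm ?invr_ge0// invf_lt1// ltr1n.
apply: filterS => x Sx; set S := (\sum_(j <oo) a j x)%E in Sx.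
have S0 : (0 <= S)%E by exact: nneseries_ge0.
exists (Num.sqrt (fine S)) => j.
rewrite -(@ler_pXn2r _ 2)// ?nnegrE ?normc_ge0 ?mulr_ge0 ?sqrtr_ge0 ?exprn_ge0 ?invr_ge0//.
rewrite exprMn sqr_sqrtr ?fine_ge0// exprAC exprVn -natrX exprVn ler_pdivlMr ?exprn_gt0//.
rewrite mulrC -lee_fin fineK ?ge0_fin_numE// EFinM.
apply: le_trans (nneseries_lim_ge (m := 0) j.+1 _) => [|n _ _]; last exact: a0.
by rewrite big_nat_recr//= leeDr// sume_ge0.
Qed.

Lemma ae_limit_cmeasurable u : (forall n, cmeasurable (u n)) ->
  {ae mu, forall x, cvgn (fun n => complex.Re (u n x)) /\ cvgn (fun n => complex.Im (u n x))} ->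
  exists2 h, cmeasurable h & {ae mu, forall x, ccvg (u ^~ x) (h x)}.
Proof.
move=> mu_ cu.
have mlim (v : nat -> R -> R) : (forall n, measurable_fun setT (v n)) ->
    measurable_fun setT (fun x => fine (limn_esup (fun n => (v n x)%:E))).
  move=> mv; apply: measurableT_comp; first exact: fine_measurable.
  by apply: measurable_fun_limn_esup => n; exact/measurable_EFinP.
have limE (v : nat -> R) : cvgn v -> v n @[n --> \oo] --> fine (limn_esup (EFin \o v)).
  move=> /cvg_ex[/= l vl]; rewrite (cvg_limn_einf_sup (l := l%:E) _).2//.
  by apply: cvg_EFin => //; exact: nearW.
exists (fun x => Complex (fine (limn_esup (fun n => (complex.Re (u n x))%:E)))
                         (fine (limn_esup (fun n => (complex.Im (u n x))%:E)))).
  by split; apply: mlim => n; case: (mu_ n).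
by apply: filterS cu => x [rx ix]; apply/ccvgP; split; exact: limE.
Qed.

Lemma L2_cauchy_subsequence u : L2_cauchy u -> exists2 M : nat -> nat,
  (forall j, (j <= M j)%N) &
  forall j, L2norm (fun x => u (M j.+1) x - u (M j) x) <= 4^-1 ^+ j.
Proof.
move=> cu; have /choice[N NP] (j : nat) : exists N, forall n m, (N <= n)%N -> (N <= m)%N ->
    L2norm (fun x => u n x - u m x) < 4^-1 ^+ j.
  by apply: cu; rewrite exprn_gt0// invr_gt0.
pose M j := (j + \sum_(i < j.+1) N i)%N.
have MN j i : (i <= j)%N -> (N i <= M j)%N.
  by move=> ij; rewrite /M (bigD1 (Ordinal (ij : (i < j.+1)%N)))//= addnCA leq_addr.
exists M => j; first exact: leq_addr.
by apply/ltW/NP; exact: MN.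
Qed.

Lemma riesz_fischer u : (forall n, L2 (u n)) -> L2_cauchy u ->
  exists2 h, L2 h & L2_cvg u h.
Proof.
move=> lu cu; have [M jM dM] := L2_cauchy_subsequence cu.
pose v j := u (M j); have lv j : L2 (v j) by exact: lu.
have [h mh vh] : exists2 h, cmeasurable h & {ae mu, forall x, ccvg (v ^~ x) (h x)}.
  apply: ae_limit_cmeasurable => [j|]; first by case: (lv j).
  apply: filterS (ae_geometric_increments lv dM) => x [C vC].
  split; apply: (cvg_geometric_increments (C := C)) => j; apply: le_trans (vC j).
    by rewrite -ReN -ReD; exact: ler_Re_normc.
  by rewrite -ImN -ImD; exact: ler_Im_normc.
have uh (e : R) : 0 < e -> exists N, forall n, (N <= n)%N ->
    (esqnorm (fun x => u n x - h x)%R <= (e ^+ 2)%:E)%E.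
  move=> e0; have [N NP] := cu e e0; exists N => n Nn.
  have lun j : L2 (fun x => u n x - v (j + N)%N x) by exact: L2B.
  apply: (@esqnorm_fatou (fun j x => u n x - v (j + N)%N x)).
  - by move=> j; exact: L2_cmeasurable.
  - by apply: cmeasurableB => //; exact: L2_cmeasurable.
  - apply: filterS vh => x vx; rewrite /ccvg.
    rewrite (_ : (fun j => _) = (fun j => normc (v (j + N)%N x - h x))).
      by rewrite (cvg_shiftn N (fun j => normc (v j x - h x))).
    by apply/funext => j; rewrite -normcN; congr normc; ring.
  move=> j; rewrite -sqnormK// -sqr_L2norm lee_fin.
  rewrite ler_pXn2r ?nnegrE ?L2norm_ge0 ?(ltW e0)// ltW// NP//.
  by rewrite (leq_trans (leq_addl j N)).
have lh : L2 h.
  have [N NP] := uh 1 ltr01.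
  suff l1 : L2 (fun x => u N x - h x).
    by have := L2B (lu N) l1; under eq_fun do rewrite subKr.
  split; first by apply: cmeasurableB => //; exact: L2_cmeasurable.
  by rewrite (le_lt_trans (NP N _))// ltry.
exists h => //; apply/cvgrPdist_le => e e0; have [N NP] := uh e e0.
exists N => // n /NP /=; rewrite sub0r normrN ger0_norm ?L2norm_ge0//.
rewrite -sqnormK; last exact: L2B.
by rewrite -sqr_L2norm lee_fin ler_pXn2r ?nnegrE ?L2norm_ge0 ?(ltW e0).
Qed.

End riesz_fischer.

Section linear_combinations.
Context {R : realType} {I : eqType}.
Implicit Types (J : set I) (r : seq I) (c : I -> R[i]) (y : I -> R -> R[i]).

Definition lincomb y r c (x : R) : R[i] := \sum_(k <- r) c k * y k x.

Definition supported_on r c : Prop := uniq r /\ forall k, k \notin r -> c k = 0.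

Lemma big_supported (V : nmodType) (F : I -> V) r r' : uniq r -> uniq r' ->
  {subset r <= r'} -> (forall k, k \notin r -> F k = 0) ->
  \sum_(k <- r) F k = \sum_(k <- r') F k.
Proof.
move=> ur ur' rr' F0; rewrite [RHS](bigID (mem r))/= [X in _ + X]big1 ?addr0//.
rewrite -[RHS]big_filter; apply: perm_big; apply: uniq_perm => //; first exact: filter_uniq.
by move=> k; rewrite mem_filter andb_idr//; exact: rr'.
Qed.

Lemma lincomb_delta r c k : supported_on r c -> \sum_(j <- r) c j * (j == k)%:R = c k.
Proof.
move=> [ur c0]; have [kr|kr] := boolP (k \in r).
  by rewrite (bigD1_seq k)//= eqxx mulr1 big1 ?addr0// => j /negbTE ->; rewrite mulr0.
rewrite c0// big_seq big1// => j jr; have [jk|] := eqVneq j k; last by rewrite mulr0.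
by rewrite -jk jr in kr.
Qed.

Lemma supported_on_linear (a : R[i]) r c r' c' : supported_on r c -> supported_on r' c' ->
  supported_on (undup (r ++ r')) (fun k => a * c k + c' k).
Proof.
move=> [_ c0] [_ c'0]; split=> [|k]; first exact: undup_uniq.
by rewrite mem_undup mem_cat negb_or => /andP[/c0 -> /c'0 ->]; rewrite mulr0 addr0.
Qed.

Lemma lincomb_linear (a : R[i]) y r c r' c' : supported_on r c -> supported_on r' c' ->
  (fun x => a * lincomb y r c x + lincomb y r' c' x) =
  lincomb y (undup (r ++ r')) (fun k => a * c k + c' k).
Proof.
move=> [ur c0] [ur' c'0]; apply/funext => x; rewrite /lincomb.
rewrite (@big_supported _ _ r (undup (r ++ r'))) ?undup_uniq//; first last.
- by move=> k /c0 ->; rewrite mul0r.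
- by move=> k kr; rewrite mem_undup mem_cat kr.
rewrite (@big_supported _ _ r' (undup (r ++ r'))) ?undup_uniq//; first last.
- by move=> k /c'0 ->; rewrite mul0r.
- by move=> k kr; rewrite mem_undup mem_cat kr orbT.
by rewrite mulr_sumr -big_split; apply: eq_bigr => k _ /=; rewrite mulrDl mulrA.
Qed.

Lemma supported_on1 k : supported_on [:: k] (fun j => (j == k)%:R).
Proof. by split=> // j; rewrite inE => /negbTE ->. Qed.

Lemma lincomb1 y k : lincomb y [:: k] (fun j => (j == k)%:R) = y k.
Proof. by apply/funext => x; rewrite /lincomb big_seq1 eqxx mul1r. Qed.

Lemma L2_lincomb y r c : (forall k, L2 (y k)) -> L2 (lincomb y r c).
Proof. by move=> ly; apply: L2_sum => k; exact: L2Z. Qed.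

Lemma L2norm_lincomb_le y r c : (forall k, L2 (y k)) ->
  L2norm (lincomb y r c) <= \sum_(k <- r) normc (c k) * L2norm (y k).
Proof.
move=> ly; rewrite /lincomb; elim: r => [|k r IHr].
  by under eq_fun do rewrite big_nil; rewrite big_nil /L2norm sqnorm0 sqrtr0.
under eq_fun do rewrite big_cons; rewrite big_cons.
apply: le_trans (minkowski (L2Z (c k) (ly k)) (L2_lincomb r c ly)) _.
by rewrite lerD// L2normZ.
Qed.

Lemma dot_lincombl y r c h : (forall k, L2 (y k)) -> L2 h ->
  dot (lincomb y r c) h = \sum_(k <- r) c k * dot (y k) h.
Proof.
move=> ly lh; rewrite dot_suml//; last by move=> k; exact: L2Z.
by apply: eq_bigr => k _; rewrite dotZl.
Qed.

Lemma span_lincombP J y g : span_of J y g <->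
  exists r c, [/\ supported_on r c, forall k, k \in r -> J k & g = lincomb y r c].
Proof.
split=> [[s [c [sJ ->]]]|[r [c [_ rJ ->]]]]; last by exists r, c.
exists (undup s), (fun k => c k *+ count_mem k s); split.
- split=> [|k]; first exact: undup_uniq.
  by rewrite mem_undup => /count_memPn ->.
- by move=> k; rewrite mem_undup; exact: sJ.
- apply/funext => x; rewrite /lincomb -[LHS]big_undup_iterop_count.
  by apply: eq_bigr => k _; rewrite mulrnAl.
Qed.

Lemma span_linear J y (a : R[i]) f g : span_of J y f -> span_of J y g ->
  span_of J y (fun x => a * f x + g x).
Proof.
move=> /span_lincombP[r [c [rc rJ ->]]] /span_lincombP[r' [c' [rc' rJ' ->]]].
apply/span_lincombP; exists (undup (r ++ r')), (fun k => a * c k + c' k).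
split; [exact: supported_on_linear| |exact: lincomb_linear].
by move=> k; rewrite mem_undup mem_cat => /orP[/rJ|/rJ'].
Qed.

Lemma span0 J y : span_of J y (fun _ => 0).
Proof. by exists [::], (fun=> 0); split=> //; apply/funext => x; rewrite big_nil. Qed.

Lemma spanD J y f g : span_of J y f -> span_of J y g -> span_of J y (fun x => f x + g x).
Proof. by move=> sf sg; have := span_linear 1 sf sg; under eq_fun do rewrite mul1r. Qed.

Lemma spanZ J y (a : R[i]) f : span_of J y f -> span_of J y (fun x => a * f x).
Proof.
by move=> sf; have := span_linear a sf (span0 J y); under eq_fun do rewrite addr0.
Qed.

Lemma span_generator J y k : J k -> span_of J y (y k).
Proof.
move=> Jk; exists [:: k], (fun j => (j == k)%:R); split; last by rewrite -[LHS]lincomb1.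
by move=> j; rewrite inE => /eqP ->.
Qed.

Lemma L2_span J y g : (forall k, L2 (y k)) -> span_of J y g -> L2 g.
Proof. by move=> ly [s [c [_ ->]]]; exact: L2_lincomb. Qed.

End linear_combinations.

Section closed_spans.
Context {R : realType} {I : eqType}.
Implicit Types (J : set I) (y : I -> R -> R[i]) (f g h : R -> R[i]).

Lemma closed_spanP J y f : (forall k, L2 (y k)) ->
  closed_span J y f <-> L2 f /\ forall e : R, 0 < e ->
    exists2 g, span_of J y g & L2norm (fun x => f x - g x) < e.
Proof.
move=> ly; have cLnormB g : L2 f -> span_of J y g ->
    cLnorm 2%:E (f \- g)%R = (L2norm (fun x => f x - g x))%:E.
  by move=> lf sg; apply/cLnorm2E/(L2B lf)/(L2_span ly sg).
split=> [[/cLp2E lf fg]|[lf fg]].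
  by split=> // e /fg[g sg]; rewrite cLnormB// lte_fin; exists g.
split=> [|e /fg[g sg fge]]; first exact/cLp2E.
by exists g => //; rewrite cLnormB// lte_fin.
Qed.

Lemma closed_span_cvgP J y f : (forall k, L2 (y k)) ->
  closed_span J y f <-> L2 f /\
    exists2 u : nat -> R -> R[i], forall n, span_of J y (u n) & L2_cvg u f.
Proof.
move=> ly; split=> [/(closed_spanP _ _ ly)[lf fJ]|[lf [u uJ uf]]].
  split=> //; have /choice[u uP] (n : nat) : exists g, span_of J y g /\
      L2norm (fun x => f x - g x) < n.+1%:R^-1.
    by have [|g] := fJ n.+1%:R^-1; [rewrite invr_gt0|exists g].
  exists u => [n|]; first by case: (uP n).
  apply: (@squeeze_cvg0 _ _ (@harmonic R)); last exact: cvg_harmonic.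
  by move=> n; rewrite L2norm_ge0 L2norm_distC ltW//; case: (uP n).
apply/(closed_spanP _ _ ly); split=> // e e0.
have /cvgrPdist_lt/(_ e e0)[N _ /(_ N (leqnn N))] := uf.
by rewrite /= sub0r normrN ger0_norm ?L2norm_ge0// L2norm_distC; exists (u N).
Qed.

Lemma span_closed_span J y f : (forall k, L2 (y k)) -> span_of J y f -> closed_span J y f.
Proof.
move=> ly sf; apply/(closed_spanP _ _ ly); split=> [|e e0]; first exact: L2_span sf.
exists f => //; under eq_fun do rewrite subrr.
by rewrite /L2norm sqnorm0 sqrtr0.
Qed.

Lemma closed_span_linear J y (a : R[i]) f g : (forall k, L2 (y k)) ->
  closed_span J y f -> closed_span J y g -> closed_span J y (fun x => a * f x + g x).
Proof.
move=> ly /(closed_span_cvgP _ _ ly)[lf [u uJ uf]] /(closed_span_cvgP _ _ ly)[lg [v vJ vg]].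
apply/(closed_span_cvgP _ _ ly); split; first exact: (L2D (L2Z a lf) lg).
exists (fun n x => a * u n x + v n x) => [n|]; first exact: span_linear.
have lu n := L2B (L2_span ly (uJ n)) lf; have lv n := L2B (L2_span ly (vJ n)) lg.
apply: (@squeeze_cvg0 _ _ (fun n => normc a * L2norm (fun x => u n x - f x) +
  L2norm (fun x => v n x - g x))) => [n|]; last first.
  rewrite -[X in _ --> X](addr0 0) -[X in _ --> X + _](mulr0 (normc a)).
  by apply: cvgD => //; exact: cvgMl_tmp.
rewrite L2norm_ge0/= (_ : (fun x => _ - _) = fun x => a * (u n x - f x) + (v n x - g x)).
  apply: le_trans (minkowski (L2Z a (lu n)) (lv n)) _; rewrite lerD2r.
  apply: le_L2norm => //; [exact: normc_ge0|by case: (L2Z a (lu n))|].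
  by move=> x; rewrite normcM.
by apply/funext => x; ring.
Qed.

Lemma closed_span_trans J J' y f : (forall k, L2 (y k)) ->
  (forall k, J' k -> closed_span J y (y k)) -> closed_span J' y f -> closed_span J y f.
Proof.
move=> ly J'J; have sub g : span_of J' y g -> closed_span J y g.
  move=> [s [c [+ ->]]]; elim: s => [_|k s IHs sJ'].
    by under eq_fun do rewrite big_nil; exact/span_closed_span/span0.
  under eq_fun do rewrite big_cons; apply: closed_span_linear => //.
    by apply/J'J/sJ'; rewrite inE eqxx.
  by apply: IHs => j js; apply: sJ'; rewrite inE js orbT.
move=> /(closed_spanP _ _ ly)[lf fJ']; apply/(closed_spanP _ _ ly); split => // e e0.
have e2 : 0 < e / 2 by rewrite divr_gt0.
have [g /sub/(closed_spanP _ _ ly)[lg gJ] fg] := fJ' _ e2.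
have [h hJ gh] := gJ _ e2; exists h => //.
apply: le_lt_trans (minkowskiB lf lg (L2_span ly hJ)) _.
by rewrite (splitr e) ltrD.
Qed.

Lemma closed_span_orthogonal J y f h : (forall k, L2 (y k)) -> L2 h ->
  (forall k, J k -> dot (y k) h = 0) -> closed_span J y f -> dot f h = 0.
Proof.
move=> ly lh oh /(closed_span_cvgP _ _ ly)[lf [u uJ uf]].
have lu n := L2_span ly (uJ n); apply: dot_cvg_eq0 uf _ => //.
rewrite (_ : (fun n => _) = fun=> 0); first exact: cvg_cst.
apply/funext => n; have [s [c [sJ ->]]] := uJ n.
rewrite dot_lincombl// big_seq big1 ?normc0// => k /sJ Jk.
by rewrite oh// mulr0.
Qed.

End closed_spans.

Section projection.
Context {R : realType} {I : eqType}.
Implicit Types (J : set I) (y : I -> R -> R[i]) (f g h v : R -> R[i]).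

Lemma minimizing_sequence_cauchy (v : nat -> R -> R[i]) (d : R) : (forall n, L2 (v n)) ->
  (forall n m, d <= sqnorm (fun x => 2^-1 * (v n x + v m x))) ->
  sqnorm (v n) @[n --> \oo] --> d -> L2_cauchy v.
Proof.
move=> lv dv /cvgrPdist_lt vd e e0.
have [N _ NP] := vd (e ^+ 2 / 4) (divr_gt0 (exprn_gt0 2 e0) (ltr0Sn _ 3)).
exists N => n m /NP/= dn /NP/= dm.
rewrite -(@ltr_pXn2r _ 2)// ?nnegrE ?L2norm_ge0 ?(ltW e0)// sqr_L2norm.
have := parallelogram (lv n) (lv m); have := dv n m.
rewrite sqnormZ; last exact: L2D.
have -> : normc (2^-1 : R[i]) ^+ 2 = 4^-1 by rewrite sqr_normcE /=; field.
move: dn dm; rewrite !ltr_norml => /andP[dn _] /andP[dm _].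
move: (sqnorm (fun x => v n x + v m x)) dn dm => S; lra.
Qed.

Lemma norm_minimizer_orthogonal v g : L2 v -> L2 g ->
  (forall z, sqnorm v <= sqnorm (fun x => v x - z * g x)) -> dot g v = 0.
Proof.
move=> lv lg vmin; have g1 : 0 < sqnorm g + 1 by rewrite ltr_wpDl ?sqnorm_ge0.
pose t := (sqnorm g + 1)^-1; have t0 : 0 < t by rewrite invr_gt0.
have := vmin ((t%:C)%C * dot v g).
rewrite sqnormB ?sqnormZ//; last exact: L2Z.
rewrite dotZr// conjcM conjc_real -mulrA (mulrC (conjc _)) mulcJ Re_realM Re_real.
rewrite normcM normc_real gtr0_norm// => tmin.
apply/eqP; rewrite (dotC lv lg) conjc_eq0 -normc_eq0 -sqrf_eq0 eq_le sqr_ge0 andbT.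
have tg : t * sqnorm g < 1 by rewrite mulrC ltr_pdivrMr// mul1r ltrDl.
move: tmin; rewrite exprMn; move: (normc _ ^+ 2) (sqr_ge0 (normc (dot v g))) => D D0 tmin.
have : 0 <= t * D * (t * sqnorm g - 2) by move: tmin; lra.
rewrite -mulrA pmulr_rge0// => tD0; nra.
Qed.

Lemma span_best_approximation J y f : (forall k, L2 (y k)) -> L2 f ->
  exists u h, [/\ forall n, span_of J y (u n), L2 h, L2_cvg (fun n x => f x - u n x) h &
    forall g, span_of J y g -> sqnorm h <= sqnorm (fun x => h x - g x)].
Proof.
move=> ly lf; pose A := [set sqnorm (fun x => f x - g x) | g in span_of J y].
have infA : has_inf A.
  split; first by exists (sqnorm (fun x => f x - 0)), (fun _ => 0) => //; exact: span0.
  by exists 0 => _ [g _ <-]; exact: sqnorm_ge0.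
have inf_le g : span_of J y g -> inf A <= sqnorm (fun x => f x - g x).
  by move=> sg; apply: ge_inf; [case: infA|exists g].
have /choice[u uP] (n : nat) : exists g, span_of J y g /\
    sqnorm (fun x => f x - g x) < inf A + harmonic n.
  have n0 : 0 < harmonic n :> R by rewrite /harmonic/= invr_gt0.
  by have [_ [g sg <-] gA] := inf_adherent n0 infA; exists g.
have su n : span_of J y (u n) by case: (uP n).
have lu n := L2_span ly (su n); have lv n := L2B lf (lu n).
have vA : sqnorm (fun x => f x - u n x) @[n --> \oo] --> inf A.
  apply: (@squeeze_cvgr _ _ _ _ (fun=> inf A) (fun n => inf A + harmonic n)).
  - by apply: nearW => n; rewrite inf_le//= ltW//; case: (uP n).
  - exact: cvg_cst.
  - rewrite -[X in _ --> X]addr0; apply: cvgD; [exact: cvg_cst|exact: cvg_harmonic].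
have [h lh vh] : exists2 h, L2 h & L2_cvg (fun n x => f x - u n x) h.
  apply: riesz_fischer => //; apply: minimizing_sequence_cauchy vA => // n m.
  rewrite (_ : (fun x => _) = fun x => f x - 2^-1 * (u n x + u m x)).
    by apply: inf_le; apply: spanZ; exact: spanD.
  by apply/funext => x; field.
have hA : sqnorm h = inf A.
  exact: cvg_unique (cvg_sqnorm lv lh vh) vA.
exists u, h; split=> // g sg; have lg := L2_span ly sg.
have vgh : L2_cvg (fun n x => f x - u n x - g x) (fun x => h x - g x).
  apply: cvg_trans vh; apply: near_eq_cvg; apply: nearW => n.
  by congr L2norm; apply/funext => x; ring.
have vghn := cvg_sqnorm (fun n => L2B (lv n) lg) (L2B lh lg) vgh.
rewrite hA; apply: cvgr_to_ge vghn _; apply: nearW => n.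
have := inf_le _ (spanD (su n) sg); congr (_ <= sqnorm _).
by apply/funext => x; rewrite opprD addrA.
Qed.

Lemma closed_span_separation J y f : (forall k, L2 (y k)) -> L2 f ->
  ~ closed_span J y f ->
  exists h, [/\ L2 h, forall k, J k -> dot (y k) h = 0 & dot f h != 0].
Proof.
move=> ly lf nf; have [u [h [su lh uh hmin]]] := span_best_approximation J ly lf.
have lu n := L2_span ly (su n).
have oh k : J k -> dot (y k) h = 0.
  move=> Jk; apply: norm_minimizer_orthogonal => // z.
  by apply: hmin; apply: spanZ; exact: span_generator.
exists h; split=> //; apply/negP => /eqP fh; apply: nf.
have h0 : dot h h = 0.
  apply: (dot_cvg_eq0 (u := fun n x => f x - u n x)) => // [n|]; first exact: L2B.
  rewrite (_ : (fun n => _) = fun=> 0); first exact: cvg_cst.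
  apply/funext => n; rewrite dotBl// fh sub0r normcN.
  by rewrite (closed_span_orthogonal ly lh oh (span_closed_span ly (su n))) normc0.
have := cvg_L2norm (fun n => L2B lf (lu n)) lh uh.
have -> : L2norm h = 0.
  by move: h0; rewrite dot_id /L2norm => /complexI ->; rewrite sqrtr0.
move=> fu; apply/(closed_span_cvgP _ _ ly); split=> //; exists u => //.
by apply: cvg_trans fu; apply: near_eq_cvg; apply: nearW => n; exact: L2norm_distC.
Qed.

End projection.

Section M_bases.
Context {R : realType} {I : eqType}.
Local Notation mu := (@lebesgue_measure R).
Implicit Types (J : set I) (y : I -> R -> R[i]) (f g h : R -> R[i]).

Lemma dot_bounded_functional (B : set (R -> R[i])) h : (forall f, B f -> L2 f) -> L2 h ->
  bounded_functional B (fun f => dot f h).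
Proof.
move=> BL lh; split=> [a f g /BL lf /BL lg|].
  by rewrite dotDl//; [rewrite dotZl|exact: L2Z].
exists (L2norm h) => f /BL lf; rewrite cLnorm2E// -EFinM lee_fin mulrC.
exact: cauchy_schwarz.
Qed.

Lemma minimal_biorthogonal J y : (forall k, L2 (y k)) -> minimal_system J y ->
  exists h : I -> R -> R[i], forall k, J k ->
    L2 (h k) /\ forall j, J j -> dot (y j) (h k) = (j == k)%:R.
Proof.
move=> ly min; suff /choice[h hP] : forall k, exists h, J k ->
    L2 h /\ forall j, J j -> dot (y j) h = (j == k)%:R by exists h.
move=> k; have [Jk|nJ] := pselect (J k); last by exists (fun _ => 0).
have [h [lh oh d0]] := closed_span_separation ly (ly k) (min k Jk).
exists (fun x => conjc (dot (y k) h)^-1 * h x) => _; split=> [|j Jj]; first exact: L2Z.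
rewrite dotZr// conjcK; have [->|jk] := eqVneq j k; first by rewrite mulVf.
by rewrite (oh j) ?mulr0//; split=> // /eqP; exact/negP.
Qed.

Lemma biorthogonal_minimal J y : (forall k, L2 (y k)) ->
  (forall k, J k -> exists2 h, L2 h & forall j, J j -> dot (y j) h = (j == k)%:R) ->
  minimal_system J y.
Proof.
move=> ly hJ k Jk cl; have [h lh yh] := hJ k Jk.
have : dot (y k) h = 0.
  apply: closed_span_orthogonal cl => // j [Jj /eqP/negbTE jk].
  by rewrite yh// jk.
by move/eqP; rewrite yh// eqxx oner_eq0.
Qed.

(* The coefficient functionals do not appear here, so that this form of totality is
   invariant under isometries. *)
Definition coefficient_total y : Prop :=
  forall (r : nat -> seq I) (c : nat -> I -> R[i]),
    (forall n, supported_on (r n) (c n)) ->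
    L2_cauchy (fun n => lincomb y (r n) (c n)) ->
    (forall k, normc (c n k) @[n --> \oo] --> 0) ->
    L2norm (lincomb y (r n) (c n)) @[n --> \oo] --> 0.

Lemma coefficient_total_dual J y (h : I -> R -> R[i]) f :
  (forall k, L2 (y k)) -> coefficient_total y ->
  (forall k, J k -> L2 (h k) /\ forall j, J j -> dot (y j) (h k) = (j == k)%:R) ->
  closed_span J y f -> (forall k, J k -> dot f (h k) = 0) ->
  {ae mu, forall x, f x = 0}.
Proof.
move=> ly ytot hP /(closed_span_cvgP _ _ ly)[lf [u uJ uf]] fh.
have /choice[rc rcP] (n : nat) : exists rc : seq I * (I -> R[i]),
    [/\ supported_on rc.1 rc.2, forall k, k \in rc.1 -> J k & u n = lincomb y rc.1 rc.2].
  by have /span_lincombP[r [c ?]] := uJ n; exists (r, c).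
have lu n := L2_span ly (uJ n).
have uE : u = (fun n => lincomb y (rc n).1 (rc n).2).
  by apply/funext => n; case: (rcP n).
have coefE n k : J k -> (rc n).2 k = dot (u n) (h k).
  move=> Jk; have [lhk hk] := hP k Jk; have [sup rJ ->] := rcP n.
  rewrite dot_lincombl// -(lincomb_delta _ sup) big_seq [RHS]big_seq.
  by apply: eq_bigr => j /rJ Jj; rewrite hk.
apply: L2norm_eq0 => //; apply: cvg_unique (cvg_L2norm lu lf uf) _ => //.
rewrite uE; apply: ytot => [n||k]; first by case: (rcP n).
  by rewrite -uE; exact: L2_cvg_cauchy uf.
have [Jk|nJk] := pselect (J k); last first.
  rewrite (_ : (fun n => _) = fun=> 0); first exact: cvg_cst.
  apply/funext => n; have [[_ c0] rJ _] := rcP n; rewrite c0 ?normc0//.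
  by apply/negP => /rJ.
have [lhk _] := hP k Jk.
apply: (@squeeze_cvg0 _ _ (fun n => L2norm (fun x => u n x - f x) * L2norm (h k))).
  move=> n; rewrite normc_ge0 andTb coefE// -[dot (u n) _]subr0 -(fh k Jk) -dotBl//.
  by apply: cauchy_schwarz => //; exact: L2B.
by rewrite -[X in _ --> X](mul0r (L2norm (h k))); exact: cvgMr_tmp.
Qed.

Lemma M_basis_criterion J y : (forall k, L2 (y k)) ->
  (forall k, closed_span J y (y k)) -> minimal_system J y -> coefficient_total y ->
  M_basis J y (closed_span setT y).
Proof.
move=> ly comp min tot; have sub f : closed_span setT y f -> closed_span J y f.
  by apply: closed_span_trans.
have [h hP] := minimal_biorthogonal ly min; split=> //.
  by split=> // k _; apply: span_closed_span => //; exact: span_generator.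
exists (fun k f => dot f (h k)).
  split=> [k /hP[lhk _]|j k Jj Jk]; last by have [_ ->] := hP k Jk.
  by apply: dot_bounded_functional lhk => f /(closed_spanP _ _ ly)[].
by move=> f /sub; exact: coefficient_total_dual tot hP.
Qed.

End M_bases.

Section isometric_systems.
Context {R : realType} {I : eqType}.
Implicit Types (J : set I) (y : I -> R -> R[i]).

Definition isometric y y' : Prop :=
  forall r c, L2norm (lincomb y r c) = L2norm (lincomb y' r c).

Lemma isometric_sym y y' : isometric y y' -> isometric y' y.
Proof. by move=> yy' r c. Qed.

Lemma isometric_dist y y' r c r' c' : isometric y y' ->
  supported_on r c -> supported_on r' c' ->
  L2norm (fun x => lincomb y r c x - lincomb y r' c' x) =
  L2norm (fun x => lincomb y' r c x - lincomb y' r' c' x).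
Proof.
move=> yy' sc sc'; have distE z : (fun x => lincomb z r c x - lincomb z r' c' x) =
    lincomb z (undup (r' ++ r)) (fun k => -1 * c' k + c k).
  by rewrite -lincomb_linear//; apply/funext => x; rewrite mulN1r addrC.
by rewrite !distE.
Qed.

Lemma isometric_closed_span J y y' k : isometric y y' ->
  (forall k, L2 (y k)) -> (forall k, L2 (y' k)) ->
  closed_span J y (y k) -> closed_span J y' (y' k).
Proof.
move=> yy' ly ly' /(closed_spanP _ _ ly)[_ cl].
apply/(closed_spanP _ _ ly'); split=> // e e0.
have [_ /span_lincombP[r [c [rc rJ ->]]] yg] := cl e e0.
exists (lincomb y' r c); first by exists r, c.
by move: yg; rewrite -[y k]lincomb1 -[y' k]lincomb1 (isometric_dist yy' (supported_on1 k) rc).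
Qed.

Lemma isometric_minimal J y y' : isometric y y' ->
  (forall k, L2 (y k)) -> (forall k, L2 (y' k)) ->
  minimal_system J y -> minimal_system J y'.
Proof.
move=> yy' ly ly' min k Jk cl; apply: min Jk _.
exact: isometric_closed_span (isometric_sym yy') ly' ly cl.
Qed.

Lemma isometric_coefficient_total y y' : isometric y y' ->
  coefficient_total y -> coefficient_total y'.
Proof.
move=> yy' ytot r c rc cauchy c0; under eq_fun do rewrite -yy'.
apply: ytot => // e e0; have [N NP] := cauchy e e0.
by exists N => n m Nn Nm; rewrite (isometric_dist yy' (rc n) (rc m)) NP.
Qed.

End isometric_systems.

Section orthogonal_families.
Context {R : realType} {I : choiceType}.
Variables (y : I -> R -> R[i]) (L : R).
Hypotheses (L0 : 0 < L) (ly : forall k, L2 (y k))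
  (oy : forall j k, dot (y j) (y k) = (L%:C)%C * (j == k)%:R).
Implicit Types (r : seq I) (c : I -> R[i]) (f : R -> R[i]).

Lemma sqnorm_lincomb_orthogonal r c : uniq r ->
  sqnorm (lincomb y r c) = L * \sum_(k <- r) normc (c k) ^+ 2.
Proof.
move=> ur; have lT := L2_lincomb r c ly; apply: (@complexI R).
rewrite -dot_id dot_lincombl// (rmorphM (real_complex R)) (rmorph_sum (real_complex R)).
rewrite mulr_sumr; apply: eq_big_seq => k kr.
rewrite (dotC lT (ly k)) dot_lincombl// (bigD1_seq k)//= big1 ?addr0; last first.
  by move=> j jk; rewrite oy (negbTE jk) !mulr0.
by rewrite oy eqxx mulr1 conjcM conjc_real mulrA mulcJ mulrC.
Qed.

Lemma dot_lincomb_orthogonal r c f : L2 f ->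
  dot (lincomb y r c) f = \sum_(k <- r) c k * conjc (dot f (y k)).
Proof.
by move=> lf; rewrite dot_lincombl//; apply: eq_bigr => k _; rewrite -(dotC lf (ly k)).
Qed.

Lemma complete_square_sum r c (d : I -> R[i]) :
  L * (\sum_(k <- r) normc (c k) ^+ 2) -
    2 * complex.Re (\sum_(k <- r) c k * conjc (d k)) =
  - (L^-1 * \sum_(k <- r) normc (d k) ^+ 2) +
  L * \sum_(k <- r) normc (c k - ((L^-1)%:C)%C * d k) ^+ 2.
Proof.
elim: r => [|k r IHr]; first by rewrite !big_nil /= !mulr0 subrr oppr0 addr0.
rewrite !big_cons ReD !mulrDr !opprD [LHS]addrACA IHr [RHS]addrACA; congr (_ + _).
rewrite !sqr_normcE; case: (c k) => c1 c2; case: (d k) => d1 d2 /=.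
by field; rewrite gt_eqF.
Qed.

Lemma sqnorm_sub_lincomb r c f : uniq r -> L2 f ->
  sqnorm (fun x => f x - lincomb y r c x) =
  sqnorm f - L^-1 * (\sum_(k <- r) normc (dot f (y k)) ^+ 2)
  + L * \sum_(k <- r) normc (c k - ((L^-1)%:C)%C * dot f (y k)) ^+ 2.
Proof.
move=> ur lf; have lT := L2_lincomb r c ly.
rewrite sqnormB// (dotC lT lf) Re_conjc sqnorm_lincomb_orthogonal//.
rewrite dot_lincomb_orthogonal// -[LHS]addrA complete_square_sum -addrA.
by [].
Qed.

Lemma bessel r f : uniq r -> L2 f ->
  \sum_(k <- r) normc (dot f (y k)) ^+ 2 <= L * sqnorm f.
Proof.
move=> ur lf; have := sqnorm_ge0 (fun x =>
  f x - lincomb y r (fun k => ((L^-1)%:C)%C * dot f (y k)) x).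
rewrite sqnorm_sub_lincomb// [X in _ + L * X]big1 ?mulr0 ?addr0; last first.
  by move=> k _; rewrite subrr normc0 expr0n.
by rewrite subr_ge0 ler_pdivrMl.
Qed.

Lemma parseval f : closed_span setT y f ->
  (\esum_(k in [set: I]) (normc (dot f (y k)) ^+ 2)%:E = (L * sqnorm f)%:E)%E.
Proof.
move=> /(closed_spanP _ _ ly)[lf cl]; apply/eqP; rewrite eq_le; apply/andP; split.
  apply: ge_ereal_sup => _ [X [finX _] <-].
  rewrite fsbig_finite//= sumEFin lee_fin; exact: bessel.
apply/lee_addgt0Pr => e e0; have eL : 0 < e / L by rewrite divr_gt0.
have [_ /span_lincombP[r [c [[ur _] _ ->]]] fg] := cl _ (eq_ind_r is_true eL (sqrtr_gt0 _)).
have {}fg : sqnorm (fun x => f x - lincomb y r c x) < e / L.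
  rewrite -sqr_L2norm -[ltRHS](sqr_sqrtr (ltW eL)).
  by rewrite ltr_pXn2r ?nnegrE ?L2norm_ge0 ?sqrtr_ge0.
apply: (@le_trans _ _ ((\sum_(k <- r) normc (dot f (y k)) ^+ 2) + e)%:E).
  rewrite lee_fin -ler_pdivlMl// mulrDr (mulrC _ e).
  move: fg; rewrite sqnorm_sub_lincomb//; set S' := (X in L * X).
  have : 0 <= L * S'.
    by rewrite mulr_ge0 ?(ltW L0)// sumr_ge0// => k _; rewrite sqr_ge0.
  move: (L * S') (L^-1 * _) => a b; lra.
rewrite EFinD leeD2r//; apply: (@esum_ge _ _ setT).
exists [set` r]; first by split => //; exact: finite_seq.
by rewrite -sumEFin fsbig_seq.
Qed.

End orthogonal_families.

Section oscillations.
Context {R : realType}.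
Implicit Types (w t s : R).

Definition osc w t : R[i] := expi (2 * pi * w * t).

Lemma oscDr w t s : osc w (t + s) = osc w t * osc w s.
Proof. by rewrite /osc mulrDr expiD. Qed.

Lemma oscDl w s t : osc (w + s) t = osc w t * osc s t.
Proof. by rewrite /osc mulrDr mulrDl expiD. Qed.

Lemma osc0r w : osc w 0 = 1.
Proof. by rewrite /osc mulr0 expi0. Qed.

Lemma osc0l t : osc 0 t = 1.
Proof. by rewrite /osc mulr0 mul0r expi0. Qed.

Lemma conjc_osc w t : conjc (osc w t) = osc (- w) t.
Proof. by rewrite /osc conjc_expi; congr expi; ring. Qed.

Lemma normc_osc w t : normc (osc w t) = 1.
Proof. exact: normc_expi. Qed.

Lemma cmeasurable_osc w : cmeasurable (osc w).
Proof. by apply: cmeasurable_expi; exact: mulrl_measurable. Qed.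

Lemma osc_natMl w t n : osc (w * n%:R) t = osc w t ^+ n.
Proof. by rewrite /osc -expi_natM; congr expi; ring. Qed.

Lemma osc_nat (n : nat) t : osc n%:~R t = osc 1 t ^+ n.
Proof. by rewrite -osc_natMl mul1r. Qed.

Lemma osc_periodic (k m : int) t : osc k%:~R (t + m%:~R) = osc k%:~R t.
Proof.
by rewrite oscDr [X in _ * X](_ : _ = 1) ?mulr1// /osc -mulrA -intrM expi_2pi_int.
Qed.

Lemma cintegrable_osc f w : cintegrable f -> cintegrable (fun x => f x * osc w x).
Proof.
move=> cf; apply: (cintegrableM_bounded (C := 1)) => //; first exact: cmeasurable_osc.
by move=> x; rewrite normc_osc.
Qed.

Lemma sqr_normc_1B_expi s : normc (1 - expi s) ^+ 2 = 2 - 2 * cos s.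
Proof.
rewrite sqr_normcE ReD ImD ReN ImN /=.
have := cos2Dsin2 s; rewrite !expr2; lra.
Qed.

Lemma cos_le_cos s t : 0 <= t <= pi -> t <= s <= 2 * pi - t -> cos s <= cos t.
Proof.
have cos_nincr x y : 0 <= x -> x <= y -> y <= pi -> cos y <= cos x :> R.
  move=> x0 xy ypi.
  have hx : x \in `[0, pi] by rewrite in_itv/= x0 (le_trans xy).
  have hy : y \in `[0, pi] by rewrite in_itv/= ypi (le_trans x0).
  by rewrite leNgt (ltr_cos hy hx) -leNgt.
move=> /andP[t0 tpi] /andP[ts st].
have [spi|/ltW spi] := leP s pi; first exact: cos_nincr.
have -> : cos s = cos (2 * pi - s).
  by rewrite -[RHS]cosN opprB -[RHS]cosD2pi -(mulr_natl pi 2) subrK.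
by apply: cos_nincr => //; lra.
Qed.

Lemma cos_lt1 s : 0 < `|s| < 2 * pi -> cos s < 1.
Proof.
move=> /andP[s0 s2]; rewrite -cos_norm.
pose t := Num.min `|s| (2 * pi - `|s|).
have t0 : 0 < t by rewrite lt_min s0 subr_gt0.
have t1 : t <= `|s| by rewrite ge_min lexx.
have t2 : t <= 2 * pi - `|s| by rewrite ge_min lexx orbT.
have tpi : t <= pi by lra.
apply: (@le_lt_trans _ _ (cos t)).
  by apply: cos_le_cos; [rewrite (ltW t0)|apply/andP; split => //; lra].
have t_itv : t \in `[0, pi] by rewrite in_itv/= tpi (ltW t0).
have o_itv : (0 : R) \in `[0, pi] by rewrite in_itv/= lexx pi_ge0.
by rewrite -[ltRHS]cos0 (ltr_cos o_itv t_itv).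
Qed.

Lemma expi_neq1 s : 0 < `|s| < 2 * pi -> expi s != 1.
Proof.
by move=> /cos_lt1 s1; apply/eqP => /(congr1 (@complex.Re R)) /= cs; rewrite cs ltxx in s1.
Qed.

End oscillations.

Section fejer_kernel.
Context {R : realType}.
Implicit Types (z u : R[i]) (N : nat).

Definition fejer N z : R := normc (\sum_(k < N) z ^+ k) ^+ 2 / N%:R ^+ 2.

Lemma fejer_ge0 N z : 0 <= fejer N z.
Proof. by rewrite divr_ge0 ?sqr_ge0. Qed.

Lemma fejer_tail N z : normc z = 1 ->
  fejer N z * normc (1 - z) ^+ 2 <= 4 / N%:R ^+ 2.
Proof.
move=> z1; rewrite /fejer mulrAC ler_wpM2r ?invr_ge0 ?sqr_ge0//.
rewrite -exprMn -normcM mulrC -[1 - z]opprB mulNr -subrX1 normcN.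
rewrite (_ : 4 = 2 ^+ 2); last by rewrite -natrX.
rewrite ler_pXn2r ?nnegrE ?normc_ge0//.
by rewrite (le_trans (le_normcD _ _))// normcN normcX z1 expr1n normc1.
Qed.

Lemma sqr_normc_sum N (a : 'I_N -> R[i]) :
  ((normc (\sum_k a k) ^+ 2)%:C)%C = \sum_k \sum_l a k * conjc (a l).
Proof.
rewrite -mulcJ (rmorph_sum (@conjc R)) mulr_suml.
by apply: eq_bigr => k _; rewrite mulr_sumr.
Qed.

Lemma sum_expi_root_of_unity N (k l : 'I_N) : l != k ->
  \sum_(j < N) expi (2 * pi / N%:R * (l%:R - k%:R) : R) ^+ j = 0.
Proof.
move=> lk; set s := _ * (_ - _).
have N0 : 0 < N%:R :> R by rewrite ltr0n (leq_ltn_trans _ (ltn_ord k)).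
have sN : s * N%:R = 2 * pi * (l%:Z - k%:Z)%:~R.
  by rewrite /s mulrAC divfK ?gt_eqF// intrD intrN -!pmulrn.
have kl0 : (0 : R) < `|l%:R - k%:R|.
  by rewrite normr_gt0 subr_eq0 eqr_nat (inj_eq val_inj).
have klN : `|l%:R - k%:R| < N%:R :> R.
  have lN : (l%:R : R) < N%:R by rewrite ltr_nat.
  have kN : (k%:R : R) < N%:R by rewrite ltr_nat.
  have l0 : 0 <= (l%:R : R) by []; have k0 : 0 <= (k%:R : R) by [].
  by rewrite ltr_norml; apply/andP; split; lra.
have s1 : expi s != 1.
  have pp : 0 < 2 * pi :> R by rewrite mulr_gt0 ?pi_gt0.
  apply: expi_neq1; rewrite normrM (@gtr0_norm _ (_ / _)) ?(divr_gt0 pp N0)//.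
  apply/andP; split; first by rewrite mulr_gt0// divr_gt0.
  by rewrite mulrAC ltr_pdivrMr// ltr_pM2l.
have := subrX1 (expi s) N; rewrite -expi_natM sN expi_2pi_int subrr => /esym/eqP.
by rewrite mulf_eq0 subr_eq0 (negbTE s1) => /eqP.
Qed.

Lemma fejer_partition_of_unity N u : (0 < N)%N -> normc u = 1 ->
  \sum_(j < N) fejer N (u * expi (- (2 * pi / N%:R)) ^+ j) = 1.
Proof.
move=> N0 u1; have Nr : N%:R != 0 :> R by rewrite pnatr_eq0 -lt0n.
set w := expi _; rewrite -mulr_suml.
suff -> : \sum_(j < N) normc (\sum_(k < N) (u * w ^+ j) ^+ k) ^+ 2 = N%:R ^+ 2.
  by rewrite divff// expf_neq0.
have uw1 j k : normc ((u * w ^+ j) ^+ k) = 1.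
  by rewrite normcX normcM normcX normc_expi u1 expr1n mulr1 expr1n.
apply: (@complexI R); rewrite rmorph_sum/=; under eq_bigr do rewrite sqr_normc_sum.
rewrite exchange_big/=; under eq_bigr => k _ do rewrite exchange_big/=.
transitivity (\sum_(k < N) (N%:R : R[i])); last first.
  by rewrite sumr_const card_ord (rmorphXn (real_complex R)) rmorph_nat expr2 mulr_natr.
apply: eq_bigr => k _; rewrite (bigD1 k)//= [X in _ + X]big1 ?addr0 => [|l lk].
  under eq_bigr do rewrite mulcJ uw1 expr1n.
  by rewrite sumr_const card_ord.
transitivity (u ^+ k * conjc u ^+ l *
    \sum_(j < N) expi (2 * pi / N%:R * (l%:R - k%:R) : R) ^+ j).
  rewrite mulr_sumr; apply: eq_bigr => j _.
  rewrite conjcX conjcM conjcX !exprMn /w conjc_expi opprK mulrACA; congr (_ * _).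
  by rewrite -!exprM -!expi_natM -expiD; congr expi; rewrite !natrM; ring.
by rewrite sum_expi_root_of_unity ?mulr0.
Qed.

End fejer_kernel.

Section fejer_sampling.
Context {R : realType}.
Variables a b c d : R.
Hypotheses (ac : a < c) (cd : c < d) (db : d < b).
Let w := (b - a)^-1.

Definition fejer_node (n j : nat) : R := a + (b - a) * (j%:R / n.+1%:R).

(* A discrete Riemann sum of Fejer kernels: a trigonometric polynomial that tends
   boundedly to the indicator of [[c, d]], without any integral of the kernel. *)
Definition fejer_sampling (n : nat) (t : R) : R :=
  \sum_(j < n.+1 | c <= fejer_node n j <= d) fejer n.+1 (osc w (t - fejer_node n j)).

Let ba : 0 < b - a.
Proof. by rewrite subr_gt0 (lt_trans ac)// (lt_trans cd). Qed.

Lemma osc_fejer_node n (j : nat) t : osc w (t - fejer_node n j) =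
  osc w (t - a) * expi (- (2 * pi / n.+1%:R)) ^+ j.
Proof.
rewrite /osc -expi_natM -expiD; congr expi; rewrite /fejer_node /w.
have : n.+1%:R != 0 :> R by rewrite pnatr_eq0.
move: (n.+1%:R) => N N0; have := gt_eqF ba.
by move=> ba0; field; rewrite ba0 N0.
Qed.

Lemma fejer_node_sum n t :
  \sum_(j < n.+1) fejer n.+1 (osc w (t - fejer_node n j)) = 1.
Proof.
under eq_bigr do rewrite osc_fejer_node.
by rewrite fejer_partition_of_unity// normc_osc.
Qed.

Lemma fejer_sampling_ge0 n t : 0 <= fejer_sampling n t.
Proof. by apply: sumr_ge0 => j _; exact: fejer_ge0. Qed.

Lemma fejer_samplingC n t : 1 - fejer_sampling n t =
  \sum_(j < n.+1 | ~~ (c <= fejer_node n j <= d)) fejer n.+1 (osc w (t - fejer_node n j)).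
Proof.
rewrite -(fejer_node_sum n t) (bigID (fun j : 'I__ => c <= fejer_node n j <= d))/=.
by rewrite addrAC subrr add0r.
Qed.

Lemma fejer_sampling_le1 n t : fejer_sampling n t <= 1.
Proof.
by rewrite -subr_ge0 fejer_samplingC; apply: sumr_ge0 => j _; exact: fejer_ge0.
Qed.

Lemma measurable_fejer_sampling n : measurable_fun setT (fejer_sampling n).
Proof.
rewrite /fejer_sampling; under eq_fun do rewrite -big_filter.
apply: measurable_sum => j; rewrite /fejer; apply: measurable_funM => //.
apply: measurable_sqr_normc; apply: cmeasurable_sum => k.
by under eq_fun do rewrite -osc_natMl; exact/cmeasurable_shift/cmeasurable_osc.
Qed.

Lemma fejer_node_itv n (j : 'I_n.+1) : a <= fejer_node n j < b.
Proof.
rewrite /fejer_node lerDl mulr_ge0 ?divr_ge0 ?(ltW ba)//=.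
have jn : (j%:R : R) < n.+1%:R by rewrite ltr_nat.
by rewrite -ltrBrDl -[ltRHS]mulr1 ltr_pM2l// ltr_pdivrMr ?mul1r ?ltr0n.
Qed.

Lemma fejer_sum_le n t (P : pred 'I_n.+1) (m : R) : 0 < m ->
  (forall j, P j -> m <= normc (1 - osc w (t - fejer_node n j)) ^+ 2) ->
  \sum_(j < n.+1 | P j) fejer n.+1 (osc w (t - fejer_node n j)) <= 4 / m / n.+1%:R.
Proof.
move=> m0 mP; set N : R := n.+1%:R; have N0 : 0 < N by rewrite ltr0n.
have bnd j : P j -> fejer n.+1 (osc w (t - fejer_node n j)) <= 4 / m / N ^+ 2.
  move=> /mP mj; rewrite mulrAC ler_pdivlMr//.
  apply: le_trans (fejer_tail n.+1 (normc_osc w (t - fejer_node n j))).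
  by rewrite ler_wpM2l// fejer_ge0.
apply: (@le_trans _ _ (\sum_(j < n.+1) 4 / m / N ^+ 2)).
  rewrite [leRHS](bigID P)/= -[leLHS]addr0 lerD ?ler_sum//.
  by rewrite sumr_ge0// => j _; rewrite divr_ge0 ?sqr_ge0// divr_ge0// ltW.
rewrite sumr_const card_ord -mulr_natr -/N le_eqVlt; apply/orP; left; apply/eqP.
by field; rewrite !gt_eqF.
Qed.

Lemma sqr_normc_1B_osc_ge r s : 0 <= r -> 2 * r <= b - a -> r <= `|s| <= b - a - r ->
  2 - 2 * cos (2 * pi * w * r) <= normc (1 - osc w s) ^+ 2.
Proof.
move=> r0 rba /andP[rs sr].
have pw0 : 0 < pi * w by rewrite mulr_gt0 ?pi_gt0// invr_gt0.
have pwE : pi * w * (b - a) = pi by rewrite -mulrA mulVf ?mulr1// gt_eqF.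
have angle u : 2 * pi * w * u = pi * w * (2 * u) by ring.
rewrite /osc sqr_normc_1B_expi lerD2l lerN2 ler_pM2l// !angle -[cos (_ * (2 * s))]cos_norm.
rewrite normrM (gtr0_norm pw0) normrM (@ger0_norm _ 2)//; apply: cos_le_cos.
  by rewrite mulr_ge0 ?(ltW pw0) ?mulr_ge0//= -[leRHS]pwE ler_pM2l.
have -> : 2 * pi - pi * w * (2 * r) = pi * w * (2 * (b - a - r)).
  by rewrite -{1}pwE; ring.
by rewrite !ler_pM2l// rs.
Qed.

Lemma dist_separated r t x : a <= t < b -> a <= x < b ->
  r <= `|t - c| -> r <= `|t - d| -> r <= c - a -> r <= b - d ->
  (c <= t <= d) != (c <= x <= d) -> r <= `|t - x| <= b - a - r.
Proof.
move: ac cd db => ac' cd' db' /andP[at_ tb] /andP[ax xb] rc rd ra rb bad.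
move: bad rc rd; have [xt|xt] := lerP x t; have [ct|tc] := lerP c t; have [td|dt] := lerP t d;
  have [cx|xc] := lerP c x; have [xd|dx] := lerP x d => //= _ rc rd;
  by apply/andP; split; lra.
Qed.

Lemma dist_fejer_sampling r n t : a <= t < b -> 0 < r ->
  r <= `|t - c| -> r <= `|t - d| -> r <= c - a -> r <= b - d ->
  `|fejer_sampling n t - (c <= t <= d)%R%:R| <=
    4 / (2 - 2 * cos (2 * pi * w * r)) / n.+1%:R.
Proof.
move=> tab r0 rc rd ra rb; set m := 2 - _.
have rba : 2 * r <= b - a by have := cd; lra.
have m0 : 0 < m.
  have pp := @pi_gt0 R; rewrite subr_gt0 gtr_pMr// cos_lt1//.
  rewrite gtr0_norm ?mulr_gt0 ?invr_gt0//= -mulrA gtr_pMr ?mulr_gt0//.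
  by rewrite mulrC ltr_pdivrMr// mul1r; lra.
have far (j : 'I_n.+1) : (c <= t <= d) != (c <= fejer_node n j <= d) ->
    m <= normc (1 - osc w (t - fejer_node n j)) ^+ 2.
  move=> bad; apply: sqr_normc_1B_osc_ge => //; first exact: ltW.
  by apply: dist_separated => //; exact: fejer_node_itv.
case: (c <= t <= d) far => far; last first.
  rewrite subr0 ger0_norm ?fejer_sampling_ge0//.
  by apply: fejer_sum_le => // j jP; apply: far; rewrite jP.
rewrite distrC ger0_norm ?subr_ge0 ?fejer_sampling_le1// fejer_samplingC.
by apply: fejer_sum_le => // j jP; exact: far.
Qed.

Lemma fejer_sampling_cvg t : a <= t < b -> t != c -> t != d ->
  fejer_sampling n t @[n --> \oo] --> ((c <= t <= d)%R%:R : R).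
Proof.
move=> tab tc td; pose r := Num.min (Num.min `|t - c| `|t - d|) (Num.min (c - a) (b - d)).
have r0 : 0 < r.
  by rewrite !lt_min !normr_gt0 !subr_eq0 tc td !subr_gt0 ac db.
have dist n := @dist_fejer_sampling r n t tab r0.
apply/subr_cvg0; apply: norm_cvg0.
apply: (@squeeze_cvg0 _ _ (fun n => 4 / (2 - 2 * cos (2 * pi * w * r)) * harmonic n)).
  by move=> n; rewrite normr_ge0 dist// !ge_min lexx ?orbT.
rewrite -[X in _ --> X](mulr0 (4 / (2 - 2 * cos (2 * pi * w * r)))).
by apply: cvgMl_tmp; exact: cvg_harmonic.
Qed.

Lemma fejer_samplingE n t : ((fejer_sampling n t)%:C)%C =
  \sum_(j < n.+1 | c <= fejer_node n j <= d) \sum_(k < n.+1) \sum_(l < n.+1)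
    (((n.+1%:R ^+ 2)^-1)%:C)%C * osc (w * (k%:R - l%:R)) (- fejer_node n j) *
      osc ((k%:Z - l%:Z)%:~R / (b - a)) t.
Proof.
rewrite (rmorph_sum (real_complex R)); apply: eq_bigr => j _.
rewrite /fejer (rmorphM (real_complex R))/= sqr_normc_sum mulr_suml.
apply: eq_bigr => k _; rewrite mulr_suml; apply: eq_bigr => l _.
rewrite mulrC -!mulrA; congr (_ * _).
rewrite intrB -!pmulrn (mulrC _ w) -oscDr addrC -!osc_natMl conjc_osc -oscDl.
by rewrite mulrBr.
Qed.

End fejer_sampling.

Section fourier_uniqueness.
Context {R : realType}.
Local Notation mu := (@lebesgue_measure R).
Implicit Types (a b c d : R) (f : R -> R[i]).

Definition vanishes_outside a b f : Prop := forall x, ~ (a <= x < b) -> f x = 0.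

Lemma ae_neq (a : R) : {ae mu, forall x, x != a}.
Proof.
exists [set a]; split; [exact: measurable_set1|exact: lebesgue_measure_set1|].
by move=> x /= /negP; rewrite negbK => /eqP.
Qed.

Lemma nicely_shrinking_harmonic (x : R) :
  nicely_shrinking x (fun n => ball x (harmonic n)).
Proof.
split; first by move=> n; exact: measurable_ball.
have harm0 n : 0 < harmonic n :> R by rewrite /harmonic/= invr_gt0.
exists (1, fun n => PosNum (harm0 n)); split => //=.
  exact: cvg_harmonic.
  by move=> n; exact: subset_refl.
by move=> n; rewrite mul1e.
Qed.

Lemma ae_eq0_of_itv_integrals a b (u : R -> R) : mu.-integrable setT (EFin \o u) ->
  (forall c d, a < c -> c < d -> d < b -> \int[mu]_(x in `[c, d]) u x = 0) ->
  {ae mu, forall x, a < x < b -> u x = 0}.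
Proof.
move=> iu uint.
have lu : locally_integrable setT u by exact: (open_integrable_locally openT).
apply: filterS (lebesgue_differentiation lu) => x lx /andP[ax xb].
have /(cvg_lim (@ereal_hausdorff R)) :=
  nice_lebesgue_differentiation nicely_shrinking_harmonic lu lx.
suff -> : limn (fun n => (mu (ball x (harmonic n)))^-1 *
    \int[mu]_(y in ball x (harmonic n)) (u y)%:E)%E = 0%E by move=> [].
apply/cvg_lim => //; apply: cvg_near_cst.
have /cvgrPdist_lt/(_ (Num.min (x - a) (b - x))) := @cvg_harmonic R.
rewrite lt_min !subr_gt0 ax xb => /(_ isT); apply: filterS => n.
have harm0 : 0 < harmonic n :> R by rewrite /harmonic/= invr_gt0.
rewrite sub0r normrN gtr0_norm// lt_min => /andP[harm_xa harm_bx].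
have iI : mu.-integrable `[x - harmonic n, x + harmonic n] (EFin \o u).
  by apply: integrableS iu.
rewrite ball_itv -(integral_itv_bndoo true false); last first.
  by apply/measurable_EFinP; apply: measurable_funTS; case: lu.
rewrite -[X in (_ * X)%E]fineK; last exact: integrable_fin_num.
by rewrite [fine _]uint ?mule0//; lra.
Qed.

Lemma fejer_sampling_itv_integral_eq0 a b c d (u : R -> R) : a < c -> c < d -> d < b ->
  mu.-integrable setT (EFin \o u) -> (forall x, ~ (a <= x < b) -> u x = 0) ->
  (forall n, \int[mu]_x (u x * fejer_sampling a b c d n x) = 0) ->
  \int[mu]_(x in `[c, d]) u x = 0.
Proof.
move=> ac cd db iu u0 ufs.
have mu_ : measurable_fun setT u by apply/measurable_EFinP; exact: (measurable_int mu).
rewrite Rintegral_mkcond (_ : _ \_ _ = (fun x => u x * (c <= x <= d)%R%:R)); last first.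
  apply/funext => x; rewrite patchE mem_setE in_itv/=.
  by case: ifPn => _; rewrite ?mulr1 ?mulr0.
have lim : \int[mu]_x (u x * fejer_sampling a b c d n x) @[n --> \oo] -->
    \int[mu]_x (u x * (c <= x <= d)%R%:R).
  apply: (@Rintegral_dominated_cvg _ _ _ (fun x => `|u x|)).
  - by move=> n; apply: measurable_funM => //; exact: measurable_fejer_sampling.
  - apply: measurable_funM => //; rewrite (_ : (fun x => _) = \1_`[c, d]).
      exact: measurable_indic.
    by apply/funext => x; rewrite indicE mem_setE in_itv.
  - exact: integrable_norm iu.
  - move=> n x; rewrite normrM ler_piMr// ger0_norm ?fejer_sampling_ge0//.
    exact: fejer_sampling_le1 ac cd db n x.
  apply: filterS2 (ae_neq c) (ae_neq d) => x xc xd.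
  have [xab|/u0 ->] := pselect (a <= x < b).
    by apply: cvgMl_tmp; exact: fejer_sampling_cvg.
  by under eq_fun do rewrite mul0r; rewrite mul0r; exact: cvg_cst.
rewrite (_ : (fun n => _) = fun=> 0) in lim; last exact/funext.
by apply: cvg_unique lim _ => //; exact: cvg_cst.
Qed.

Lemma cintegral_fejer_sampling a b c d n f : cintegrable f ->
  (forall k : int, cintegral (fun x => f x * osc (k%:~R / (b - a)) x) = 0) ->
  cintegral (fun x => f x * ((fejer_sampling a b c d n x)%:C)%C) = 0.
Proof.
move=> cf fk; pose q j k l : R[i] := (((n.+1%:R ^+ 2)^-1)%:C)%C *
  osc ((b - a)^-1 * ((k : 'I_n.+1)%:R - (l : 'I_n.+1)%:R)) (- fejer_node a b n j).
pose F j k l (x : R) : R[i] := q j k l * (f x * osc ((k%:Z - l%:Z)%:~R / (b - a)) x).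
have cF j k l : cintegrable (F j k l) by apply: cintegrableZ; exact: cintegrable_osc.
set s := [seq j : 'I_n.+1 <- index_enum 'I_n.+1 | c <= fejer_node a b n j <= d].
transitivity (cintegral (fun x => \sum_(j <- s) \sum_k \sum_l F j k l x)).
  congr cintegral; apply/funext => x; rewrite fejer_samplingE -big_filter.
  rewrite mulr_sumr; apply: eq_bigr => j _; rewrite mulr_sumr; apply: eq_bigr => k _.
  by rewrite mulr_sumr; apply: eq_bigr => l _; rewrite /F mulrCA.
rewrite cintegral_sum => [|j]; last by do 2 apply: cintegrable_sum => ?.
apply: big1 => j _; rewrite cintegral_sum => [|k]; last exact: cintegrable_sum.
apply: big1 => k _; rewrite cintegral_sum//.
apply: big1 => l _; rewrite /F cintegralZ ?fk ?mulr0//; exact: cintegrable_osc.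
Qed.

Lemma fourier_uniqueness a b f : cintegrable f -> vanishes_outside a b f ->
  (forall k : int, cintegral (fun x => f x * osc (k%:~R / (b - a)) x) = 0) ->
  {ae mu, forall x, f x = 0}.
Proof.
move=> cf f0 fk; have [rf jf] := cf.
have Re0 : {ae mu, forall x, a < x < b -> complex.Re (f x) = 0}.
  apply: ae_eq0_of_itv_integrals => // c d ac cd db.
  apply: (@fejer_sampling_itv_integral_eq0 a b) => // [x /f0 -> //|n].
  have /(congr1 (@complex.Re R))/= := cintegral_fejer_sampling c d n cf fk.
  by under eq_Rintegral do rewrite ReM /= mulr0 subr0.
have Im0 : {ae mu, forall x, a < x < b -> complex.Im (f x) = 0}.
  apply: ae_eq0_of_itv_integrals => // c d ac cd db.
  apply: (@fejer_sampling_itv_integral_eq0 a b) => // [x /f0 -> //|n].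
  have /(congr1 (@complex.Im R))/= := cintegral_fejer_sampling c d n cf fk.
  by under eq_Rintegral do rewrite ImM /= mulr0 add0r.
apply: filterS3 (ae_neq a) Re0 Im0 => x xa Rex Imx.
have [/andP[ax xb]|/f0//] := pselect (a <= x < b).
have axb : a < x < b by rewrite lt_neqAle eq_sym xa ax.
by apply: complex_ext; rewrite ?Rex ?Imx.
Qed.

End fourier_uniqueness.

Section translation.
Context {R : realType}.
Local Notation mu := (@lebesgue_measure R).

Lemma lebesgue_measure_shift (c : R) (A : set R) : measurable A ->
  pushforward mu ((fun x => x + c) : measurableTypeR R -> measurableTypeR R) A = mu A.
Proof.
move=> mA; have mshift := measurable_shift c.
apply/esym/lebesgue_measure_unique => //= _ [[a b]] _ <-.
rewrite /pushforward.
have -> : (fun x => x + c) @^-1` `]a, b] = `]a - c, b - c]%classic.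
  by apply/seteqP; split => x /=; rewrite !in_itv/= ltrBlDr lerBrDr.
rewrite !lebesgue_measure_itv/= !lte_fin ltrD2r.
by case: ifP => // _; rewrite -!EFinB; congr EFin; lra.
Qed.

Lemma ge0_integral_shift (c : R) (D : set R) (f : R -> \bar R) : measurable D ->
  measurable_fun D f -> (forall x, D x -> (0 <= f x)%E) ->
  (\int[mu]_(x in D) f x = \int[mu]_(x in (fun x => x + c)%R @^-1` D) f (x + c)%R)%E.
Proof.
move=> mD mf f0.
have := @ge0_integral_pushforward _ _ _ _ R _ (measurable_shift c) mu D f mD mf.
move=> /(_ _)/= <-; last by move=> x /set_mem; exact: f0.
apply: eq_measure_integral; first exact: measurable_shift.
by move=> ? A mA _; apply/esym; exact: lebesgue_measure_shift.
Qed.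

Lemma Rintegral_shift (c : R) (u : R -> R) : measurable_fun setT u ->
  \int[mu]_x u (x + c) = \int[mu]_x u x.
Proof.
move=> /measurable_EFinP mu_.
have ge0_shift (v : R -> \bar R) : measurable_fun setT v -> (forall x, (0 <= v x)%E) ->
    (\int[mu]_x v (x + c)%R = \int[mu]_x v x)%E.
  by move=> mv v0; rewrite [RHS](ge0_integral_shift c)// preimage_setT.
rewrite /Rintegral; congr fine; rewrite integralE [RHS]integralE; congr (_ - _)%E.
- rewrite -[RHS](ge0_shift _ (measurable_funepos mu_) (funepos_ge0 _)).
  by apply: eq_integral => x _; rewrite !funeposE.
- rewrite -[RHS](ge0_shift _ (measurable_funeneg mu_) (funeneg_ge0 _)).
  by apply: eq_integral => x _; rewrite !funenegE.
Qed.

Lemma cintegral_shift (c : R) (f : R -> R[i]) : cmeasurable f ->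
  cintegral (fun x => f (x + c)) = cintegral f.
Proof.
by move=> [rf jf]; apply: complex_ext => /=; [exact: Rintegral_shift rf|exact: Rintegral_shift jf].
Qed.

Lemma esqnorm_shift (c : R) (f : R -> R[i]) : cmeasurable f ->
  esqnorm (fun x => f (x + c)) = esqnorm f.
Proof.
move=> mf; apply/esym; rewrite /esqnorm (ge0_integral_shift c)//.
  by apply/measurable_EFinP; exact: measurable_sqr_normc.
by move=> x _; rewrite lee_fin sqr_ge0.
Qed.

Definition int_of_nat (n : nat) : int := if odd n then Negz n./2 else Posz n./2.

Lemma int_of_nat_bij : set_bij setT setT int_of_nat.
Proof.
pose g (k : int) : nat := match k with Posz n => n.*2 | Negz n => n.*2.+1 end.
have gK : cancel int_of_nat g.
  move=> n; rewrite /int_of_nat; case: ifP => on /=; rewrite -[RHS]odd_double_half on//.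
have Kg : cancel g int_of_nat.
  by case=> n; rewrite /int_of_nat/= odd_double/= ?uphalf_double ?doubleK.
split => // [n m _ _ /(congr1 g)|k _]; first by rewrite !gK.
by exists (g k) => //; exact: Kg.
Qed.

Lemma esum_intE (a : int -> \bar R) : (forall k, (0 <= a k)%E) ->
  (\esum_(k in [set: int]) a k = \sum_(i <oo) a (int_of_nat i))%E.
Proof.
by move=> a0; rewrite nneseries_esumT// (reindex_esum _ _ _ _ int_of_nat_bij).
Qed.

Lemma esum_intZl (a : int -> \bar R) (x : R) : 0 <= x -> (forall k, (0 <= a k)%E) ->
  (\esum_(k in [set: int]) (x%:E * a k) = x%:E * \esum_(k in [set: int]) a k)%E.
Proof.
by move=> x0 a0; rewrite !esum_intE ?nneseriesZl// => k; rewrite mule_ge0.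
Qed.

Definition periodize (p : R) (f : R -> \bar R) (t : R) : \bar R :=
  (\esum_(k in [set: int]) f (t + k%:~R * p)%R)%E.

Lemma measurable_periodize (p : R) (f : R -> \bar R) :
  measurable_fun setT f -> (forall x, (0 <= f x)%E) ->
  measurable_fun setT (periodize p f).
Proof.
move=> mf f0; rewrite /periodize; under eq_fun do rewrite esum_intE//.
apply: ge0_emeasurable_sum => // n _.
exact: (measurableT_comp mf (measurable_shift _)).
Qed.

Lemma floor_itv (p x : R) (k : int) : 0 < p ->
  (k%:~R * p <= x < k%:~R * p + p) = (k == Num.floor (x / p)).
Proof.
move=> p0; have -> : k%:~R * p + p = (k + 1)%:~R * p by rewrite intrD mulrDl mul1r.
rewrite -ler_pdivlMr// -ltr_pdivrMr// eq_sym; apply/idP/idP => [itv|/eqP <-].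
  by apply/eqP; exact: floor_def.
by rewrite floor_le floorD1_gt.
Qed.

Lemma integral_periodize (p : R) (f : R -> \bar R) : 0 < p ->
  measurable_fun setT f -> (forall x, (0 <= f x)%E) ->
  (\int[mu]_x f x = \int[mu]_(t in `[0%R, p[) periodize p f t)%E.
Proof.
move=> p0 mf f0; pose F n := `[(int_of_nat n)%:~R * p, (int_of_nat n)%:~R * p + p[%classic.
have Fcover : \bigcup_n F n = setT.
  apply/seteqP; split => // x _.
  have [_ _ /(_ (Num.floor (x / p)) I)[n _ nE]] := int_of_nat_bij.
  by exists n => //; rewrite /F/= in_itv/= floor_itv// nE.
have Ftriv : trivIset setT F.
  apply/trivIsetP => i j _ _ ij; apply/seteqP; split => // x [].
  rewrite /F/= !in_itv/= !floor_itv// => /eqP ix /eqP jx.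
  have [_ inj _] := int_of_nat_bij.
  by move/eqP: ij; apply; apply: inj; rewrite ?inE// ix.
rewrite -[in LHS]Fcover ge0_integral_bigcup//; last 2 first.
- by move=> n; exact: measurable_itv.
- by rewrite Fcover.
rewrite /periodize; under [RHS]eq_integral do rewrite esum_intE//.
rewrite integral_nneseries//; last first.
  by move=> n; apply: measurable_funTS; exact: measurableT_comp mf (measurable_shift _).
apply: eq_eseriesr => n _.
have mF : measurable (F n) by exact: measurable_itv.
rewrite (ge0_integral_shift ((int_of_nat n)%:~R * p) mF)//; last exact: measurable_funTS.
rewrite (_ : _ @^-1` F n = `[0%R, p[%classic)//.
by rewrite /F; apply/seteqP; split => t /=; rewrite !in_itv/= [t + _]addrC lerDl ltrD2l.
Qed.

End translation.

Section intervals.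
Context {R : realType}.
Local Notation mu := (@lebesgue_measure R).
Implicit Types (a b : R) (k : int) (f g h : R -> R[i]).

Lemma Rintegral_sin_itv (w c a b : R) : w != 0 -> a < b ->
  \int[mu]_(x in `[a, b[) sin (w * x + c) = (cos (w * a + c) - cos (w * b + c)) / w.
Proof.
move=> w0 ab; pose F (x : R) : R := - w^-1 * cos (w * x + c).
have daff (x : R) : is_derive x (1 : R) (fun y => w * y + c) w.
  by apply: is_derive_eq; rewrite !(scaler0, scaler1, addr0, add0r, mulr1)//; exact: mulr1.
have dF (x : R) : is_derive x (1 : R) F (sin (w * x + c)).
  have dcos := is_derive1_comp (f := cos) (g := fun y => w * y + c) (is_derive_cos _) (daff x).
  apply: is_derive_eq (is_deriveZ (- w^-1) dcos) _.
  by rewrite /= /GRing.scale/=; field.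
have cF : continuous F.
  by move=> x; apply: differentiable_continuous; apply/derivable1_diffP; case: (dF x).
have csin : continuous (fun x : R => sin (w * x + c)).
  move=> x; apply: continuous_comp; last exact: continuous_sin.
  by apply: cvgD; [apply: cvgM; [exact: cvg_cst|exact: cvg_id]|exact: cvg_cst].
rewrite /Rintegral integral_itv_bndo_bndc; last first.
  by apply/measurable_EFinP; apply: measurable_funTS; exact: continuous_measurable_fun.
rewrite (continuous_FTC2 (F := F) ab)//.
- by rewrite /F/=; ring.
- exact: continuous_subspaceT.
- split=> [x _||]; first by case: (dF x).
    by apply: cvg_at_right_filter; exact: cF.
  by apply: cvg_at_left_filter; exact: cF.
- by move=> x _; rewrite derive1E; case: (dF x).
Qed.

Lemma Rintegral_sin_period a b c k : a < b -> k != 0 ->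
  \int[mu]_(x in `[a, b[) sin (2 * pi * (k%:~R / (b - a)) * x + c) = 0.
Proof.
move=> ab k0; have ba : b - a != 0 by rewrite subr_eq0 gt_eqF.
rewrite Rintegral_sin_itv//; last first.
  by rewrite !mulf_neq0 ?invr_eq0 ?intr_eq0// gt_eqF ?pi_gt0.
set w := 2 * pi * _; have -> : w * b + c = (w * a + c) + 2 * pi * k%:~R.
  by rewrite /w; field.
have := expi_2pi_int (R := R) k; rewrite /expi => -[ck sk].
by rewrite (cosD (_ + c)) ck sk mulr1 mulr0 subr0 subrr mul0r.
Qed.

Definition box a b (x : R) : R[i] := ((\1_(`[a, b[) x)%:C)%C.

Lemma box_in a b x : a <= x < b -> box a b x = 1.
Proof. by move=> xab; rewrite /box indicE mem_setE in_itv/= xab. Qed.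

Lemma box_out a b : vanishes_outside a b (box a b).
Proof.
by move=> x /negP/negbTE xab; rewrite /box indicE mem_setE in_itv/= xab.
Qed.

Lemma normc_box_le1 a b x : normc (box a b x) <= 1.
Proof.
by have [/box_in ->|/box_out ->] := pselect (a <= x < b); rewrite ?normc1 ?normc0.
Qed.

Lemma cmeasurable_box a b : cmeasurable (box a b).
Proof. by apply: cmeasurable_real; exact: measurable_indic. Qed.

Lemma vanishes_outsideM a b f g : vanishes_outside a b f ->
  vanishes_outside a b (fun x => f x * g x).
Proof. by move=> f0 x /f0 ->; rewrite mul0r. Qed.

Lemma L2_box a b : a < b -> L2 (box a b).
Proof.
move=> ab; apply: (L2_dominated (g := \1_(`[a, b[))).
- exact: cmeasurable_box.
- exact: integrable_indic_itv.
- move=> x; have [xab|xab] := pselect (a <= x < b).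
    by rewrite box_in// normc1 expr1n indicE mem_setE in_itv/= xab.
  by rewrite box_out// normc0 expr0n.
Qed.

Lemma cintegral_box a b f : cintegral (fun x => box a b x * f x) =
  Complex (\int[mu]_(x in `[a, b[) complex.Re (f x))
          (\int[mu]_(x in `[a, b[) complex.Im (f x)).
Proof.
have boxE x : box a b x * f x = if x \in `[a, b[ then f x else 0.
  by rewrite in_itv/=; case: ifPn => [/box_in->|/negP/box_out->]; rewrite ?mul1r ?mul0r.
congr Complex; rewrite [RHS]Rintegral_mkcond; apply: eq_Rintegral => x _;
  by rewrite boxE patchE mem_setE; case: ifP.
Qed.

Definition box_osc a b k (x : R) : R[i] := box a b x * osc (k%:~R / (b - a)) x.

Lemma box_osc_out a b k : vanishes_outside a b (box_osc a b k).
Proof. exact/vanishes_outsideM/box_out. Qed.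

Lemma L2_box_osc a b k : a < b -> L2 (box_osc a b k).
Proof.
move=> ab; rewrite /box_osc; under eq_fun do rewrite mulrC.
apply: (L2M_bounded (C := 1)); [exact: L2_box|exact: cmeasurable_osc|].
by move=> x; rewrite normc_osc.
Qed.

Lemma cintegral_box_osc a b k : a < b ->
  cintegral (box_osc a b k) = ((b - a)%:C)%C * (k == 0)%:R.
Proof.
move=> ab; rewrite cintegral_box; have [->|k0] := eqVneq k 0.
  under eq_Rintegral do rewrite mul0r osc0l.
  under [X in Complex _ X]eq_Rintegral do rewrite mul0r osc0l.
  rewrite !Rintegral_cst//= lebesgue_measure_itv/= lte_fin ab -EFinB mul1r mul0r.
  by rewrite mulr1.
rewrite mulr0; apply: complex_ext => /=; last first.
  by under eq_Rintegral do rewrite -[_ * _]addr0; exact: Rintegral_sin_period.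
under eq_Rintegral do rewrite -sinDpihalf.
exact: Rintegral_sin_period.
Qed.

Lemma dot_box_osc a b j k : a < b ->
  dot (box_osc a b j) (box_osc a b k) = ((b - a)%:C)%C * (j == k)%:R.
Proof.
move=> ab; rewrite -subr_eq0 -cintegral_box_osc//; congr cintegral.
apply/funext => x; have [xab|xab] := pselect (a <= x < b); last first.
  by rewrite !box_osc_out ?mul0r.
by rewrite /box_osc box_in// !mul1r conjc_osc -oscDl intrB mulrBl.
Qed.

Lemma box_osc_complete a b f : a < b -> L2 f -> vanishes_outside a b f ->
  closed_span setT (box_osc a b) f.
Proof.
move=> ab lf f0; apply: contrapT => nf.
have lb k : L2 (box_osc a b k) by exact: L2_box_osc.
have [h [lh yh /eqP fh]] := closed_span_separation lb lf nf; apply: fh.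
have : {ae mu, forall x, box a b x * conjc (h x) = 0}.
  apply: (@fourier_uniqueness _ a b).
  - exact: cintegrable_mul_conjc (L2_box ab) lh.
  - exact/vanishes_outsideM/box_out.
  move=> k; rewrite -[RHS](yh k)//; congr cintegral; apply/funext => x.
  by rewrite /box_osc mulrAC.
move=> bh0; rewrite -cintegral0; apply: ae_eq_cintegral.
- by apply: cintegrable_cmeasurable; exact: cintegrable_mul_conjc.
- exact: cmeasurable_cst.
- apply: filterS bh0 => x; have [xab|/f0 ->] := pselect (a <= x < b).
    by rewrite box_in// mul1r => ->; rewrite mulr0.
  by rewrite mul0r.
Qed.

Lemma fourier_series_parseval a b f : a < b -> L2 f -> vanishes_outside a b f ->
  (\esum_(k in [set: int]) (normc (dot f (box_osc a b k)) ^+ 2)%:E =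
   ((b - a) * sqnorm f)%:E)%E.
Proof.
move=> ab lf f0; apply: parseval; [by rewrite subr_gt0|by move=> k; exact: L2_box_osc| |].
  by move=> j k; exact: dot_box_osc.
exact: box_osc_complete.
Qed.

End intervals.

Section plancherel.
Context {R : realType}.
Local Notation mu := (@lebesgue_measure R).
Implicit Types (a b : R) (f g : R -> R[i]).

Lemma fourier_integralE f y :
  fourier_integral f y = cintegral (fun x => f x * osc (- y) x).
Proof.
by congr cintegral; apply/funext => x; congr (_ * expi _); ring.
Qed.

Lemma fourier_integralZ (z : R[i]) f y : cintegrable f ->
  fourier_integral (fun x => z * f x) y = z * fourier_integral f y.
Proof.
move=> cf; rewrite !fourier_integralE -cintegralZ; last exact: cintegrable_osc.
by congr cintegral; apply/funext => x; rewrite mulrA.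
Qed.

Lemma fourier_integralB f g y : cintegrable f -> cintegrable g ->
  fourier_integral (fun x => f x - g x) y = fourier_integral f y - fourier_integral g y.
Proof.
move=> cf cg; rewrite !fourier_integralE -cintegralB; try exact: cintegrable_osc.
by congr cintegral; apply/funext => x; rewrite mulrBl.
Qed.

Lemma fourier_integral_sum (I : Type) (s : seq I) (F : I -> R -> R[i]) y :
  (forall i, cintegrable (F i)) ->
  fourier_integral (fun x => \sum_(i <- s) F i x) y = \sum_(i <- s) fourier_integral (F i) y.
Proof.
move=> cF; rewrite fourier_integralE; under [RHS]eq_bigr do rewrite fourier_integralE.
rewrite -cintegral_sum; last by move=> i; exact: cintegrable_osc.
by congr cintegral; apply/funext => x; rewrite mulr_suml.
Qed.

Lemma continuous_Rintegral_param (F : R -> R -> R) (g : R -> R) :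
  mu.-integrable setT (EFin \o g) -> (forall y, mu.-integrable setT (EFin \o F y)) ->
  (forall x, continuous (F ^~ x)) -> (forall y x, `|F y x| <= g x) ->
  continuous (fun y => \int[mu]_x F y x).
Proof.
move=> ig iF cF Fg y.
apply: (@continuity_under_integral R _ _ mu F setT measurableT (y - 1) (y + 1) _ _ g ig).
- by move=> z _; exact: iF.
- by apply: aeW => x _ z _; exact: cF.
- by move=> z _; apply: aeW => x _; exact: Fg.
- by rewrite inE/= in_itv/=; apply/andP; split; lra.
Qed.

Lemma cmeasurable_fourier f : cintegrable f -> cmeasurable (fourier_integral f).
Proof.
move=> cf; have inf := integrable_normc cf.
have cphase (x : R) : continuous (fun y : R => 2 * pi * - y * x).
  move=> y; apply: cvgM; last exact: cvg_cst.
  by apply: cvgM; [exact: cvg_cst|apply: cvgN; exact: cvg_id].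
have ccos (x : R) : continuous (fun y : R => cos (2 * pi * - y * x)).
  by move=> y; apply: continuous_comp; [exact: cphase|exact: continuous_cos].
have csin (x : R) : continuous (fun y : R => sin (2 * pi * - y * x)).
  by move=> y; apply: continuous_comp; [exact: cphase|exact: continuous_sin].
have bnd y x : normc (f x * osc (- y) x) <= normc (f x).
  by rewrite normcM normc_osc mulr1.
have -> : fourier_integral f = (fun y => cintegral (fun x => f x * osc (- y) x)).
  by apply/funext => y; exact: fourier_integralE.
split; apply: continuous_measurable_fun;
  apply: (continuous_Rintegral_param inf) => [y|x y|y x].
- by case: (cintegrable_osc (- y) cf).
- under eq_fun do rewrite ReM.
  exact: cvgB (cvgM (cvg_cst _) (ccos x y)) (cvgM (cvg_cst _) (csin x y)).
- by apply: le_trans (bnd y x); exact: ler_Re_normc.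
- by case: (cintegrable_osc (- y) cf).
- under eq_fun do rewrite ImM.
  exact: cvgD (cvgM (cvg_cst _) (csin x y)) (cvgM (cvg_cst _) (ccos x y)).
- by apply: le_trans (bnd y x); exact: ler_Im_normc.
Qed.

(* The values of the transform along [t + k / (b - a)] are the Fourier coefficients
   on [[a, b[] of the modulated function, so Parseval holds for every [t]. *)
Lemma esqnorm_fourier_itv a b f : a < b -> cintegrable f -> L2 f ->
  vanishes_outside a b f -> esqnorm (fourier_integral f) = esqnorm f.
Proof.
move=> ab cf lf f0; have ba : 0 < b - a by rewrite subr_gt0.
rewrite /esqnorm (@integral_periodize _ (b - a)^-1)//; first last.
- by move=> x; rewrite lee_fin sqr_ge0.
- by apply/measurable_EFinP; apply: measurable_sqr_normc; exact: cmeasurable_fourier.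
- by rewrite invr_gt0.
rewrite -/(esqnorm f) -sqnormK//.
transitivity (\int[mu]_(t in `[0%R, ((b - a)^-1)%R[) (cst ((b - a) * sqnorm f)%R%:E t))%E.
  apply: eq_integral => t _; rewrite [RHS]/(cst _ _).
  have lg : L2 (fun x => osc (- t) x * f x).
    apply: (L2M_bounded (C := 1)) => //; first exact: cmeasurable_osc.
    by move=> x; rewrite normc_osc.
  rewrite (@eq_sqnorm _ f (fun x => osc (- t) x * f x)); last first.
    by move=> x; rewrite normcM normc_osc mul1r.
  rewrite -(fourier_series_parseval ab lg); last by move=> x /f0 ->; rewrite mulr0.
  apply: eq_esum => k _; congr (normc _ ^+ 2)%:E.
  rewrite fourier_integralE; congr cintegral; apply/funext => x.
  have [xab|xab] := pselect (a <= x < b); last by rewrite f0// mulr0 !mul0r.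
  by rewrite /box_osc box_in// mul1r conjc_osc opprD oscDl; ring.
rewrite integral_cst//= lebesgue_measure_itv/= lte_fin invr_gt0 ba -EFinD subr0 -EFinM.
by rewrite mulrAC divff ?mul1r// gt_eqF.
Qed.

Definition truncation f (n : nat) (x : R) : R[i] := box (- n.+1%:R) n.+1%:R x * f x.

Lemma truncation_eventually f x : \forall n \near \oo, truncation f n x = f x.
Proof.
exists (Num.truncn `|x|).+1 => // n /= xn; rewrite /truncation box_in ?mul1r//.
have : `|x| < n.+1%:R.
  by rewrite (lt_le_trans (truncnS_gt _))// ler_nat leqW.
by rewrite ltr_norml => /andP[x1 x2]; rewrite x2 ltW.
Qed.

Lemma normc_truncation_le f n x : normc (truncation f n x) <= normc (f x).
Proof. by rewrite normcM ler_piMl ?normc_ge0// normc_box_le1. Qed.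

Lemma ccvg_truncation f x : ccvg (truncation f ^~ x) (f x).
Proof.
apply: cvg_near_cst; apply: filterS (truncation_eventually f x) => n ->.
by rewrite subrr normc0.
Qed.

Lemma cmeasurable_truncation f n : cmeasurable f -> cmeasurable (truncation f n).
Proof. by move=> mf; apply: cmeasurableM => //; exact: cmeasurable_box. Qed.

Lemma cintegrable_truncation f n : cintegrable f -> cintegrable (truncation f n).
Proof.
move=> cf; apply: (le_cintegrable (g := fun x => normc (f x))).
- by apply: cmeasurable_truncation; exact: cintegrable_cmeasurable.
- exact: integrable_normc.
- by move=> x; exact: normc_truncation_le.
Qed.

Lemma L2_truncation f n : L2 f -> L2 (truncation f n).
Proof.
move=> lf; apply: L2M_bounded (normc_box_le1 _ _) => //; exact: cmeasurable_box.
Qed.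

Lemma truncation_L2_cvg f : L2 f -> L2_cvg (truncation f) f.
Proof.
move=> lf; have ld n : L2 (fun x => truncation f n x - f x).
  by apply: L2B => //; exact: L2_truncation.
have sq0 : sqnorm (fun x => truncation f n x - f x) @[n --> \oo] --> \int[mu]_x (0 : R).
  apply: (@Rintegral_dominated_cvg _ _ _ (fun x => 4 * normc (f x) ^+ 2)).
  - by move=> n; apply: measurable_sqr_normc; case: (ld n).
  - exact: measurable_cst.
  - exact/integrable_funZl/integrable_sqr_normc.
  - move=> n x; rewrite ger0_norm ?sqr_ge0// (le_trans (sqr_normcD_le _ _))// normcN.
    have : normc (truncation f n x) ^+ 2 <= normc (f x) ^+ 2.
      by rewrite ler_pXn2r ?nnegrE ?normc_ge0// normc_truncation_le.
    lra.
  - by apply: aeW => x; rewrite -[X in _ --> X](mulr0 0); apply: cvgM; exact: ccvg_truncation.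
rewrite Rintegral_cst// mul0r in sq0.
rewrite /L2_cvg -[X in _ --> X](sqrtr0 R); apply: continuous_cvg => //.
exact: sqrt_continuous.
Qed.

Lemma ccvg_fourier_truncation f y : cintegrable f ->
  ccvg (fun n => fourier_integral (truncation f n) y) (fourier_integral f y).
Proof.
move=> cf; rewrite fourier_integralE; under eq_fun do rewrite fourier_integralE.
have ct n := cintegrable_truncation n cf.
apply: cintegral_dominated_cvg (integrable_normc cf) _ _.
- by move=> n; apply: cintegrable_cmeasurable; exact: cintegrable_osc.
- by apply: cintegrable_cmeasurable; exact: cintegrable_osc.
- by move=> n x; rewrite normcM normc_osc mulr1 normc_truncation_le.
apply: aeW => x; rewrite /ccvg; under eq_fun do rewrite -mulrBl normcM normc_osc mulr1.
exact: ccvg_truncation.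
Qed.

Lemma esqnorm_fourier_truncation f n : cintegrable f -> L2 f ->
  esqnorm (fourier_integral (truncation f n)) = esqnorm (truncation f n).
Proof.
move=> cf lf; apply: (@esqnorm_fourier_itv (- n.+1%:R) n.+1%:R).
- by rewrite (@lt_trans _ _ 0)// ?oppr_lt0 ltr0n.
- exact: cintegrable_truncation.
- exact: L2_truncation.
- exact/vanishes_outsideM/box_out.
Qed.

Lemma esqnorm_fourier_le f : cintegrable f -> L2 f ->
  (esqnorm (fourier_integral f) <= esqnorm f)%E.
Proof.
move=> cf lf; apply: (@esqnorm_fatou _ (fun n => fourier_integral (truncation f n))).
- by move=> n; apply: cmeasurable_fourier; exact: cintegrable_truncation.
- exact: cmeasurable_fourier.
- by apply: aeW => y; exact: ccvg_fourier_truncation.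
move=> n; rewrite esqnorm_fourier_truncation// -[leRHS]mul1e -[X in (X%:E * _)%E](expr1n _ 2).
apply: le_esqnorm => [||x]; [by case: (L2_truncation n lf)|by case: lf|].
by rewrite mul1r normc_truncation_le.
Qed.

Lemma L2_fourier f : cintegrable f -> L2 f -> L2 (fourier_integral f).
Proof.
move=> cf lf; split; first exact: cmeasurable_fourier.
by apply: le_lt_trans (esqnorm_fourier_le cf lf) _; case: lf.
Qed.

Lemma plancherel f : cintegrable f -> L2 f -> L2norm (fourier_integral f) = L2norm f.
Proof.
move=> cf lf; have ct n := cintegrable_truncation n cf; have lt n := L2_truncation n lf.
have Ft n : L2norm (fourier_integral (truncation f n)) = L2norm (truncation f n).
  by rewrite /L2norm /sqnorm esqnorm_fourier_truncation.
have Fcvg : L2_cvg (fun n => fourier_integral (truncation f n)) (fourier_integral f).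
  apply: squeeze_cvg0 (truncation_L2_cvg lf) => n; rewrite L2norm_ge0/=.
  rewrite (_ : (fun x => _ - _) = fourier_integral (fun x => truncation f n x - f x)).
    have cd := cintegrableB (ct n) cf; have ld := L2B (lt n) lf.
    rewrite ler_wsqrtr// -lee_fin (sqnormK ld) (sqnormK (L2_fourier cd ld)).
    exact: esqnorm_fourier_le.
  by apply/funext => y; rewrite fourier_integralB.
have := cvg_L2norm (fun n => L2_fourier (ct n) (lt n)) (L2_fourier cf lf) Fcvg.
rewrite (_ : (fun n => _) = (fun n => L2norm (truncation f n))); last exact/funext.
by move=> FF; apply: cvg_unique FF (cvg_L2norm lt lf (truncation_L2_cvg lf)).
Qed.

End plancherel.

Section translates.
Context {R : realType}.
Implicit Types (f u phi : R -> R[i]) (r : seq int) (c : int -> R[i]).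

Definition trig r c : R -> R[i] := lincomb (fun k => osc k%:~R) r c.

Lemma cmeasurable_trig r c : cmeasurable (trig r c).
Proof.
apply: cmeasurable_sum => k; apply: cmeasurableM; first exact: cmeasurable_cst.
exact: cmeasurable_osc.
Qed.

Lemma normc_trig_le r c t : normc (trig r c t) <= \sum_(k <- r) normc (c k).
Proof.
apply: le_trans (ler_normc_sum _ _) _; apply: ler_sum => k _.
by rewrite normcM normc_osc mulr1.
Qed.

Lemma trig_periodic r c t (m : int) : trig r c (t + m%:~R) = trig r c t.
Proof. by apply: eq_bigr => k _; rewrite osc_periodic. Qed.

Lemma L2_trigM r c f : L2 f -> L2 (fun x => trig r c x * f x).
Proof.
move=> lf; apply: (L2M_bounded lf _ (normc_trig_le r c)); exact: cmeasurable_trig.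
Qed.

Lemma L2_translate u k : L2 u -> L2 (translate u k).
Proof.
move=> [mu_ su]; split; first exact: cmeasurable_shift.
by rewrite /translate esqnorm_shift.
Qed.

Lemma L2norm_translate u k : L2 u -> L2norm (translate u k) = L2norm u.
Proof. by move=> [mu_ _]; rewrite /L2norm /sqnorm /translate esqnorm_shift. Qed.

Lemma cintegrable_translate u k : cintegrable u -> cintegrable (translate u k).
Proof.
move=> /cintegrableP[mu_ su]; apply/cintegrableP; split; first exact: cmeasurable_shift.
have := @ge0_integral_shift R k%:~R setT (fun x => (normc (u x))%:E) measurableT.
rewrite preimage_setT => <-//.
- by apply/measurable_EFinP; exact: measurable_normc.
- by move=> x _; rewrite lee_fin normc_ge0.
Qed.

Lemma fourier_translate u k y : cintegrable u ->
  fourier_integral (translate u k) y = osc k%:~R y * fourier_integral u y.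
Proof.
move=> cu; rewrite !fourier_integralE -cintegralZ; last exact: cintegrable_osc.
rewrite -[RHS](cintegral_shift k%:~R); last first.
  by apply: cintegrable_cmeasurable; apply: cintegrableZ; exact: cintegrable_osc.
congr cintegral; apply/funext => x; rewrite /translate oscDr mulrCA; congr (_ * _).
rewrite mulrCA -[LHS]mulr1; congr (_ * _).
by rewrite /osc -expiD -[LHS]expi0; congr expi; ring.
Qed.

Lemma fourier_lincomb_translate r c u y : cintegrable u ->
  fourier_integral (lincomb (translate u) r c) y = trig r c y * fourier_integral u y.
Proof.
move=> cu; have ct k := cintegrable_translate k cu.
rewrite fourier_integral_sum => [|k]; last exact: cintegrableZ.
rewrite mulr_suml; apply: eq_bigr => k _.
by rewrite fourier_integralZ// fourier_translate// mulrA.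
Qed.

Lemma cLnorm2_cvg0 (v : nat -> R -> R[i]) : (forall n, L2 (v n)) ->
  cLnorm 2%:E (v n) @[n --> \oo] --> 0%E -> L2norm (v n) @[n --> \oo] --> 0.
Proof.
move=> lv /fine_cvg; rewrite (_ : fine \o _ = (fun n => L2norm (v n)))//.
by apply/funext => n /=; rewrite cLnorm2E.
Qed.

Lemma lincomb_translate_L2_cvg r c (u : nat -> R -> R[i]) f :
  (forall n, L2 (u n)) -> L2 f -> L2_cvg u f ->
  L2_cvg (fun n => lincomb (translate (u n)) r c) (lincomb (translate f) r c).
Proof.
move=> lu lf uf; have ld n := L2B (lu n) lf.
apply: (@squeeze_cvg0 _ _ (fun n => (\sum_(k <- r) normc (c k)) *
  L2norm (fun x => u n x - f x))) => [n|]; last first.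
  by rewrite -[X in _ --> X](mulr0 (\sum_(k <- r) normc (c k))); exact: cvgMl_tmp.
rewrite L2norm_ge0/= (_ : (fun x => _ - _) = lincomb (translate (fun x => u n x - f x)) r c).
  apply: le_trans (L2norm_lincomb_le r c (fun k => L2_translate k (ld n))) _.
  by rewrite mulr_suml; apply: ler_sum => k _; rewrite L2norm_translate.
by apply/funext => x; rewrite /lincomb -sumrB; apply: eq_bigr => k _; rewrite -mulrBr.
Qed.

Lemma trigM_L2_cvg r c (u : nat -> R -> R[i]) f :
  (forall n, L2 (u n)) -> L2 f -> L2_cvg u f ->
  L2_cvg (fun n x => trig r c x * u n x) (fun x => trig r c x * f x).
Proof.
move=> lu lf uf; have ld n := L2B (lu n) lf.
apply: (@squeeze_cvg0 _ _ (fun n => (\sum_(k <- r) normc (c k)) *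
  L2norm (fun x => u n x - f x))) => [n|]; last first.
  by rewrite -[X in _ --> X](mulr0 (\sum_(k <- r) normc (c k))); exact: cvgMl_tmp.
rewrite L2norm_ge0/=; under eq_fun do rewrite -mulrBr.
apply: le_L2norm => //; first by apply: sumr_ge0 => k _; exact: normc_ge0.
  by case: (L2_trigM r c (ld n)).
by move=> x; rewrite normcM ler_wpM2r ?normc_ge0// normc_trig_le.
Qed.

Lemma L2norm_lincomb_translate phi phihat r c : is_fourier_transform phi phihat ->
  L2norm (lincomb (translate phi) r c) = L2norm (fun y => trig r c y * phihat y).
Proof.
move=> [/cLp2E lp /cLp2E lh [u [uL up uh]]].
have cu n : cintegrable (u n) by apply/cLp1E; case: (uL n).
have lu n : L2 (u n) by apply/cLp2E; case: (uL n).
have lF n : L2 (fourier_integral (u n)) by exact: L2_fourier.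
have {}up : L2_cvg u phi by apply: cLnorm2_cvg0 up => n; exact: L2B.
have {}uh : L2_cvg (fun n => fourier_integral (u n)) phihat.
  by apply: cLnorm2_cvg0 uh => n; exact: L2B.
have lS v : L2 v -> L2 (lincomb (translate v) r c).
  by move=> lv; apply: L2_lincomb => k; exact: L2_translate.
have := cvg_L2norm (fun n => lS _ (lu n)) (lS _ lp) (lincomb_translate_L2_cvg r c lu lp up).
have := cvg_L2norm (fun n => L2_trigM r c (lF n)) (L2_trigM r c lh)
  (trigM_L2_cvg r c lF lh uh).
rewrite (_ : (fun n => _) = (fun n => L2norm (lincomb (translate (u n)) r c))).
  by move=> limhat lim; exact: cvg_unique lim limhat.
apply/funext => n; rewrite -[RHS]plancherel; last exact: lS; last first.
  by apply: cintegrable_sum => k; apply/cintegrableZ/cintegrable_translate.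
by congr L2norm; apply/funext => y; rewrite fourier_lincomb_translate.
Qed.

End translates.

Section periodic_weights.
Context {R : realType}.
Local Notation mu := (@lebesgue_measure R).
Implicit Types (f : R -> R[i]) (r : seq int) (c : int -> R[i]) (w : R -> \bar R).

Definition periodic_weight w : Prop :=
  [/\ measurable_fun setT w, forall t, (0 <= w t)%E,
      forall t (m : int), w (t + m%:~R) = w t &
      (\int[mu]_(t in `[0%R, 1%R[) w t < +oo)%E].

Lemma periodizationE f :
  periodization f = periodize 1 (fun x => (normc (f x) ^+ 2)%:E).
Proof. by apply/funext => t; apply: eq_esum => k _; rewrite mulr1. Qed.

Lemma periodic_weight_periodization f : L2 f -> periodic_weight (periodization f).
Proof.
move=> lf; have sqf0 x : (0 <= (normc (f x) ^+ 2)%:E)%E by rewrite lee_fin sqr_ge0.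
have msqf : measurable_fun setT (fun x => (normc (f x) ^+ 2)%:E).
  by apply/measurable_EFinP; apply: measurable_sqr_normc; case: lf.
split=> [|t|t m|].
- by rewrite periodizationE; exact: measurable_periodize.
- by apply: esum_ge0 => k _; exact: sqf0.
- rewrite /periodization [RHS](reindex_esum setT setT (fun k : int => m + k)).
    by apply: eq_esum => k _; rewrite intrD addrA.
  split; [by []|by move=> k l _ _ /addrI|].
  by move=> k _; exists (k - m) => //; rewrite addrC subrK.
- by rewrite periodizationE -integral_periodize//; case: lf.
Qed.

Lemma esqnorm_trigM r c f : L2 f -> esqnorm (fun y => trig r c y * f y) =
  (\int[mu]_(t in `[0%R, 1%R[) ((normc (trig r c t) ^+ 2)%:E * periodization f t))%E.
Proof.
move=> lf; rewrite /esqnorm (@integral_periodize _ 1)//; first last.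
- by move=> x; rewrite lee_fin sqr_ge0.
- apply/measurable_EFinP; apply: measurable_sqr_normc.
  by apply: cmeasurableM; [exact: cmeasurable_trig|case: lf].
apply: eq_integral => t _; rewrite periodizationE -esum_intZl ?sqr_ge0//.
- by apply: eq_esum => k _; rewrite mulr1 trig_periodic normcM exprMn EFinM.
- by move=> k; rewrite lee_fin sqr_ge0.
Qed.

Lemma esqnorm_itv01 f : vanishes_outside 0 1 f ->
  esqnorm f = (\int[mu]_(t in `[0%R, 1%R[) (normc (f t) ^+ 2)%:E)%E.
Proof.
move=> f0; rewrite [RHS]integral_mkcond; apply: eq_integral => t _.
rewrite patchE mem_setE in_itv/=; case: ifPn => // /negP t01.
by rewrite f0// normc0 expr0n.
Qed.

Definition sqrt_weight w (t : R) : R[i] := box 0 1 t * ((Num.sqrt (fine (w t)))%:C)%C.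

Lemma sqrt_weight_out w : vanishes_outside 0 1 (sqrt_weight w).
Proof. exact/vanishes_outsideM/box_out. Qed.

Lemma cmeasurable_sqrt_weight w : measurable_fun setT w -> cmeasurable (sqrt_weight w).
Proof.
move=> mw; apply: cmeasurableM; first exact: cmeasurable_box.
have mfw : measurable_fun setT (fine \o w).
  by apply: measurableT_comp => //; exact: fine_measurable.
exact: cmeasurable_real (measurable_sqrt mfw).
Qed.

Lemma sqr_normc_sqrt_weight w t : (0 <= w t)%E -> 0 <= t < 1 ->
  normc (sqrt_weight w t) ^+ 2 = fine (w t).
Proof.
move=> w0 t01; rewrite /sqrt_weight box_in// mul1r normc_real real_normK ?num_real//.
by rewrite sqr_sqrtr// fine_ge0.
Qed.

(* On the Fourier side [translate phi k] becomes [osc k * phihat], and only the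
   periodization of [|phihat|^2] matters for norms: hence this model. *)
Definition weighted_exp w (k : int) (t : R) : R[i] := osc k%:~R t * sqrt_weight w t.

Lemma lincomb_weighted_exp w r c :
  lincomb (weighted_exp w) r c = (fun t => trig r c t * sqrt_weight w t).
Proof.
by apply/funext => t; rewrite /trig /lincomb mulr_suml; apply: eq_bigr => k _; rewrite mulrA.
Qed.

Section weight.
Variable w : R -> \bar R.
Hypothesis hw : periodic_weight w.

Lemma weight_fin_num_ae : {ae mu, forall t, 0 <= t < 1 -> w t \is a fin_num}.
Proof.
have [mw w0 _ iw] := hw.
have /integrable_ae : mu.-integrable `[0%R, 1%R[ w.
  by apply/integrableP; split; [exact: measurable_funTS|under eq_integral do rewrite gee0_abs//].
move=> /(_ (measurable_itv _)); apply: filterS => t wt t01.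
by apply: wt; rewrite /= in_itv.
Qed.

Lemma esqnorm_trig_sqrt_weight r c : esqnorm (fun t => trig r c t * sqrt_weight w t) =
  (\int[mu]_(t in `[0%R, 1%R[) ((normc (trig r c t) ^+ 2)%:E * w t))%E.
Proof.
have [mw w0 _ _] := hw; rewrite esqnorm_itv01; last by move=> t /sqrt_weight_out ->; rewrite mulr0.
apply: ae_eq_integral => //.
- apply/measurable_funTS/measurable_EFinP; apply: measurable_sqr_normc.
  by apply: cmeasurableM; [exact: cmeasurable_trig|exact: cmeasurable_sqrt_weight].
- apply/measurable_funTS/emeasurable_funM => //.
  by apply/measurable_EFinP; apply: measurable_sqr_normc; exact: cmeasurable_trig.
- apply: filterS weight_fin_num_ae => t wt /=; rewrite in_itv/= => t01.
  by rewrite normcM exprMn sqr_normc_sqrt_weight// EFinM fineK// wt.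
Qed.

Lemma L2_sqrt_weight : L2 (sqrt_weight w).
Proof.
have [mw _ _ iw] := hw; split; first exact: cmeasurable_sqrt_weight.
have := esqnorm_trig_sqrt_weight [:: 0] (fun=> 1).
rewrite /trig /lincomb; under eq_fun do rewrite big_seq1 osc0l !mul1r.
move=> ->; under eq_integral do rewrite big_seq1 osc0l mul1r normc1 expr1n mul1e.
exact: iw.
Qed.

Lemma L2_weighted_exp k : L2 (weighted_exp w k).
Proof.
apply: (L2M_bounded (C := 1)); [exact: L2_sqrt_weight|exact: cmeasurable_osc|].
by move=> t; rewrite normc_osc.
Qed.

End weight.

Lemma isometric_translate phi phihat : is_fourier_transform phi phihat ->
  isometric (weighted_exp (periodization phihat)) (translate phi).
Proof.
move=> ft r c; have [_ /cLp2E lh _] := ft.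
rewrite (L2norm_lincomb_translate r c ft) lincomb_weighted_exp /L2norm /sqnorm.
by rewrite esqnorm_trig_sqrt_weight ?esqnorm_trigM//; exact: periodic_weight_periodization.
Qed.

End periodic_weights.

Section chords.
Context {R : realType}.
Implicit Types (s t x : R) (q : {poly R[i]}).

Lemma exprM2_norm x n : x ^+ (2 * n) = (`|x| ^+ n) ^+ 2.
Proof. by rewrite [RHS]exprAC real_normK ?num_real// -exprM. Qed.

Lemma sin_MVT x : 0 < x -> exists2 y, 0 < y < x & sin x = cos y * x.
Proof.
move=> x0.
have ds (z : R) : z \in `]0, x[ -> is_derive z (1 : R) sin (cos z).
  by move=> _; exact: is_derive_sin.
have cs : {within `[0, x], continuous (@sin R)}.
  by apply: continuous_subspaceT; exact: continuous_sin.
have [y] := MVT x0 ds cs.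
by rewrite in_itv/= => y0x; rewrite sin0 !subr0 => E; exists y.
Qed.

Lemma norm_sin_norm x : `|sin x| = `|sin `|x| |.
Proof.
have [x0|x0] := leP 0 x; first by rewrite (ger0_norm x0).
by rewrite (ltr0_norm x0) sinN normrN.
Qed.

Lemma norm_sin_le x : `|sin x| <= `|x|.
Proof.
rewrite norm_sin_norm; have [x0|x0] := eqVneq `|x| 0; first by rewrite x0 sin0 normr0.
have xp : 0 < `|x| by rewrite lt_def x0 normr_ge0.
have [y _ ->] := sin_MVT xp.
by rewrite normrM normr_id ler_piMl// cos_max.
Qed.

Lemma norm_sin_ge x : `|x| <= 1 -> cos 1 * `|x| <= `|sin x|.
Proof.
move=> x1; rewrite norm_sin_norm; have [x0|x0] := eqVneq `|x| 0.
  by rewrite x0 sin0 normr0 mulr0.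
have xp : 0 < `|x| by rewrite lt_def x0 normr_ge0.
have [y /andP[y0 yx] ->] := sin_MVT xp.
rewrite normrM normr_id ler_pM2r// (le_trans _ (ler_norm _))//.
have pi2 := @pi_ge2 R.
by apply: cos_le_cos; apply/andP; split; lra.
Qed.

Lemma normc_oscB t x : normc (osc 1 t - osc 1 x) = 2 * `|sin (pi * (t - x))|.
Proof.
apply/eqP; rewrite -(@eqrXn2 _ 2)// ?normc_ge0 ?mulr_ge0//; apply/eqP.
have -> : osc 1 t - osc 1 x = - (osc 1 x * (1 - osc 1 (t - x))).
  by rewrite mulrBr mulr1 -oscDr (addrC x) subrK opprB.
rewrite normcN normcM normc_osc mul1r /osc sqr_normc_1B_expi.
rewrite exprMn real_normK ?num_real//.
have -> : 2 * pi * 1 * (t - x) = (pi * (t - x)) *+ 2 by rewrite mulr1 -mulrA mulr_natl.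
rewrite cos_mulr2n cos2sin2 -mulr_natl; ring.
Qed.

Lemma chord_le_arc t x : normc (osc 1 t - osc 1 x) <= 2 * pi * `|t - x|.
Proof.
rewrite normc_oscB -mulrA ler_pM2l// (le_trans (norm_sin_le _))//.
by rewrite normrM (ger0_norm (pi_ge0 R)).
Qed.

Lemma arc_le_chord t x : `|t - x| <= 4^-1 ->
  2 * pi * cos 1 * `|t - x| <= normc (osc 1 t - osc 1 x).
Proof.
move=> tx; have pi0 := @pi_gt0 R; have := @pihalf_lt2 R.
rewrite ltr_pdivrMr// => pi4.
have nE : `|pi * (t - x)| = pi * `|t - x| by rewrite normrM (gtr0_norm pi0).
have := @norm_sin_ge (pi * (t - x)); rewrite nE normc_oscB => sin_ge.
have : pi * `|t - x| <= 1.
  rewrite (@le_trans _ _ (pi * 4^-1))//; first by rewrite ler_pM2l.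
  by rewrite ler_pdivrMr// mul1r ltW// (lt_le_trans pi4)// -natrM.
by move=> /sin_ge; lra.
Qed.

Lemma osc1_eq1 s : osc 1 s = 1 -> exists m : int, s = m%:~R.
Proof.
move=> s1; exists (Num.floor s); pose d := s - (Num.floor s)%:~R.
have d0 : 0 <= d by rewrite subr_ge0 floor_le.
have d1 : d < 1 by rewrite ltrBlDr addrC -[X in _ + X]/(1%:~R) -intrD floorD1_gt.
have oscd : osc 1 d = 1.
  rewrite -[RHS]s1 -[in RHS](subrK (Num.floor s)%:~R s) -/d.
  by rewrite -[X in osc X (d + _)]/(1%:~R) osc_periodic.
apply/eqP; rewrite -subr_eq0 -/d; apply: contraT => dn0.
have dp : 0 < d by rewrite lt_neqAle eq_sym dn0.
have /expi_neq1 : 0 < `|2 * pi * 1 * d| < 2 * pi.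
  have pi2 : 0 < 2 * pi :> R by rewrite mulr_gt0 ?pi_gt0.
  by rewrite mulr1 (gtr0_norm (mulr_gt0 pi2 dp)) mulr_gt0//= gtr_pMr.
by rewrite -/(osc 1 d) oscd eqxx.
Qed.

Lemma osc1_inj_mod1 t x : osc 1 t = osc 1 x -> eq_mod1 t x.
Proof. by move=> tx; apply: osc1_eq1; rewrite oscDr tx -oscDr subrr osc0r. Qed.

Lemma osc_neq0 w t : osc w t != 0 :> R[i].
Proof. by rewrite -normc_eq0 normc_osc oner_eq0. Qed.

Lemma cmeasurable_horner_osc q : cmeasurable (fun t => q.[osc 1 t]).
Proof.
under eq_fun do rewrite horner_coef.
apply: cmeasurable_sum => i; apply: cmeasurableM; first exact: cmeasurable_cst.
by under eq_fun do rewrite -osc_nat; exact: cmeasurable_osc.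
Qed.

Lemma horner_osc_bounded q : exists2 S, 0 <= S & forall t, normc (q.[osc 1 t]) <= S.
Proof.
exists (\sum_(i < size q) normc q`_i); first by apply: sumr_ge0 => i _; exact: normc_ge0.
move=> t; rewrite horner_coef (le_trans (ler_normc_sum _ _))//.
by apply: ler_sum => i _; rewrite normcM normcX normc_osc expr1n mulr1.
Qed.

Lemma horner_osc_neq0_lower q x : q.[osc 1 x] != 0 ->
  exists2 d, 0 < d & exists2 c, 0 < c & forall t, `|t - x| < d -> c <= normc (q.[osc 1 t]).
Proof.
set z := osc 1 x => qz0.
have nq0 : 0 < normc q.[z] by rewrite lt_def normc_eq0 qz0 normc_ge0.
have /factor_theorem[s qE] : root (q - (q.[z])%:P) z.
  by rewrite rootE !hornerE subrr.
have [S S0 SP] := horner_osc_bounded s.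
have D0 : 0 < 2 * (2 * pi * (S + 1)) by rewrite !mulr_gt0 ?pi_gt0 ?ltr_wpDl.
exists (normc q.[z] / (2 * (2 * pi * (S + 1)))); first by rewrite divr_gt0.
exists (normc q.[z] / 2); first by rewrite divr_gt0.
move=> t; rewrite ltr_pdivlMr// => tx.
have qt : q.[z] = q.[osc 1 t] - s.[osc 1 t] * (osc 1 t - z).
  have := congr1 (fun p => p.[osc 1 t]) qE; rewrite !hornerE => <-.
  by rewrite opprB addrCA subrr addr0.
have : normc q.[z] <= normc q.[osc 1 t] + normc s.[osc 1 t] * normc (osc 1 t - z).
  by rewrite qt (le_trans (le_normcD _ _))// normcN normcM.
have : normc s.[osc 1 t] * normc (osc 1 t - z) <= (S + 1) * (2 * pi * `|t - x|).
  by rewrite ler_pM ?normc_ge0 ?chord_le_arc// (le_trans (SP t))// lerDl.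
move: tx; move: (normc s.[osc 1 t] * _) (normc q.[z]) (normc q.[osc 1 t]) `|t - x| => *.
nra.
Qed.

Lemma horner_osc_lower q x m : ~~ (('X - (osc 1 x)%:P) ^+ m.+1 %| q) ->
  exists2 d, 0 < d & exists2 c, 0 < c &
    forall t, `|t - x| < d -> c * `|t - x| ^+ m <= normc q.[osc 1 t].
Proof.
move=> ndvd; have q0 : q != 0 by apply: contraNneq ndvd => ->; exact: dvdp0.
have [n [p /implyP/(_ q0) px qE]] := multiplicity_XsubC q (osc 1 x).
have nm : (n <= m)%N.
  by rewrite leqNgt; apply: contraNN ndvd => mn; rewrite qE dvdp_mull// dvdp_exp2l.
have [d d0 [c c0 cP]] := horner_osc_neq0_lower px.
pose kap := 2 * pi * cos 1 : R.
have kap0 : 0 < kap by rewrite !mulr_gt0 ?pi_gt0 ?cos1_gt0.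
exists (Num.min d 4^-1); first by rewrite lt_min d0 invr_gt0 ltr0n.
exists (c * kap ^+ n); first by rewrite mulr_gt0// exprn_gt0.
move=> t; rewrite lt_min => /andP[td t4]; have t4' := ltW t4.
rewrite qE hornerM horner_exp !hornerE normcM normcX -mulrA.
apply: ler_pM; [exact: ltW|by rewrite mulr_ge0 ?exprn_ge0// ltW|exact: cP|].
apply: (@le_trans _ _ ((kap * `|t - x|) ^+ n)).
  rewrite [leRHS]exprMn ler_wpM2l ?exprn_ge0 ?(ltW kap0)// ler_wiXn2l//.
  by rewrite (le_trans t4')// invf_le1// ler1n.
apply: lerXn2r; last exact: arc_le_chord.
  by rewrite nnegrE mulr_ge0 ?(ltW kap0).
by rewrite nnegrE normc_ge0.
Qed.

End chords.

Section local_integrability.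
Context {R : realType}.
Local Notation mu := (@lebesgue_measure R).
Implicit Types (f : R -> \bar R) (A B C : set R).

Lemma integrable_sub_setU f A B C : measurable A -> measurable B -> measurable C ->
  A `<=` B `|` C -> mu.-integrable B f -> mu.-integrable C f -> mu.-integrable A f.
Proof.
move=> mA mB mC ABC /integrableP[mfB fB] /integrableP[mfC fC].
have mBC : measurable (B `|` C) by exact: measurableU.
have mfBC : measurable_fun (B `|` C) f by exact/measurable_funU.
apply: (@integrableS _ _ _ mu (B `|` C)) => //; apply/integrableP; split=> //.
have BCE : B `|` C = B `|` (C `\` B) by rewrite setUDr setDv setD0.
rewrite BCE ge0_integral_setU//; first last.
- by apply/disj_setPS => t [Bt []].
- by rewrite -BCE; exact: measurableT_comp.
- exact: measurableD.
apply: lte_add_pinfty => //; apply: le_lt_trans fC.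
apply: ge0_subset_integral => //; [exact: measurableD|exact: measurableT_comp].
Qed.

Lemma integrable_sub_bigcup (I : eqType) (s : seq I) (F : I -> set R) f A :
  measurable A -> A `<=` [set t | exists2 i, i \in s & F i t] ->
  (forall i, i \in s -> measurable (F i) /\ mu.-integrable (F i) f) ->
  mu.-integrable A f.
Proof.
elim: s A => [|i s IHs] A mA AF Ff.
  rewrite (_ : A = set0); first exact: integrable_set0.
  by apply/seteqP; split=> // t /AF[].
have [mFi iFi] := Ff i (mem_head i s).
apply: (@integrable_sub_setU _ _ (F i) (A `\` F i)) => //.
- exact: measurableD.
- by move=> t At; have [Ft|nFt] := pselect (F i t); [left|right].
- apply: IHs; first exact: measurableD.
    by move=> t [/AF[j + Fjt] nFt]; rewrite inE => /predU1P[ji|js]; [rewrite -ji in nFt|exists j].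
  by move=> j js; apply: Ff; rewrite inE js orbT.
Qed.

Lemma locally_integrable_segment f (a b : R) :
  (forall t, a <= t <= b -> exists2 r : R, 0 < r & mu.-integrable `]t - r, t + r[ f) ->
  mu.-integrable `[a, b] f.
Proof.
move=> loc; have /choice[r rP] (t : R) : exists r : R, a <= t <= b ->
    0 < r /\ mu.-integrable `]t - r, t + r[ f.
  have [/loc[r r0 ir]|nt] := pselect (a <= t <= b); last by exists 0.
  by exists r.
have := @segment_compact R a b; rewrite compact_cover.
move=> /(_ _ [set` `[a, b]] (fun t => `]t - r t, t + r t[%classic)).
case=> [t _|t tab|D' D'ab cov]; first exact: interval_open.
  exists t => //=; rewrite in_itv/=.
  by have [r0 _] := rP t tab; rewrite ltrBlDr ltrDl r0.
apply: (@integrable_sub_bigcup _ (finmap.enum_fset D') (fun t => `]t - r t, t + r t[%classic)).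
- exact: measurable_itv.
- by move=> t /cov[u uD' ut]; exists u.
- move=> t tD'; split; first exact: measurable_itv.
  by have := D'ab t tD'; rewrite inE /= in_itv/= => /rP[].
Qed.

Lemma integrable_shift f c A : measurable A -> measurable_fun setT f ->
  mu.-integrable A f ->
  mu.-integrable ((fun x => x + c) @^-1` A) (fun x => f (x + c)).
Proof.
move=> mA mf /integrableP[mfA fA]; apply/integrableP; split.
  by apply: measurable_funTS; exact: measurableT_comp mf (measurable_shift c).
by rewrite -(ge0_integral_shift c (f := fun x => `|f x|%E))//; exact: measurableT_comp.
Qed.

Lemma integrable_periodic_shift f (m : int) A : measurable A -> measurable_fun setT f ->
  (forall t (m : int), f (t + m%:~R) = f t) ->
  mu.-integrable A f -> mu.-integrable ((fun x => x + m%:~R) @^-1` A) f.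
Proof.
move=> mA mf fper /(integrable_shift m%:~R mA mf).
by under [X in _.-integrable _ X]eq_fun do rewrite fper.
Qed.

Lemma periodic_integrable f (a b : R) : measurable_fun setT f ->
  (forall t (m : int), f (t + m%:~R) = f t) ->
  mu.-integrable `[0, 1[ f -> mu.-integrable `]a, b[ f.
Proof.
move=> mf fper f01; have [N bN] : exists N : nat, b <= (Num.floor a)%:~R + N%:R.
  exists (Num.truncn (b - (Num.floor a)%:~R)).+1.
  by rewrite -lerBlDl; exact/ltW/truncnS_gt.
pose F (i : nat) : set R := (fun x => x + (- (Num.floor a + i%:Z))%:~R) @^-1` `[0, 1[.
have FE i t : F i t = ((Num.floor a)%:~R + i%:R <= t < (Num.floor a)%:~R + i%:R + 1).
  rewrite /F/= in_itv/= intrN intrD -pmulrn subr_ge0.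
  by rewrite ltrBlDr [1 + _]addrC.
have mF i : measurable (F i).
  by rewrite -[F i]setTI; apply: measurable_shift => //; exact: measurable_itv.
apply: (@integrable_sub_bigcup _ (iota 0 N) F) => [||i _].
- exact: measurable_itv.
- move=> t /=; rewrite in_itv/= => /andP[at_ tb].
  have fat : (Num.floor a)%:~R <= t by rewrite (le_trans (floor_le a))// ltW.
  have t0 : 0 <= t - (Num.floor a)%:~R by rewrite subr_ge0.
  have /andP[tr_le lt_tr] := truncn_itv t0.
  exists (Num.truncn (t - (Num.floor a)%:~R)).
    rewrite mem_iota add0n -(ltr_nat R) (le_lt_trans tr_le)//.
    by rewrite ltrBlDl (lt_le_trans tb).
  by rewrite FE; move: tr_le lt_tr; rewrite -natr1 => tr_le lt_tr; apply/andP; split; lra.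
- split; first exact: mF.
  by apply: integrable_periodic_shift => //; exact: measurable_itv.
Qed.

End local_integrability.

Section weight_quotients.
Context {R : realType}.
Local Notation mu := (@lebesgue_measure R).
Variable w : R -> \bar R.
Hypothesis hw : periodic_weight w.
Implicit Types (u v : R -> R) (q : {poly R[i]}) (t x : R).

Lemma measurable_inve : measurable_fun setT (fun t => (w t)^-1)%E.
Proof.
have [mw w0 _ _] := hw.
apply: (measurability _ (ErealGenCInfty.measurableE R)) => //.
move=> _ [_ [y ->] <-]; rewrite setTI; have [y0|y0] := lerP y 0.
  rewrite (_ : _ @^-1` _ = setT)//; apply/seteqP; split => // t _ /=.
  by rewrite in_itv/= andbT (@le_trans _ _ 0%E)// ?lee_fin// inve_ge0.
have yV : (y%:E^-1 = y^-1%:E)%E by rewrite inver gt_eqF.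
rewrite (_ : _ @^-1` _ = setT `&` [set t | (w t <= y^-1%:E)%E]).
  exact: emeasurable_fun_infty_c.
apply/seteqP; split => t /=; rewrite in_itv/= andbT.
  move=> yw; split => //; rewrite -(inveK (w t)) -yV.
  by rewrite lee_pV2// ?inE ?inve_ge0// lee_fin ltW.
by move=> [_ wy]; rewrite -(inveK y%:E) lee_pV2 ?inE ?inve_ge0 ?lee_fin ?(ltW y0)// yV.
Qed.

Definition weight_quotient u (t : R) : \bar R := ((u t)%:E * (w t)^-1)%E.

Lemma weighted_inverseE m x :
  weighted_inverse w m x = weight_quotient (fun t => (t - x) ^+ (2 * m)).
Proof. by []. Qed.

Lemma weight_quotient_ge0 u t : 0 <= u t -> (0 <= weight_quotient u t)%E.
Proof. by move=> u0; have [_ w0 _ _] := hw; rewrite mule_ge0 ?lee_fin ?inve_ge0. Qed.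

Lemma measurable_weight_quotient u : measurable_fun setT u ->
  measurable_fun setT (weight_quotient u).
Proof.
by move=> mu_; apply: emeasurable_funM; [exact/measurable_EFinP|exact: measurable_inve].
Qed.

Lemma le_integrable_weight_quotient (A : set R) u v (C : R) : measurable A ->
  measurable_fun setT u -> (forall t, A t -> 0 <= u t <= C * v t) ->
  mu.-integrable A (weight_quotient v) -> mu.-integrable A (weight_quotient u).
Proof.
move=> mA mu_ uv iv; have [_ w0 _ _] := hw.
have iCv : mu.-integrable A (fun t => C%:E * weight_quotient v t)%E.
  exact: integrableZl.
apply: le_integrable iCv => // [|t /uv/andP[ut0 utv]].
  by apply: measurable_funTS; exact: measurable_weight_quotient.
rewrite /weight_quotient muleA -EFinM !gee0_abs ?mule_ge0 ?inve_ge0 ?lee_fin//.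
  by rewrite lee_wpmul2r ?inve_ge0 ?lee_fin.
by rewrite (le_trans ut0).
Qed.

Definition poly_quotient q : R -> \bar R :=
  weight_quotient (fun t => normc q.[osc 1 t] ^+ 2).

Lemma measurable_sqr_normc_horner_osc q :
  measurable_fun setT (fun t : R => normc q.[osc 1 t] ^+ 2).
Proof. exact: measurable_sqr_normc (cmeasurable_horner_osc q). Qed.

Lemma measurable_poly_quotient q : measurable_fun setT (poly_quotient q).
Proof. exact: measurable_weight_quotient (measurable_sqr_normc_horner_osc q). Qed.

Lemma poly_quotient_periodic q t (m : int) : poly_quotient q (t + m%:~R) = poly_quotient q t.
Proof.
have [_ _ wper _] := hw; rewrite /poly_quotient /weight_quotient wper.
by rewrite -[X in osc X (t + _)]/(1%:~R) osc_periodic.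
Qed.

Lemma singularity_dvdp q x (k : nat) : has_singularity w k x ->
  mu.-integrable `[0, 1[ (poly_quotient q) -> ('X - (osc 1 x)%:P) ^+ k %| q.
Proof.
move=> [k0 [r r0 [sing reg]]] iq; apply: contrapT => /negP; rewrite -(prednK k0) => ndvd.
apply: sing; rewrite !weighted_inverseE in reg *.
have mI (a b : R) : measurable (`]a, b[%classic : set R) by exact: measurable_itv.
have mpow : measurable_fun setT (fun t : R => (t - x) ^+ (2 * k.-1)).
  by apply: measurable_funX; apply: measurable_funB => //; exact: measurable_cst.
have [d d0 [c c0 lower]] := horner_osc_lower ndvd.
pose near_x : set R := `](x - d)%R, (x + d)%R[%classic.
pose far_x : set R := `](x - r)%R, (x + r)%R[%classic `\` near_x.
have mnear : measurable near_x by exact: mI.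
have mfar : measurable far_x by apply: measurableD => //; exact: mI.
apply: (@integrable_sub_setU _ _ _ near_x far_x) => //.
- by move=> t It; have [nt|ft] := pselect (near_x t); [left|right].
- have iq' := periodic_integrable (x - d) (x + d) (measurable_poly_quotient q)
    (poly_quotient_periodic q) iq.
  apply: (le_integrable_weight_quotient (C := (c ^+ 2)^-1) _ mpow _ iq') => // t.
  rewrite /near_x/= in_itv/= -ltr_distl => tx; rewrite exprM2_norm sqr_ge0/=.
  rewrite ler_pdivlMl ?exprn_gt0// -exprMn lerXn2r ?nnegrE ?normc_ge0 ?lower//.
  by rewrite mulr_ge0 ?exprn_ge0// ltW.
- have ireg : mu.-integrable far_x (weight_quotient (fun t => (t - x) ^+ (2 * k))).
    by apply: integrableS reg => //; exact: subDsetl.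
  apply: (le_integrable_weight_quotient (C := (d ^+ 2)^-1) mfar mpow _ ireg) => t [_].
  rewrite /near_x/= in_itv/= -ltr_distl => /negP; rewrite -leNgt => dt.
  have -> : (2 * k)%N = (2 * k.-1.+1)%N by rewrite prednK.
  rewrite !exprM2_norm sqr_ge0/= ler_pdivlMl ?exprn_gt0// -exprMn (exprS _ k.-1).
  rewrite lerXn2r ?nnegrE ?mulr_ge0 ?exprn_ge0 ?(ltW d0)//.
  by rewrite ler_wpM2r ?exprn_ge0.
Qed.

End weight_quotients.

Section node_polynomials.
Context {F : fieldType} {I : finType}.
Variables (z : I -> F) (lambda : I -> nat).
Implicit Types q : {poly F}.

Definition node_poly : {poly F} := \prod_i ('X - (z i)%:P) ^+ lambda i.

Lemma node_poly_monic : node_poly \is monic.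
Proof. by apply: monic_prod => i _; apply: monic_exp; exact: monicXsubC. Qed.

Lemma size_node_poly : size node_poly = (\sum_i lambda i).+1.
Proof.
rewrite /node_poly size_prod => [|i _]; last by rewrite expf_neq0// polyXsubC_eq0.
under eq_bigr do rewrite size_exp_XsubC -addn1.
by rewrite big_split/= sum1_card -addSn addnK.
Qed.

Lemma node_poly_root (t : F) : node_poly.[t] = 0 -> exists i, t = z i.
Proof.
rewrite /node_poly horner_prod => /eqP; rewrite prodf_seq_eq0 => /hasP[i _ /=].
rewrite horner_exp hornerXsubC expf_eq0 subr_eq0 => /andP[_ /eqP ->].
by exists i.
Qed.

Lemma node_poly_dvdp q : injective z ->
  (forall i, ('X - (z i)%:P) ^+ lambda i %| q) -> node_poly %| q.
Proof.
move=> zI dq; rewrite /node_poly; move: (index_enum_uniq I).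
elim: (index_enum I) => [_|i r IHr /andP[ir ur]].
  by rewrite big_nil dvd1p.
rewrite big_cons Gauss_dvdp ?dq ?IHr// coprimep_sym big_seq.
apply: (big_ind (fun p => coprimep p _)); first exact: coprime1p.
  by move=> p1 p2 c1 c2; rewrite coprimepMl c1.
move=> j jr; apply: coprimep_expl; apply: coprimep_expr; rewrite coprimep_XsubC2//.
by rewrite subr_eq0; apply: contraNneq ir => /zI ->.
Qed.

Lemma modp_node_poly q :
  exists p Q : {poly F}, (size p <= \sum_i lambda i)%N /\ q - p = node_poly * Q.
Proof.
exists (q %% node_poly), (q %/ node_poly); split.
  by rewrite -ltnS -size_node_poly ltn_modp monic_neq0// node_poly_monic.
by rewrite {1}(divp_eq q node_poly) addrK mulrC.
Qed.

Lemma inv_Xn_modp_node_poly (m : nat) : (forall i, z i != 0) ->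
  exists p Q : {poly F}, (size p <= \sum_i lambda i)%N /\ 1 - 'X^m * p = node_poly * Q.
Proof.
move=> z0; have cop : coprimep 'X^m node_poly.
  apply: coprimep_expl; rewrite coprimep_sym coprimepX rootE; apply/eqP.
  by move=> W0; have [i zi] := node_poly_root W0; have := z0 i; rewrite -zi eqxx.
have /Bezout_eq1_coprimepP[[u v] /= uv] := cop.
have [p [Q [sp uE]]] := modp_node_poly u.
by exists p, (v + 'X^m * Q); split=> //; rewrite -uv mulrDr mulrCA -uE; ring.
Qed.

End node_polynomials.

Section windows.
Context {R : realType}.
Implicit Types (n k : int) (m : nat) (p : {poly R[i]}).

Definition window n m : seq int := [seq n + i%:Z | i <- iota 0 m].

Lemma mem_window n m k : (k \in window n m) = (n <= k < n + m%:Z).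
Proof.
apply/mapP/andP => [[i +]|[nk km]].
  by rewrite mem_iota add0n => /andP[_ im] ->; rewrite lerDl ltrD2l ltz_nat.
have k0 : 0 <= k - n by rewrite subr_ge0.
exists `|k - n|%N; last by rewrite gez0_abs// subrKC.
by rewrite mem_iota add0n -ltz_nat gez0_abs// ltrBlDl.
Qed.

Lemma window_uniq n m : uniq (window n m).
Proof. by rewrite map_inj_uniq ?iota_uniq// => i j /addrI []. Qed.

(* The coefficients of the Laurent polynomial ['X^n * p]. *)
Definition laurent_coef n p k : R[i] := if n <= k then p`_(absz (k - n)) else 0.

Lemma laurent_coefD n p (i : nat) : laurent_coef n p (n + i%:Z) = p`_i.
Proof. by rewrite /laurent_coef lerDl/= addrC addKr absz_nat. Qed.

Lemma supported_laurent_coef n m p : (size p <= m)%N ->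
  supported_on (window n m) (laurent_coef n p).
Proof.
move=> pm; split=> [|k]; first exact: window_uniq.
rewrite mem_window /laurent_coef; case: ifPn => //= nk; rewrite -leNgt => mk.
apply: nth_default; rewrite (leq_trans pm)// -lez_nat gez0_abs ?subr_ge0//.
by rewrite lerBrDl.
Qed.

Lemma trig_laurent_coef n m p t : (size p <= m)%N ->
  trig (window n m) (laurent_coef n p) t = osc n%:~R t * p.[osc 1 t].
Proof.
move=> pm; rewrite /trig /lincomb big_map (horner_coef_wide _ pm) mulr_sumr.
rewrite -(big_mkord xpredT (fun i => osc n%:~R t * (p`_i * osc 1 t ^+ i))).
rewrite /index_iota subn0; apply: eq_bigr => i _.
by rewrite laurent_coefD intrD oscDl osc_nat mulrCA.
Qed.

End windows.

Section inverse_weight.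
Context {R : realType}.
Local Notation mu := (@lebesgue_measure R).
Variable w : R -> \bar R.
Hypothesis hw : periodic_weight w.
Implicit Types (r : seq int) (c : int -> R[i]) (h D : R -> R[i]).

(* [fine +oo = 0], so this vanishes where [w] is [0]. *)
Definition inv_sqrt_weight (t : R) : R[i] :=
  box 0 1 t * ((Num.sqrt (fine (w t)^-1%E))%:C)%C.

Lemma inv_sqrt_weight_out : vanishes_outside 0 1 inv_sqrt_weight.
Proof. exact/vanishes_outsideM/box_out. Qed.

Lemma cmeasurable_inv_sqrt_weight : cmeasurable inv_sqrt_weight.
Proof.
have minv := measurable_inve hw.
have mfinv : measurable_fun setT (fine \o (fun t => (w t)^-1%E)).
  by apply: measurableT_comp => //; exact: fine_measurable.
apply: cmeasurableM; first exact: cmeasurable_box.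
exact: cmeasurable_real (measurable_sqrt mfinv).
Qed.

Lemma sqr_normc_inv_sqrt_weight_le D t :
  ((normc (D t * inv_sqrt_weight t) ^+ 2)%:E <=
    weight_quotient w (fun t => normc (D t) ^+ 2)%R t)%E.
Proof.
have [_ w0 _ _] := hw; have wV0 : (0 <= (w t)^-1)%E by rewrite inve_ge0.
rewrite normcM exprMn EFinM /weight_quotient lee_wpmul2l ?lee_fin ?sqr_ge0//.
have [t01|/inv_sqrt_weight_out->] := pselect (0 <= t < 1); last by rewrite normc0 expr0n.
rewrite /inv_sqrt_weight box_in// mul1r normc_real real_normK ?num_real//.
by rewrite sqr_sqrtr ?fine_ge0//; case: (_^-1)%E wV0.
Qed.

Lemma L2_mul_inv_sqrt_weight D : cmeasurable D ->
  mu.-integrable `[0, 1[ (weight_quotient w (fun t => normc (D t) ^+ 2)) ->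
  L2 (fun t => D t * inv_sqrt_weight t).
Proof.
move=> mD /integrableP[mq iq]; have mDw : cmeasurable (fun t => D t * inv_sqrt_weight t).
  by apply: cmeasurableM => //; exact: cmeasurable_inv_sqrt_weight.
split=> //; rewrite esqnorm_itv01; last by move=> t /inv_sqrt_weight_out ->; rewrite mulr0.
apply: le_lt_trans iq; apply: ge0_le_integral => //.
- by move=> t _; rewrite lee_fin sqr_ge0.
- by apply: measurable_funTS; apply/measurable_EFinP; exact: measurable_sqr_normc.
- exact: measurableT_comp.
- move=> t _; rewrite (le_trans (sqr_normc_inv_sqrt_weight_le D t))// gee0_abs//.
  by apply: weight_quotient_ge0 => //; exact: sqr_ge0.
Qed.

Lemma lincomb_box_osc01 r c :
  lincomb (box_osc 0 1) r c = (fun t => box 0 1 t * trig r c t).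
Proof.
apply/funext => t; rewrite /trig /lincomb mulr_sumr; apply: eq_bigr => k _.
by rewrite /box_osc subr0 divr1 mulrCA.
Qed.

Lemma dot_box_osc01_lincomb r c k : supported_on r c ->
  dot (box_osc 0 1 k) (lincomb (box_osc 0 1) r c) = conjc (c k).
Proof.
move=> rc; have lb j : L2 (box_osc 0 1 j : R -> R[i]) by exact/L2_box_osc/ltr01.
rewrite (dotC (L2_lincomb r c lb)) ?dot_lincombl// -(lincomb_delta k rc); congr conjc.
by apply: eq_bigr => j _; rewrite dot_box_osc ?ltr01// subr0 mul1r.
Qed.

Lemma trig_cofactor r c h : L2 h -> supported_on r c ->
  (forall k, c k = conjc (dot (weighted_exp w k) h)) ->
  {ae mu, forall t, sqrt_weight w t * conjc (h t) = conjc (box 0 1 t * trig r c t)}.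
Proof.
move=> lh rc ch; have lw := L2_sqrt_weight hw.
have lP : L2 (lincomb (box_osc 0 1) r c : R -> R[i]).
  by apply: L2_lincomb => k; exact/L2_box_osc/ltr01.
pose G t := sqrt_weight w t * conjc (h t).
pose P t : R[i] := box 0 1 t * conjc (lincomb (box_osc 0 1) r c t).
have cG : cintegrable G by exact: cintegrable_mul_conjc.
have cP : cintegrable P by exact: cintegrable_mul_conjc (L2_box ltr01) lP.
have : {ae mu, forall t, G t - P t = 0}.
  apply: (@fourier_uniqueness R 0 1); first exact: cintegrableB.
    by move=> t t01; rewrite /G /P sqrt_weight_out// box_out// !mul0r subr0.
  move=> k; under eq_fun do rewrite mulrBl.
  rewrite cintegralB; [|exact: cintegrable_osc..]; rewrite subr0 divr1.
  apply/eqP; rewrite subr_eq0; apply/eqP.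
  transitivity (dot (weighted_exp w k) h).
    by congr cintegral; apply/funext => t; rewrite /G /weighted_exp; ring.
  rewrite -[LHS]conjcK -ch -(dot_box_osc01_lincomb k rc); congr cintegral.
  by apply/funext => t; rewrite /P /box_osc subr0 divr1; ring.
apply: filterS => t /eqP; rewrite subr_eq0 => /eqP GP; rewrite -/(G t) GP /P lincomb_box_osc01.
have [t01|t01] := pselect (0 <= t < 1); last by rewrite box_out// !mul0r conjc0.
by rewrite box_in// !mul1r.
Qed.

End inverse_weight.

Section singular_weight.
Context {R : realType}.
Local Notation mu := (@lebesgue_measure R).
Variables (w : R -> \bar R) (s : nat) (x : 'I_s -> R) (lambda : 'I_s -> nat).
Hypotheses (hw : periodic_weight w) (hsing : singularities_exactly w x lambda).
Implicit Types (n k m : int) (r : seq int) (c : int -> R[i]) (h D : R -> R[i])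
  (q : {poly R[i]}) (t : R).
Local Notation L := (\sum_j lambda j)%N.
Local Notation W := (node_poly (fun j => osc 1 (x j)) lambda).

Lemma node_poly_osc_upper j : exists2 C, 0 <= C &
  forall t, normc W.[osc 1 t] ^+ 2 <= C * (t - x j) ^+ (2 * lambda j).
Proof.
pose p := \prod_(i < s | i != j) ('X - (osc 1 (x i))%:P) ^+ lambda i : {poly R[i]}.
have [S S0 SP] := horner_osc_bounded p.
have pi2 : 0 <= 2 * pi :> R by rewrite mulr_ge0// pi_ge0.
exists ((S * (2 * pi) ^+ lambda j) ^+ 2); first exact: sqr_ge0.
move=> t; rewrite /node_poly (bigD1 j)//= -/p hornerM horner_exp !hornerE normcM normcX.
rewrite exprM2_norm -exprMn; apply: lerXn2r; rewrite ?nnegrE ?mulr_ge0 ?exprn_ge0 ?normc_ge0//.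
rewrite mulrC -mulrA -exprMn; apply: ler_pM; rewrite ?exprn_ge0 ?normc_ge0//.
apply: lerXn2r; last exact: chord_le_arc; rewrite nnegrE ?normc_ge0//.
by rewrite mulr_ge0.
Qed.

Lemma integrable_node_poly_quotient : mu.-integrable `[0, 1[ (poly_quotient w W).
Proof.
have [_ sing reg] := hsing; have mW := measurable_sqr_normc_horner_osc W.
have mI (a b : R) : measurable (`]a, b[%classic : set R) by exact: measurable_itv.
suff : mu.-integrable `[0, 1] (poly_quotient w W).
  apply: integrableS; [exact: measurable_itv|exact: measurable_itv|].
  by move=> t /=; rewrite !in_itv/= => /andP[-> /ltW].
apply: locally_integrable_segment => t _.
have [[j [m tm]]|nx] := pselect (exists j, eq_mod1 t (x j)).
  have [_ [r r0 [_ ir]]] := sing j; exists r => //.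
  have [C C0 CP] := node_poly_osc_upper j.
  have : mu.-integrable `](x j - r)%R, (x j + r)%R[ (poly_quotient w W).
    rewrite weighted_inverseE in ir.
    apply: (le_integrable_weight_quotient hw _ mW _ ir) => // u _.
    by apply/andP; split; [exact: sqr_ge0|exact: CP].
  move=> /(integrable_periodic_shift (- m) (mI _ _) (measurable_poly_quotient hw W)
    (poly_quotient_periodic hw W)).
  rewrite (_ : _ @^-1` _ = `](t - r)%R, (t + r)%R[%classic)//.
  have -> : t = x j + m%:~R by rewrite -tm addrC subrK.
  by apply/seteqP; split => u /=; rewrite !in_itv/= intrN => /andP[? ?]; apply/andP; split; lra.
have [r r0 ir] := reg t (fun j e => nx (ex_intro _ j e)); exists r => //.
have [S S0 SP] := horner_osc_bounded W.
apply: (@le_integrable_weight_quotient _ _ hw _ _ (fun=> 1) (S ^+ 2) (mI _ _) mW).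
  by move=> u _; rewrite sqr_ge0 mulr1 lerXn2r ?nnegrE ?normc_ge0.
by under [X in _.-integrable _ X]eq_fun do rewrite /weight_quotient mul1e.
Qed.

(* The vanishing orders forced by the singularities exceed the degree. *)
Lemma integrable_poly_quotient_eq0 q : (size q <= L)%N ->
  mu.-integrable `[0, 1[ (poly_quotient w q) -> q = 0.
Proof.
move=> qL iq; apply/eqP/negPn/negP => q0; have [inj sing _] := hsing.
have : W %| q.
  apply: node_poly_dvdp => [i j /osc1_inj_mod1/inj//|j].
  exact: singularity_dvdp (sing j) iq.
by move=> /(dvdp_leq q0); rewrite size_node_poly => /leq_trans/(_ qL); rewrite ltnn.
Qed.

Lemma node_poly_osc_neq0_ae : {ae mu, forall t, 0 <= t < 1 -> W.[osc 1 t] != 0}.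
Proof.
have : {ae mu, forall t, forall j, t != x j - (Num.floor (x j))%:~R}.
  by apply: filter_forall => j; exact: ae_neq.
apply: filterS => t tx t01; apply/eqP => /node_poly_root[j /osc1_inj_mod1[m tm]].
have := tx j; suff -> : Num.floor (x j) = - m.
  by rewrite intrN opprK -tm addrC subrK eqxx.
apply: floor_def; rewrite intrD intrN; move: tm t01 => /eqP; rewrite subr_eq => /eqP ->.
by move=> /andP[t_ge0 t_lt1]; apply/andP; split; lra.
Qed.

Lemma weight_gt0_ae : {ae mu, forall t, 0 <= t < 1 ->
  w t \is a fin_num /\ 0 < fine (w t)}.
Proof.
have [_ w0 _ _] := hw.
have /(@integrable_ae _ _ _ mu _ (measurable_itv _)) := integrable_node_poly_quotient.
apply: filterS3 node_poly_osc_neq0_ae (weight_fin_num_ae hw) => t Wt wt qt t01.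
have wfin := wt t01; split=> //; rewrite lt_neqAle fine_ge0// andbT eq_sym.
apply/eqP => fw0; have : poly_quotient w W t \is a fin_num by apply: qt; rewrite /= in_itv.
rewrite /poly_quotient /weight_quotient -(fineK wfin) fw0 inver eqxx gt0_muley//.
by rewrite lte_fin exprn_gt0// lt_def normc_eq0 Wt// normc_ge0.
Qed.

Lemma sqrt_weightM_inv_ae :
  {ae mu, forall t, sqrt_weight w t * conjc (inv_sqrt_weight w t) = box 0 1 t}.
Proof.
apply: filterS weight_gt0_ae => t wt.
have [t01|t01] := pselect (0 <= t < 1); last by rewrite sqrt_weight_out// box_out// mul0r.
have [fw w0] := wt t01; rewrite /sqrt_weight /inv_sqrt_weight box_in// !mul1r -(fineK fw).
rewrite inver gt_eqF// conjc_real -(rmorphM (real_complex R))/= -sqrtrM ?ltW//.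
by rewrite divff ?sqrtr1// gt_eqF.
Qed.

Lemma integrable_cofactor_quotient h q : L2 h ->
  {ae mu, forall t, 0 <= t < 1 ->
    normc q.[osc 1 t] = normc (sqrt_weight w t) * normc (h t)} ->
  mu.-integrable `[0, 1[ (poly_quotient w q).
Proof.
move=> lh qh; have [_ wge0 _ _] := hw; have mq := measurable_poly_quotient hw q.
have iI : mu.-integrable `[0, 1[ (EFin \o (fun t => normc (h t) ^+ 2)).
  apply: integrableS (integrable_sqr_normc lh) => //; exact: measurable_itv.
apply/integrableP; split; first exact: measurable_funTS.
move/integrableP: iI => [mh ih]; apply: le_lt_trans ih.
apply: ae_ge0_le_integral => //.
- by apply: measurableT_comp => //; exact: measurable_funTS.
- exact: measurableT_comp.
apply: filterS2 qh weight_gt0_ae => t qt wt; rewrite /= in_itv/= => t01.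
have [fw w0] := wt t01.
rewrite gee0_abs; last exact/weight_quotient_ge0/sqr_ge0.
rewrite /poly_quotient /weight_quotient qt// exprMn sqr_normc_sqrt_weight//.
rewrite -{2}(fineK fw) inver gt_eqF// -EFinM lee_fin ger0_norm ?sqr_ge0//.
by rewrite mulrAC divff ?mul1r// gt_eqF.
Qed.

Lemma orthogonal_laurent_coef n (m : nat) h :
  (forall k, ~ (n <= k < n + m%:Z) -> dot (weighted_exp w k) h = 0) ->
  exists2 q : {poly R[i]}, (size q <= m)%N &
    forall k, laurent_coef n q k = conjc (dot (weighted_exp w k) h).
Proof.
move=> oh; exists (\poly_(i < m) conjc (dot (weighted_exp w (n + i%:Z)) h)).
  exact: size_poly.
move=> k; have [kn|kn] := boolP (k \in window n m); last first.
  rewrite (supported_laurent_coef n (size_poly _ _)).2// oh ?conjc0//.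
  by move: kn; rewrite mem_window => /negP.
have /mapP[i iL ->] := kn; rewrite laurent_coefD coef_poly.
by move: iL; rewrite mem_iota add0n => /= ->.
Qed.

Lemma weighted_exp_complete n k :
  closed_span (~` [set j | n <= j < n + L%:Z]) (weighted_exp w) (weighted_exp w k).
Proof.
have lm := L2_weighted_exp hw; apply: contrapT.
move=> /(closed_span_separation lm (lm k))[h [lh oh /eqP]]; apply.
have [q qL qE] := orthogonal_laurent_coef oh.
have cofactor := trig_cofactor hw lh (supported_laurent_coef n qL) qE.
suff q0 : q = 0 by apply/eqP; rewrite -conjc_eq0 -qE q0 /laurent_coef coef0 if_same.
apply: integrable_poly_quotient_eq0 => //; apply: integrable_cofactor_quotient lh _.
apply: filterS cofactor => t; rewrite trig_laurent_coef// => ct t01.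
rewrite -[normc (h t)]normc_conjc -normcM ct normc_conjc box_in// mul1r normcM.
by rewrite normc_osc mul1r.
Qed.

Lemma L2_le_node_poly D (C : R) : cmeasurable D ->
  (forall t, normc (D t) <= C * normc W.[osc 1 t]) -> L2 (fun t => D t * inv_sqrt_weight w t).
Proof.
move=> mD DW; apply: L2_mul_inv_sqrt_weight => //.
apply: (le_integrable_weight_quotient hw (C := C ^+ 2) (measurable_itv _)
  (measurable_sqr_normc mD) _ integrable_node_poly_quotient) => t _.
rewrite sqr_ge0 -exprMn lerXn2r ?nnegrE ?normc_ge0//.
by rewrite (le_trans _ (DW t)) ?normc_ge0.
Qed.

Lemma dot_weighted_exp_trig r c k : supported_on r c ->
  L2 (fun t => trig r c t * inv_sqrt_weight w t) ->
  dot (weighted_exp w k) (fun t => trig r c t * inv_sqrt_weight w t) = conjc (c k).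
Proof.
move=> rc lc; rewrite -(dot_box_osc01_lincomb k rc); apply: ae_eq_cintegral.
- by apply/cintegrable_cmeasurable/cintegrable_mul_conjc => //; exact: L2_weighted_exp.
- apply/cintegrable_cmeasurable/cintegrable_mul_conjc; first exact/L2_box_osc/ltr01.
  by apply: L2_lincomb => j; exact/L2_box_osc/ltr01.
apply: filterS sqrt_weightM_inv_ae => t sqrt_inv.
rewrite conjcM /weighted_exp mulrACA sqrt_inv lincomb_box_osc01 /box_osc subr0 divr1.
have [t01|t01] := pselect (0 <= t < 1); last by rewrite box_out// !(mulr0, mul0r).
by rewrite box_in// !mul1r mulr1.
Qed.

(* Below the window, [osc 1] is inverted modulo [W], whose roots are nonzero. *)
Lemma window_reduction n k : exists (p : {poly R[i]}) (C : R), (size p <= L)%N /\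
  forall t, normc (osc k%:~R t - osc n%:~R t * p.[osc 1 t]) <= C * normc W.[osc 1 t].
Proof.
suff [p [Q [l [pL pQ]]]] : exists (p Q : {poly R[i]}) (l : int), (size p <= L)%N /\
    forall t, osc k%:~R t - osc n%:~R t * p.[osc 1 t] = osc l%:~R t * (W * Q).[osc 1 t].
  have [S S0 SP] := horner_osc_bounded Q; exists p, S; split=> // t.
  by rewrite pQ hornerM !normcM normc_osc mul1r mulrC ler_wpM2r ?normc_ge0.
have oscB (i j : int) t : i <= j -> osc j%:~R t = osc i%:~R t * osc 1 t ^+ `|j - i|%N.
  by move=> ij; rewrite -osc_nat gez0_abs ?subr_ge0// -oscDl -intrD subrKC.
have [nk|/ltW kn] := lerP n k.
  have [p [Q [pL pQ]]] := modp_node_poly (fun j => osc 1 (x j)) lambda 'X^`|k - n|%N.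
  exists p, Q, n; split=> // t.
  by rewrite -pQ hornerD hornerN hornerXn (oscB n k)// mulrBr.
have [p [Q [pL pQ]]] :=
  inv_Xn_modp_node_poly lambda `|n - k|%N (fun j => osc_neq0 1 (x j)).
exists p, Q, k; split=> // t; rewrite -pQ hornerD hornerN hornerM hornerXn hornerC.
by rewrite (oscB k n)// mulrBr mulr1 mulrA.
Qed.

Lemma weighted_exp_minimal n :
  minimal_system (~` [set j | n <= j < n + L%:Z]) (weighted_exp w).
Proof.
apply: biorthogonal_minimal => [k|k _]; first exact: L2_weighted_exp.
have [p [C [pL pC]]] := window_reduction n k.
have sp := supported_laurent_coef n pL.
have sk : supported_on [:: k] (fun j => (j == k)%:R : R[i]) by exact: supported_on1.
pose r := undup (window n L ++ [:: k]).
pose c l := -1 * laurent_coef n p l + (l == k)%:R.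
have sc : supported_on r c := supported_on_linear (-1) sp sk.
have trigE := lincomb_linear (-1) (fun k => osc k%:~R) sp sk.
have lc : L2 (fun t => trig r c t * inv_sqrt_weight w t).
  apply: (L2_le_node_poly (C := C)) => [|t]; first exact: cmeasurable_trig.
  rewrite /trig -trigE lincomb1 -/(trig _ _ _) trig_laurent_coef// mulN1r addrC.
  exact: pC.
exists (fun t => trig r c t * inv_sqrt_weight w t) => // j /= /negP jn.
rewrite dot_weighted_exp_trig// /c sp.2 ?mem_window// mulr0 add0r.
by case: (j == k); rewrite ?conjc1 ?conjc0.
Qed.

Definition node_dual m t : R[i] := osc m%:~R t * W.[osc 1 t] * inv_sqrt_weight w t.

Lemma node_dualE m : node_dual m =
  (fun t => trig (window m L.+1) (laurent_coef m W) t * inv_sqrt_weight w t).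
Proof. by apply/funext => t; rewrite trig_laurent_coef// size_node_poly. Qed.

Lemma L2_node_dual m : L2 (node_dual m).
Proof.
apply: (L2_le_node_poly (C := 1)) => [|t]; last by rewrite normcM normc_osc.
by apply: cmeasurableM; [exact: cmeasurable_osc|exact: cmeasurable_horner_osc].
Qed.

Lemma orthogonal_node_dual_ae h : L2 h -> (forall m, dot h (node_dual m) = 0) ->
  {ae mu, forall t, 0 <= t < 1 -> h t = 0}.
Proof.
move=> lh oh; have : {ae mu, forall t, h t * conjc (node_dual 0 t) = 0}.
  apply: (@fourier_uniqueness R 0 1).
  - exact: cintegrable_mul_conjc (L2_node_dual 0).
  - by move=> t t01; rewrite /node_dual inv_sqrt_weight_out// mulr0 conjc0 mulr0.
  move=> k; rewrite -[RHS](oh (- k)); congr cintegral; apply/funext => t.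
  by rewrite /node_dual !conjcM !conjc_osc subr0 divr1 -!intrN opprK oppr0 osc0l; ring.
apply: filterS3 sqrt_weightM_inv_ae node_poly_osc_neq0_ae => t sqrt_inv Wt + t01.
move/eqP; rewrite mulf_eq0 => /orP[/eqP//|].
rewrite conjc_eq0 /node_dual mulf_eq0 mulf_eq0 (negbTE (osc_neq0 _ _)) (negbTE (Wt t01))/=.
move=> /eqP inv0; move: sqrt_inv; rewrite inv0 conjc0 mulr0 box_in// => /esym/eqP.
by rewrite oner_eq0.
Qed.

Lemma dot_lincomb_node_dual r c m : supported_on r c ->
  dot (lincomb (weighted_exp w) r c) (node_dual m) =
  \sum_(k <- window m L.+1) c k * conjc (laurent_coef m W k).
Proof.
move=> [ur c0]; have lm := L2_weighted_exp hw.
have WL : (size W <= L.+1)%N by rewrite size_node_poly.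
have sW := supported_laurent_coef m WL.
rewrite dot_lincombl//; last exact: L2_node_dual.
rewrite (eq_bigr (fun k => c k * conjc (laurent_coef m W k))); last first.
  move=> k _; rewrite node_dualE dot_weighted_exp_trig ?conjcK//.
  by rewrite -node_dualE; exact: L2_node_dual.
rewrite (@big_supported _ _ _ r (undup (r ++ window m L.+1))) ?undup_uniq//; first last.
- by move=> k /c0 ->; rewrite mul0r.
- by move=> k kr; rewrite mem_undup mem_cat kr.
rewrite -(@big_supported _ _ _ (window m L.+1)) ?undup_uniq//.
- by case: sW.
- by move=> k kW; rewrite mem_undup mem_cat kW orbT.
- by move=> k /sW.2 ->; rewrite conjc0 mulr0.
Qed.

Lemma L2norm_weighted_exp_le r c h : L2 h -> {ae mu, forall t, 0 <= t < 1 -> h t = 0} ->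
  L2norm (lincomb (weighted_exp w) r c) <=
  L2norm (fun t => lincomb (weighted_exp w) r c t - h t).
Proof.
move=> lh h0; have lm := L2_weighted_exp hw; set f := lincomb _ r c.
have lf : L2 f by exact: L2_lincomb.
have lB := L2B lf lh.
have lbox : cmeasurable (fun t => box 0 1 t * (f t - h t)).
  by apply: cmeasurableM; [exact: cmeasurable_box|exact: L2_cmeasurable].
rewrite /L2norm /sqnorm (ae_eq_esqnorm lf.1 lbox).
  rewrite -[leRHS]mul1r; apply: le_L2norm => // t.
  by rewrite normcM ler_wpM2r ?normc_ge0// normc_box_le1.
apply: filterS h0 => t ht; have [t01|t01] := pselect (0 <= t < 1).
  by rewrite ht// subr0 box_in// mul1r.
by rewrite /f lincomb_weighted_exp sqrt_weight_out// box_out// mulr0 mul0r.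
Qed.

(* A limit whose coefficients vanish is orthogonal to every [node_dual m], since each of
   these pairings only involves finitely many coefficients. *)
Lemma weighted_exp_coefficient_total : coefficient_total (weighted_exp w).
Proof.
move=> r c rc cauchy c0; have lm := L2_weighted_exp hw.
have lF (i : nat) : L2 (lincomb (weighted_exp w) (r i) (c i)) by exact: L2_lincomb.
have [G lG FG] := riesz_fischer lF cauchy.
have G0 : {ae mu, forall t, 0 <= t < 1 -> G t = 0}.
  apply: orthogonal_node_dual_ae => // m; apply: (dot_cvg_eq0 lF lG (L2_node_dual m) FG).
  apply: (@squeeze_cvg0 _ _ (fun i => \sum_(k <- window m L.+1)
    normc (c i k) * normc (laurent_coef m W k))) => [i|].
    rewrite normc_ge0 dot_lincomb_node_dual// (le_trans (ler_normc_sum _ _))//.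
    by apply: ler_sum => k _; rewrite normcM normc_conjc.
  rewrite [X in _ --> X](_ : 0 = \sum_(k <- window m L.+1) (0 : R)); last by rewrite big1.
  apply: cvg_big => [|k _]; first exact: add_continuous.
  rewrite -[X in _ --> X](mul0r (normc (laurent_coef m W k))).
  exact: cvgMr_tmp.
apply: squeeze_cvg0 FG => i; rewrite L2norm_ge0; exact: L2norm_weighted_exp_le.
Qed.

End singular_weight.

Theorem proposition3 (R : realType) (phi phihat : R -> R[i])
    (hphi : cLp 2%:E phi)
    (hphihat : is_fourier_transform phi phihat)
    (s : nat) (x : 'I_s -> R) (lambda : 'I_s -> nat)
    (hsing : singularities_exactly (periodization phihat) x lambda)
    (hLambda : (1 <= \sum_(j < s) lambda j)%N)
    (Omega : set int)
    (hOmega : consecutive_integers Omega (\sum_(j < s) lambda j)%N) :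
  M_basis (~` Omega) (translate phi) (shift_space phi).
Proof.
have [n ->] := hOmega; have [/cLp2E lp /cLp2E lh _] := hphihat.
have hw := periodic_weight_periodization lh.
have iso := isometric_translate hphihat.
have lm := L2_weighted_exp hw; have lt k : L2 (translate phi k) by exact: L2_translate.
apply: M_basis_criterion => // [k||].
- exact: isometric_closed_span iso lm lt (weighted_exp_complete hw hsing n k).
- exact/(isometric_minimal iso lm lt)/(weighted_exp_minimal hw hsing).
- exact: isometric_coefficient_total iso (weighted_exp_coefficient_total hw hsing).
Qed.
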